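(* Let $N\geq 2$ and $1\leq m<N-2$ be integers, let $0<a<b<\infty$, and let \[ \Omega:=\{x=(y,z)\in\mathbb{R}^{m+1}\times\mathbb{R}^{N-m-1}: a<|y|<b\}. \] Let $p\geq \frac{2(N-m)}{N-m-2}$. Then the problem \[ -\Delta u=|u|^{p-2}u \text{ in }\Omega,\qquad u=0 \text{ on }\partial\Omega,\qquad |\nabla u|^2,\ |u|^p\in L^1(\Omega), \] has no nontrivial solution $u\in\mathcal{C}^2(\Omega)\cap\mathcal{C}^1(\overline{\Omega})$. *)

(* Defs.v *)
From HB Require Import structures.
From mathcomp Require Import all_boot all_order all_algebra.
From mathcomp Require Import all_classical all_reals all_analysis.
Set Implicit Arguments. Unset Strict Implicit. Unset Printing Implicit Defensive.
Import Order.TTheory GRing.Theory Num.Theory.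
Import numFieldNormedType.Exports.
Local Open Scope classical_set_scope.
Local Open Scope ring_scope.

Definition ebase (R : realType) (N : nat) (i : 'I_N) : 'rV[R]_N :=
  \row_j (i == j)%:R.

Definition partial (R : realType) (N : nat) (i : 'I_N) (u : 'rV[R]_N -> R)
  : 'rV[R]_N -> R := fun x => 'D_(ebase R i) u x.

Definition laplacian (R : realType) (N : nat) (u : 'rV[R]_N -> R) (x : 'rV[R]_N) : R :=
  \sum_(i < N) partial i (partial i u) x.

Definition grad_sq (R : realType) (N : nat) (u : 'rV[R]_N -> R) (x : 'rV[R]_N) : R :=
  \sum_(i < N) (partial i u x) ^+ 2.

Definition C2_on (R : realType) (N : nat) (Om : set 'rV[R]_N) (u : 'rV[R]_N -> R) : Prop :=
  forall x, Om x ->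
    {for x, continuous u} /\
    forall i : 'I_N,
      derivable u x (ebase R i) /\ {for x, continuous (partial i u)} /\
      forall j : 'I_N,
        derivable (partial i u) x (ebase R j) /\
        {for x, continuous (partial j (partial i u))}.

Definition C1_closure (R : realType) (N : nat) (Om : set 'rV[R]_N) (u : 'rV[R]_N -> R) : Prop :=
  (forall x, Om x -> forall i : 'I_N, derivable u x (ebase R i)) /\
  {within closure Om, continuous u} /\
  forall i : 'I_N, exists g : 'rV[R]_N -> R,
    {within closure Om, continuous g} /\ forall x, Om x -> g x = partial i u x.

Definition upd (R : realType) (x : nat -> R) (n : nat) (t : R) : nat -> R :=
  fun k => if k == n then t else x k.

(* iterated Lebesgue integral over R^n of a function of the first n coordinates *)
Fixpoint iter_int (R : realType) (n : nat) (F : (nat -> R) -> \bar R) : \bar R :=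
  match n with
  | 0 => F (fun _ => 0)
  | n'.+1 => (\int[@lebesgue_measure R]_t iter_int n' (fun x => F (upd x n' t)))%E
  end.

(* Lebesgue integral over R^N of a nonnegative function (Tonelli: iterated integral) *)
Definition int_RN (R : realType) (N : nat) (G : 'rV[R]_N -> \bar R) : \bar R :=
  iter_int N (fun x => G (\row_i x (nat_of_ord i))).

Definition L1_nonneg_on (R : realType) (N : nat) (Om : set 'rV[R]_N) (f : 'rV[R]_N -> R) : Prop :=
  (int_RN (fun x => (\1_Om x * f x)%:E) < +oo)%E.

Definition Omega (R : realType) (N m : nat) (a b : R) : set 'rV[R]_N :=
  [set x | a < Num.sqrt (\sum_(i < N | (i < m.+1)%N) x ord0 i ^+ 2) < b].
Arguments Omega {R} N m a b.

(* Main.v *)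
(* Write x = (y, z), r = |y|^2 and k = N - m. The proof is a Pohozaev identity for the
   field chi = (phi(r) y, z), where (m + 1) phi + 2 r phi' = 1 and phi(a^2) = 0: then
   div chi = k, chi is tangent to |y| = a and points outwards on |y| = b, and
   dchi[v, v] <= |v|^2 - m phi |v_y|^2. The field
     G = (chi . grad u) grad u + (|u|^p / p - |grad u|^2 / 2) chi + (k / p) u grad u
   satisfies - div G >= m phi |grad_y u|^2, precisely because p >= 2 k / (k - 2).
   Integrate the divergence of eta zeta G, where eta is a cutoff in y supported inside
   the annulus and zeta a logarithmic cutoff in z. Since grad u is normal on the
   boundary, the term carrying grad eta has a favourable sign in the limit; the term
   carrying grad zeta is small because |z| |grad zeta| is, once the integral of u^2 is
   bounded by a Poincare inequality. Hence grad_y u = 0 and u = 0.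
   Since all fields are compactly supported, only the fact that the integral of a
   partial derivative vanishes is needed; for iterated integrals this follows from
   differentiation under the integral sign, without Fubini's theorem. *)

Require Import Defs.
From HB Require Import structures.
From mathcomp Require Import all_boot all_order all_algebra.
From mathcomp Require Import all_classical all_reals all_analysis.
From mathcomp Require Import ring lra.
Set Implicit Arguments. Unset Strict Implicit. Unset Printing Implicit Defensive.
Import Order.TTheory GRing.Theory Num.Theory.
Import numFieldNormedType.Exports.
Local Open Scope classical_set_scope.
Local Open Scope ring_scope.

(** * One-variable Lebesgue integrals of continuous functions with bounded support *)

Section OneDim.
Context {R : realType}.
Local Notation mu := (@lebesgue_measure R).

(** The gradient of [eta] lives in a layer of width [e], where the boundary integral is replaced by
    a pointwise sign in the limit, uniform by compactness on bounded ranges of |z|, multiplied by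
    the mass of the layer, which is bounded independently of [e]. In [z] an ordinary cutoff would
    need the tails of the energy to be small; the logarithmic one costs [d] times the total energy,
    so an upper bound on the integrals suffices. The parameters are chosen in the order [d],
    [delta], [e]. The threshold 2 k / (k - 2) is the critical Sobolev exponent in dimension k = N -
    m, and p >= 2 k / (k - 2) reads k (1/2 - 1/p) >= 1. The number 1 is the largest eigenvalue of
    dchi: it is 1 in the z directions, phi in the y directions tangent to the sphere, and 1 - m phi
    in the radial direction. The condition phi(a^2) = 0 is forced by the inner sphere, where a
    positive multiple of y points into the domain and has the wrong sign. *)

Definition supported_in (K : R) (g : R -> R) := forall t, K < `|t| -> g t = 0.

Lemma patch_supported (g : R -> R) (K : R) :
  supported_in K g -> (g \_ `[- K, K]%classic) = g.
Proof.
move=> gK; apply/funext => t; rewrite patchE; case: ifPn => // tK.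
rewrite gK//; rewrite ltNge; apply: contra tK => tK.
by rewrite inE /= in_itv /= -ler_norml.
Qed.

Lemma Rintegral_supported (g : R -> R) (K : R) :
  supported_in K g -> \int[mu]_t g t = \int[mu]_(t in `[- K, K]) g t.
Proof. by move=> gK; rewrite [RHS]Rintegral_mkcond patch_supported. Qed.

Lemma integrable_segment (g : R -> R) (x y : R) :
  continuous g -> mu.-integrable `[x, y] (EFin \o g).
Proof.
move=> cg; have cxy : compact (`[x, y]%classic : set R) by exact: segment_compact.
exact: continuous_compact_integrable cxy (continuous_subspaceT cg).
Qed.

Lemma integrable_supported (g : R -> R) (K : R) :
  continuous g -> supported_in K g -> mu.-integrable setT (EFin \o g).
Proof.
move=> cg gK.
have -> : EFin \o g = (EFin \o g) \_ `[- K, K]%classic.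
  by rewrite -{1}(patch_supported gK) restrict_EFin.
apply/(@integrable_mkcond _ _ _ mu `[- K, K]%classic); first exact: measurable_itv.
exact: integrable_segment.
Qed.

Lemma Rintegral_cst_segment (x y c : R) : x <= y ->
  \int[mu]_(t in `[x, y]) c = c * (y - x).
Proof.
move=> xy; rewrite Rintegral_cst; last exact: measurable_itv.
congr (_ * _).
transitivity (fine (if (x%:E < y%:E)%E then y%:E - x%:E else 0)%E).
  congr fine; exact: (lebesgue_measure_itv `[x, y]).
by rewrite lte_fin; case: ltgtP xy => // -> _; rewrite subrr.
Qed.

Lemma Rintegral_bound (g : R -> R) (K B : R) :
  continuous g -> supported_in K g -> 0 <= K -> (forall t, `|g t| <= B) ->
  `|\int[mu]_t g t| <= B * (K *+ 2).
Proof.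
move=> cg gK K0 gB; rewrite (Rintegral_supported gK).
have ig : mu.-integrable `[- K, K] (EFin \o g).
  exact: integrable_segment.
apply: le_trans (@le_normr_Rintegral _ _ _ mu _ g _ ig) _; first exact: measurable_itv.
apply: (@le_trans _ _ (\int[mu]_(t in `[- K, K]) B)).
  apply: le_Rintegral => //; apply: integrable_segment; last exact: cst_continuous.
  by move=> x; apply: continuous_comp; [exact: cg|exact: norm_continuous].
by rewrite Rintegral_cst_segment ?opprK ?mulr2n//; lra.
Qed.

Lemma Rintegral_derive0 (f df : R -> R) (K : R) :
  continuous df -> supported_in K f -> 0 <= K ->
  (forall t : R, is_derive t (1 : R) f (df t)) -> \int[mu]_t df t = 0.
Proof.
move=> cdf fK K0 fdf.
(* The unit margin makes [f] vanish at both endpoints [K + 1] and [- (K + 1)], and near every point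
   beyond them, so that [df] vanishes there too. *)
have K1 : K < K + 1 by lra.
have dfK : supported_in (K + 1) df.
  move=> t Kt; have <- := @derive_val _ _ _ _ _ _ _ (fdf t).
  rewrite (@near_eq_derive _ _ _ f (cst 0)) ?derive_cst//.
  have : \forall s \near t, K < `|s|.
    have := @norm_continuous _ _ t => /cvgrPdist_lt /(_ 1 ltr01).
    apply: filterS => s; rewrite ltr_norml => /andP[? ?]; lra.
  by apply: filterS => s; exact: fK.
rewrite (Rintegral_supported dfK) /Rintegral.
have cf t : {for t, continuous f}.
  by apply/differentiable_continuous/derivable1_diffP; have [] := fdf t.
rewrite (@continuous_FTC2 _ df f).
- have h : `|K + 1| = K + 1 by rewrite ger0_norm; lra.
  have f1 : f (K + 1) = 0 by apply: fK; rewrite h.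
  have f2 : f (- (K + 1)) = 0 by apply: fK; rewrite normrN h.
  by rewrite f1 f2 sube0.
- lra.
- exact: continuous_subspaceT.
- split; first by move=> t _; have [] := fdf t.
    exact: cvg_at_right_filter (cf _).
  exact: cvg_at_left_filter (cf _).
- by move=> t _; rewrite derive1E; have [] := fdf t.
Qed.

Lemma Rintegral_gt0 (g : R -> R) (K t0 : R) :
  continuous g -> supported_in K g -> (forall t, 0 <= g t) -> 0 < g t0 ->
  0 < \int[mu]_t g t.
Proof.
move=> cg gK g0 gt0.
have [d d0 gd] : exists2 d, 0 < d & forall t, t \in `[t0 - d, t0 + d] -> g t0 / 2 <= g t.
  have /cvgrPdist_lt /(_ (g t0 / 2)) := cg t0.
  have g2 : 0 < g t0 / 2 by lra.
  move=> /(_ g2) /nbhs_ballP[e /= e0 He]; exists (e / 2); first by lra.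
  move=> t; rewrite in_itv /= => /andP[t1 t2].
  have /He /= : ball t0 e t by rewrite /ball /= ltr_norml; apply/andP; split; lra.
  by rewrite ltr_norml => /andP[_ ?]; lra.
have ig := integrable_supported cg gK.
apply: (@lt_le_trans _ _ (\int[mu]_(t in `[t0 - d, t0 + d]) (g t0 / 2))).
  by rewrite Rintegral_cst_segment ?mulr_gt0//; lra.
rewrite Rintegral_mkcond; apply: le_Rintegral => //.
  rewrite -restrict_EFin; apply/(@integrable_mkcond _ _ _ mu `[t0 - d, t0 + d]%classic) => //.
  by apply: integrable_segment; exact: cst_continuous.
move=> t _; rewrite patchE; case: ifPn => // tI; apply: gd.
by rewrite inE in tI.
Qed.

End OneDim.

(** * Iterated integrals of uniformly continuous functions with bounded support *)

Section IteratedIntegral.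
Context {R : realType}.
Local Notation mu := (@lebesgue_measure R).
Implicit Types (F G : (nat -> R) -> R) (K B : R).

Lemma is_derive_quotient (f : R -> R) (t l : R) :
  (forall e, 0 < e -> exists2 d, 0 < d &
     forall h, h != 0 -> `|h| < d -> `|h^-1 * (f (t + h) - f t) - l| <= e) ->
  is_derive t (1 : R) f l.
Proof.
move=> H.
have cvl : (fun h : R => h^-1 *: ((f \o shift t) (h *: (1 : R)) - f t)) @ 0^' --> l.
  apply/cvgrPdist_le => e e0; have [d d0 Hd] := H _ e0.
  rewrite near_withinE; apply/nbhs_ballP; exists d => //= h.
  rewrite /ball /= sub0r normrN => hd h0.
  by rewrite distrC /= [h%:A]mulr1 [h + t]addrC; exact: Hd.
apply: DeriveDef; first by apply/cvg_ex; exists l.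
exact: cvg_lim cvl.
Qed.

(* In particular [F x] depends only on the first [n] coordinates of [x]. *)
Definition ucc (n : nat) (K : R) (F : (nat -> R) -> R) :=
  (forall x i, (i < n)%N -> K < `|x i| -> F x = 0) /\
  (forall e, 0 < e -> exists2 d, 0 < d & forall x y,
     (forall i, (i < n)%N -> `|x i - y i| < d) -> `|F x - F y| <= e).

Fixpoint iter_Rint (n : nat) (F : (nat -> R) -> R) : R :=
  match n with
  | 0 => F (fun _ => 0)
  | n'.+1 => \int[mu]_t iter_Rint n' (fun x => F (upd x n' t))
  end.

Lemma updE (x : nat -> R) n t : upd x n t n = t.
Proof. by rewrite /upd eqxx. Qed.

Lemma updNE (x : nat -> R) n t i : (i < n)%N -> upd x n t i = x i.
Proof. by rewrite /upd => /ltn_eqF ->. Qed.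

Lemma upd_id (x : nat -> R) n : upd x n (x n) = x.
Proof. by apply/funext => k; rewrite /upd; case: eqP => [->|]. Qed.

Lemma upd_upd (x : nat -> R) n s t : upd (upd x n s) n t = upd x n t.
Proof. by apply/funext => k; rewrite /upd; case: eqP. Qed.

Lemma upd_comm (x : nat -> R) n i s t : (i < n)%N ->
  upd (upd x n t) i s = upd (upd x i s) n t.
Proof.
move=> lin; apply/funext => k; rewrite /upd.
by case: (eqVneq k n) => [->|//]; rewrite (gtn_eqF lin).
Qed.

Lemma ucc_slice n K F t : ucc n.+1 K F -> ucc n K (fun x => F (upd x n t)).
Proof.
move=> [F0 Fc]; split=> [x i lin xK|e e0].
  by apply: (F0 _ i); rewrite ?updNE// ltnW.
have [d d0 Fd] := Fc _ e0; exists d => // x y xy; apply: Fd => i.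
rewrite ltnS leq_eqVlt => /predU1P[->|lin]; first by rewrite !updE subrr normr0.
by rewrite !updNE// xy.
Qed.

Lemma ucc_lin n K F G c : ucc n K F -> ucc n K G ->
  ucc n K (fun x => c * F x + G x).
Proof.
move=> [F0 Fc] [G0 Gc]; split=> [x i lin xK|e e0].
  by rewrite (F0 _ i)// (G0 _ i)// mulr0 addr0.
have c0 : 0 < 2 * (`|c| + 1) by have := normr_ge0 c; lra.
have [|d1 d10 H1] := Fc (e / (2 * (`|c| + 1))); first by rewrite divr_gt0.
have [|d2 d20 H2] := Gc (e / 2); first by rewrite divr_gt0.
exists (Num.min d1 d2); first by rewrite lt_min d10.
move=> x y xy.
have {}H1 : `|F x - F y| <= e / (2 * (`|c| + 1)).
  by apply: H1 => i /xy; rewrite lt_min => /andP[].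
have {}H2 : `|G x - G y| <= e / 2.
  by apply: H2 => i /xy; rewrite lt_min => /andP[].
have -> : c * F x + G x - (c * F y + G y) = c * (F x - F y) + (G x - G y) by ring.
rewrite (le_trans (ler_normD _ _))// normrM.
have : `|c| * `|F x - F y| <= e / 2; last by lra.
apply: (@le_trans _ _ (`|c| * (e / (2 * (`|c| + 1))))).
  by rewrite ler_wpM2l.
have -> : `|c| * (e / (2 * (`|c| + 1))) = e / 2 * (`|c| / (`|c| + 1)).
  by field; have := normr_ge0 c; lra.
rewrite ger_pMr ?divr_gt0// ler_pdivrMr ?mul1r; first by lra.
by have := normr_ge0 c; lra.
Qed.

Lemma uccW n K K' F : K <= K' -> ucc n K F -> ucc n K' F.
Proof.
move=> KK' [F0 Fc]; split=> // x i lin xK.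
by apply: (F0 x i) => //; exact: le_lt_trans xK.
Qed.

Lemma iter_Rint_slice_supported n K F : ucc n.+1 K F ->
  forall t, K < `|t| -> (fun x => F (upd x n t)) = (fun _ => 0).
Proof.
move=> [F0 _] t Kt; apply/funext => x; apply: (F0 _ n) => //.
by rewrite updE.
Qed.

Lemma iter_Rint0 n : iter_Rint n (fun _ => 0) = 0.
Proof.
elim: n => //= n IH; under eq_Rintegral do rewrite IH.
by rewrite Rintegral_cst// mul0r.
Qed.

Lemma iter_Rint_ge0 n F : (forall x, 0 <= F x) -> 0 <= iter_Rint n F.
Proof.
elim: n F => [F F0|n IH F F0] /=; first exact: F0.
apply: (@Rintegral_ge0 _ _ _ mu setT) => t _.
by apply: IH => x; exact: F0.
Qed.

(** Linearity and the bound in dimension [n] are hypotheses because everything is proved in one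
    induction: integrating in dimension [n.+1] requires continuous slices, and their continuity
    rests on the two facts in dimension [n]. *)
Lemma iter_Rint_slice_continuous_step n :
  (forall K F G c, ucc n K F -> ucc n K G ->
    iter_Rint n (fun x => c * F x + G x) = c * iter_Rint n F + iter_Rint n G) ->
  (forall K F B, 0 <= K -> ucc n K F -> (forall x, `|F x| <= B) ->
    `|iter_Rint n F| <= B * (K *+ 2) ^+ n) ->
  forall K F, ucc n.+1 K F ->
  continuous (fun t => iter_Rint n (fun x => F (upd x n t))).
Proof.
move=> lin bound K F cF t.
pose K1 := Num.max K 0.
have {}cF : ucc n.+1 K1 F by apply: uccW cF; rewrite /K1 le_max lexx.
have K10 : 0 <= K1 by rewrite /K1 le_max lexx orbT.
apply/cvgrPdist_le => e e0.
have K2 : 0 < (K1 *+ 2) ^+ n + 1 by rewrite ltr_wpDl// exprn_ge0// mulrn_wge0.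
have [d d0 Fd] := cF.2 (e / ((K1 *+ 2) ^+ n + 1)) (divr_gt0 e0 K2).
apply/nbhs_ballP; exists d => //= s ts.
have cFt := ucc_slice t cF; have cFs := ucc_slice s cF.
rewrite [leLHS](_ : _ = `|iter_Rint n (fun x => -1 * F (upd x n s) + F (upd x n t))|).
  apply: (@le_trans _ _ (e / ((K1 *+ 2) ^+ n + 1) * (K1 *+ 2) ^+ n)).
    apply: (bound K1) => //; first exact: ucc_lin.
    move=> x; rewrite mulN1r addrC; apply: Fd => i.
    rewrite ltnS leq_eqVlt => /predU1P[->|lin']; first by rewrite !updE.
    by rewrite !updNE// subrr normr0.
  rewrite mulrAC ler_pdivrMr// ler_wpM2l ?ltW//; lra.
by rewrite (lin K1)// mulN1r addrC.
Qed.

Lemma iter_Rint_lin_bound n :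
  (forall K F G c, ucc n K F -> ucc n K G ->
    iter_Rint n (fun x => c * F x + G x) = c * iter_Rint n F + iter_Rint n G) /\
  (forall K F B, 0 <= K -> ucc n K F -> (forall x, `|F x| <= B) ->
    `|iter_Rint n F| <= B * (K *+ 2) ^+ n).
Proof.
elim: n => [|n [IHl IHb]]; first by split=> // K F B _ _ FB; rewrite expr0 mulr1 /= FB.
have supp K F : ucc n.+1 K F ->
    supported_in K (fun t => iter_Rint n (fun x => F (upd x n t))).
  by move=> cF t Kt; rewrite (iter_Rint_slice_supported cF Kt) iter_Rint0.
have cont := @iter_Rint_slice_continuous_step n IHl IHb.
split=> [K F G c cF cG /=|K F B K0 cF FB /=].
  have iF := integrable_supported (cont _ _ cF) (supp _ _ cF).
  have iG := integrable_supported (cont _ _ cG) (supp _ _ cG).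
  have e1 := @RintegralZl _ _ _ mu setT _ c measurableT iF.
  have icF := @integrableZl _ _ _ mu setT measurableT c _ iF.
  have e2 := @RintegralD _ _ _ mu setT _ _ measurableT icF iG.
  rewrite /= in e1 e2; rewrite -e1 -e2.
  apply: eq_Rintegral => t _; apply: (IHl K); exact: ucc_slice.
rewrite exprSr mulrA; apply: Rintegral_bound => //.
- exact: (cont K).
- exact: supp.
- by move=> t; apply: (IHb K) => //; exact: ucc_slice.
Qed.

Lemma iter_Rint_lin n K F G c : ucc n K F -> ucc n K G ->
  iter_Rint n (fun x => c * F x + G x) = c * iter_Rint n F + iter_Rint n G.
Proof. exact: (iter_Rint_lin_bound n).1. Qed.

Lemma iter_Rint_bound n K F B : 0 <= K -> ucc n K F -> (forall x, `|F x| <= B) ->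
  `|iter_Rint n F| <= B * (K *+ 2) ^+ n.
Proof. exact: (iter_Rint_lin_bound n).2. Qed.

End IteratedIntegral.

(** * Positivity, comparison and differentiation of iterated integrals *)

Section IteratedDerivative.
Context {R : realType}.
Local Notation mu := (@lebesgue_measure R).
Implicit Types (F G : (nat -> R) -> R) (K B : R).

Lemma iter_Rint_slice_continuous n K F : ucc n.+1 K F ->
  continuous (fun t => iter_Rint n (fun x => F (upd x n t))).
Proof.
have [lin bound] := @iter_Rint_lin_bound R n.
exact: iter_Rint_slice_continuous_step lin bound K F.
Qed.

Lemma iter_Rint_slice_supp n K F : ucc n.+1 K F ->
  supported_in K (fun t => iter_Rint n (fun x => F (upd x n t))).
Proof.
by move=> cF t Kt; rewrite (iter_Rint_slice_supported cF Kt) iter_Rint0.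
Qed.

Lemma iter_Rint_gt0 n K F x0 : ucc n K F -> (forall x, 0 <= F x) ->
  (forall x y, (forall i, (i < n)%N -> x i = y i) -> F x = F y) ->
  0 < F x0 -> 0 < iter_Rint n F.
Proof.
elim: n F => [F _ _ Fext F0 /=|n IH F cF F0 Fext Fx0 /=].
  by rewrite (Fext _ x0).
apply: (@Rintegral_gt0 _ _ K (x0 n)).
- exact: iter_Rint_slice_continuous cF.
- exact: iter_Rint_slice_supp.
- by move=> t; apply: iter_Rint_ge0 => x; exact: F0.
apply: IH => //; first exact: ucc_slice.
  move=> x y xy; apply: Fext => i.
  rewrite ltnS leq_eqVlt => /predU1P[->|lin]; first by rewrite !updE.
  by rewrite !updNE// xy.
by rewrite upd_id.
Qed.

(** The bridge to the extended-valued integral of the statement: at each level the inner integral is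
    finite, its slices being continuous with bounded support. *)
Lemma iter_int_EFin n K F : ucc n K F ->
  iter_int n (fun x => (F x)%:E) = (iter_Rint n F)%:E.
Proof.
elim: n F => [//|n IH] F cF /=.
under eq_integral do rewrite (IH _ (ucc_slice _ cF)).
rewrite fineK//.
apply: (integrable_fin_num (mu := mu) measurableT).
exact: integrable_supported (iter_Rint_slice_continuous cF) (iter_Rint_slice_supp cF).
Qed.

Lemma iter_int_ge0 n (F : (nat -> R) -> \bar R) :
  (forall x, 0 <= F x)%E -> (0 <= iter_int n F)%E.
Proof.
elim: n F => [F F0|n IH F F0] /=; first exact: F0.
by apply: integral_ge0 => t _; apply: IH => x; exact: F0.
Qed.

(* No measurability is assumed: the integral of a nonnegative function is a
   supremum over the simple functions below it. *)
Lemma iter_int_le n (F G : (nat -> R) -> \bar R) :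
  (forall x, 0 <= F x)%E -> (forall x, F x <= G x)%E ->
  (iter_int n F <= iter_int n G)%E.
Proof.
elim: n F G => [F G _ FG|n IH F G F0 FG] /=; first exact: FG.
have G0 x : (0 <= G x)%E by exact: le_trans (FG x).
rewrite !ge0_integralTE; first last.
- by move=> t; apply: iter_int_ge0 => x; exact: F0.
- by move=> t; apply: iter_int_ge0 => x; exact: G0.
apply: le_ereal_sup => _ [h hF <-]; exists h => // t.
by apply: le_trans (hF t) _; apply: IH => x; [exact: F0|exact: FG].
Qed.

(** The mean value theorem turns the error of the difference quotient into [DF] at a nearby point
    minus [DF] at [t]. Uniform continuity makes this small uniformly in [x], so [iter_Rint_bound]
    replaces dominated convergence. *)
Lemma is_derive_iter_Rint n K F DF t : 0 <= K ->
  ucc n.+1 K F -> ucc n.+1 K DF ->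
  (forall x, is_derive (x n) (1 : R) (fun s => F (upd x n s)) (DF x)) ->
  is_derive t (1 : R) (fun s => iter_Rint n (fun x => F (upd x n s)))
    (iter_Rint n (fun x => DF (upd x n t))).
Proof.
move=> K0 cF cDF FDF; apply: is_derive_quotient => e e0.
have K2 : 0 < (K *+ 2) ^+ n + 1 by rewrite ltr_wpDl// exprn_ge0// mulrn_wge0.
have [d d0 DFd] := cDF.2 (e / ((K *+ 2) ^+ n + 1)) (divr_gt0 e0 K2).
exists d => // h h0 hd.
have cFt := ucc_slice t cF; have cFh := ucc_slice (t + h) cF.
have cDt := ucc_slice t cDF.
(* The zero summand gives the scaled difference the shape [c * F + G] required by [ucc_lin] and
   [iter_Rint_lin]. *)
have cz : ucc n K (fun _ : nat -> R => 0).
  by split=> // e' e'0; exists 1 => // x y _; rewrite subrr normr0 ltW.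
rewrite [leLHS](_ : _ = `|iter_Rint n (fun x => -1 * DF (upd x n t) +
   (h^-1 * (-1 * F (upd x n t) + F (upd x n (t + h))) + 0))|).
  apply: (@le_trans _ _ (e / ((K *+ 2) ^+ n + 1) * (K *+ 2) ^+ n)).
    apply: (@iter_Rint_bound _ _ K) => //.
      by do ?apply: ucc_lin.
    move=> x.
    have Fs s : is_derive s (1 : R) (fun s => F (upd x n s)) (DF (upd x n s)).
      have := FDF (upd x n s); rewrite updE.
      by under eq_fun do rewrite upd_upd.
    have Fcont a b : {within `[a, b], continuous (fun s => F (upd x n s))}.
      apply: continuous_subspaceT => s.
      by apply/differentiable_continuous/derivable1_diffP; have [] := Fs s.
    have [c /andP[c1 c2] ->] : exists2 c, t - `|h| <= c <= t + `|h| &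
        -1 * F (upd x n t) + F (upd x n (t + h)) = DF (upd x n c) * h.
      have [h1|h1|] := ltgtP h 0; last by move=> h1; rewrite h1 eqxx in h0.
        have th : t + h <= t by lra.
        have [c] := MVT_segment th (fun s _ => Fs s) (Fcont _ _).
        rewrite in_itv /= => /andP[c1 c2] ec; exists c.
          by rewrite ltr0_norm//; apply/andP; split; lra.
        have -> : DF (upd x n c) * h = - (DF (upd x n c) * (t - (t + h))) by ring.
        by rewrite -ec; ring.
      have th : t <= t + h by lra.
      have [c] := MVT_segment th (fun s _ => Fs s) (Fcont _ _).
      rewrite in_itv /= => /andP[c1 c2] ec; exists c.
        by rewrite gtr0_norm//; apply/andP; split; lra.
      have -> : DF (upd x n c) * h = (DF (upd x n c) * (t + h - t)) by ring.
      by rewrite -ec; ring.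
    have -> : -1 * DF (upd x n t) + (h^-1 * (DF (upd x n c) * h) + 0) =
      DF (upd x n c) - DF (upd x n t) by field.
    apply: DFd => i.
    rewrite ltnS leq_eqVlt => /predU1P[->|lin].
      by rewrite !updE ltr_norml; apply/andP; split; lra.
    by rewrite !updNE// subrr normr0.
  rewrite mulrAC ler_pdivrMr// ler_wpM2l ?ltW//; lra.
have c1 : ucc n K (fun x => -1 * F (upd x n t) + F (upd x n (t + h))).
  exact: ucc_lin.
have c2 := ucc_lin h^-1 c1 cz.
rewrite (iter_Rint_lin (-1) cDt c2) (iter_Rint_lin h^-1 c1 cz).
by rewrite (iter_Rint_lin (-1) cFt cFh) iter_Rint0; congr `|_|; ring.
Qed.

(** If [i] is the outermost variable, the fundamental theorem of calculus applies to the integral of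
    the slices; otherwise every slice integrates to zero by induction. *)
Lemma iter_Rint_derive0 n i K F DF : 0 <= K -> (i < n)%N ->
  ucc n K F -> ucc n K DF ->
  (forall x, is_derive (x i) (1 : R) (fun s => F (upd x i s)) (DF x)) ->
  iter_Rint n DF = 0.
Proof.
move=> K0; elim: n F DF => // n IH F DF + cF cDF FDF.
rewrite ltnS leq_eqVlt => /predU1P[ein|lin] /=.
  subst i.
  apply: (@Rintegral_derive0 _ (fun t => iter_Rint n (fun x => F (upd x n t)))
    _ K) => //.
  - exact: iter_Rint_slice_continuous cDF.
  - exact: iter_Rint_slice_supp cF.
  - by move=> t; exact: is_derive_iter_Rint K0 cF cDF FDF.
have z t : iter_Rint n (fun x => DF (upd x n t)) = 0.
  apply: (IH (fun x => F (upd x n t))) => //; [exact: ucc_slice..|].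
  move=> x; have := FDF (upd x n t); rewrite updNE//.
  by under eq_fun do rewrite upd_comm//.
under eq_Rintegral do rewrite z.
by rewrite Rintegral_cst// mul0r.
Qed.

End IteratedDerivative.

(** * Properties inherited by pointwise finite sums *)

Section SumInduction.
Context {R : realType} {T I : Type} (r : seq I) (P : pred I).

Lemma fun_sum_cons (i : I) (q : seq I) (h : I -> T -> R) :
  (fun x => \sum_(j <- i :: q | P j) h j x) =
  if P i then fun x => h i x + \sum_(j <- q | P j) h j x
  else fun x => \sum_(j <- q | P j) h j x.
Proof. by apply/funext => x; rewrite big_cons; case: ifP. Qed.

Lemma fun_sum_nil (h : I -> T -> R) :
  (fun x => \sum_(j <- [::] | P j) h j x) = (fun _ => 0).
Proof. by apply/funext => x; rewrite big_nil. Qed.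

Lemma fun_sum_ind (Q : (T -> R) -> Prop) (h : I -> T -> R) :
  Q (fun _ => 0) -> (forall f g, Q f -> Q g -> Q (fun x => f x + g x)) ->
  (forall i, P i -> Q (h i)) -> Q (fun x => \sum_(i <- r | P i) h i x).
Proof.
move=> Q0 QD Qh; elim: r => [|i q IH]; first by rewrite fun_sum_nil.
rewrite fun_sum_cons; case: ifPn => [Pi|_]; last exact: IH.
by apply: QD; [exact: Qh|exact: IH].
Qed.

End SumInduction.

(** * Directional derivatives as derivatives along a line *)

Section Line.
Context {R : realType} {V : normedModType R}.

Lemma line_quotient (f : V -> R) (x v : V) (t : R) :
  (fun h => h^-1 *: ((f \o shift (x + t *: v)) (h *: v) - f (x + t *: v))) =
  (fun h => h^-1 *: (((fun s => f (x + s *: v)) \o shift t) (h *: (1 : R)) -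
     f (x + t *: v))).
Proof.
by apply/funext => h /=; rewrite [h%:A]mulr1 scalerDl addrCA.
Qed.

Lemma derivable_line (f : V -> R) (x v : V) (t : R) :
  derivable f (x + t *: v) v -> derivable (fun s : R => f (x + s *: v)) t (1 : R).
Proof. by rewrite /derivable line_quotient. Qed.

Lemma derive_line (f : V -> R) (x v : V) (t : R) :
  'D_v f (x + t *: v) = 'D_(1 : R) (fun s : R => f (x + s *: v)) t.
Proof. by rewrite /derive line_quotient. Qed.

Lemma is_derive_line (f : V -> R) (x v : V) (t : R) :
  derivable f (x + t *: v) v ->
  is_derive t (1 : R) (fun s => f (x + s *: v)) ('D_v f (x + t *: v)).
Proof. by move=> fv; apply: DeriveDef; [exact: derivable_line|rewrite derive_line]. Qed.

End Line.

(** * The integral of compactly supported continuous functions on row vectors *)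

Section RowIntegral.
Context {R : realType} {N : nat}.
Implicit Types (f g : 'rV[R]_N -> R) (K : R).

Definition row_of (x : nat -> R) : 'rV[R]_N := \row_i x (nat_of_ord i).

Definition Lint f : R := iter_Rint N (fun x => f (row_of x)).

Definition Cc f := continuous f /\
  exists K, forall (x : 'rV[R]_N) i, K < `|x ord0 i| -> f x = 0.

Lemma row_ballP (x y : 'rV[R]_N) d : 0 < d ->
  (forall i, `|x ord0 i - y ord0 i| < d) <-> ball x d y.
Proof.
move=> d0; split=> [xy|[_ xy] i]; last exact: xy.
by split=> // j i; rewrite ord1; exact: xy.
Qed.

Lemma Cc_heine f : Cc f -> forall e, 0 < e -> exists2 d, 0 < d &
  forall x y : 'rV[R]_N, (forall i, `|x ord0 i - y ord0 i| < d) -> `|f x - f y| <= e.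
Proof.
move=> [cf [K fK]] e e0.
have cB : compact [set v : 'rV[R]_N | forall i, v ord0 i \in `[- (K + 1), K + 1]].
  apply: (@rV_compact _ _ (fun=> `[- (K + 1), (K + 1)]%classic)).
  by move=> _; exact: segment_compact.
pose P (d : R) (x : 'rV[R]_N) := forall y, ball x d y -> `|f x - f y| <= e.
move/compact_near_coveringP : cB => /(_ R 0^'+ P _).
have : forall x, [set v : 'rV[R]_N | forall i, v ord0 i \in `[- (K + 1), K + 1]] x ->
    \forall x' \near x & i \near 0^'+, P i x'.
  move=> x _; have /cvgrPdist_lt /(_ (e / 2) (divr_gt0 e0 (ltr0Sn _ 1))) := cf x.
  move=> /nbhs_ballP[d /= d0 fd].
  exists (ball x (d / 2), [set r | r < d / 2]) => /=.
    split; first by apply: nbhsx_ballx; rewrite divr_gt0.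
    by apply: nbhs_right_lt; rewrite divr_gt0.
  move=> [x' r] /= [xx' rd] y x'y.
  have h1 : `|f x - f x'| < e / 2.
    by apply: fd; apply: le_ball xx'; lra.
  have h2 : `|f x - f y| < e / 2.
    apply: fd; have -> : d = d / 2 + d / 2 by lra.
    by apply: ball_triangle xx' _; apply: le_ball x'y; exact: ltW.
  rewrite (_ : f x' - f y = (f x - f y) - (f x - f x')); last by ring.
  by rewrite (le_trans (ler_normB _ _))//; lra.
move=> h /(_ h) [r /= r0 Hr].
(* The bound [1] settles the points [x] outside the box of half-width [K + 1]: a neighbour [y] still
   has a coordinate beyond [K], and both values vanish. *)
exists (Num.min (r / 2) 1); first by rewrite lt_min ltr01 divr_gt0.
move=> x y xy.
have [xK|/existsNP[i xiK]] := pselect (forall i, x ord0 i \in `[- (K + 1), K + 1]).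
  apply: (Hr (r / 2)) => //=.
  - by rewrite sub0r normrN gtr0_norm ?divr_gt0//; lra.
  - by rewrite divr_gt0.
  apply/row_ballP; first by rewrite divr_gt0.
  by move=> i; have := xy i; rewrite lt_min => /andP[].
have {}xiK : K + 1 < `|x ord0 i|.
  rewrite ltNge; apply/negP => xK; apply: xiK.
  by rewrite in_itv /= -ler_norml.
rewrite (fK x i) ?(fK y i) ?subrr ?normr0 ?ltW//; last by lra.
have := xy i; rewrite lt_min => /andP[_].
have : `|x ord0 i| <= `|x ord0 i - y ord0 i| + `|y ord0 i|.
  by rewrite -[X in `|X| <= _](subrK (y ord0 i)) ler_normD.
lra.
Qed.

Lemma Cc_ucc f : Cc f -> exists2 K, 0 <= K & ucc N K (fun x => f (row_of x)).
Proof.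
move=> cf; have [_ [K fK]] := cf; exists (Num.max K 0); first by rewrite le_max lexx orbT.
split=> [x i iN|e e0].
  rewrite gt_max => /andP[xK _]; apply: (fK _ (Ordinal iN)).
  by rewrite mxE.
have [d d0 fd] := Cc_heine cf e0; exists d => // x y xy; apply: fd => i.
by rewrite !mxE; exact: xy.
Qed.

Lemma Lint_lin f g c : Cc f -> Cc g ->
  Lint (fun x => c * f x + g x) = c * Lint f + Lint g.
Proof.
move=> /Cc_ucc[K _ cf] /Cc_ucc[K' _ cg].
apply: (iter_Rint_lin (K := Num.max K K')).
  by apply: uccW cf; rewrite le_max lexx.
by apply: uccW cg; rewrite le_max lexx orbT.
Qed.

Lemma Cc0 : Cc (fun _ => 0).
Proof. by split; [exact: cst_continuous|exists 0]. Qed.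

Lemma CcM f g : Cc f -> continuous g -> Cc (fun x => g x * f x).
Proof.
move=> [cf [K fK]] cg; split; last first.
  by exists K => x i xK; rewrite (fK x i)// mulr0.
by move=> x; apply: continuousM; [exact: cg|exact: cf].
Qed.

Lemma CcZ f c : Cc f -> Cc (fun x => c * f x).
Proof. by move=> cf; apply: CcM => //; exact: cst_continuous. Qed.

Lemma CcD f g : Cc f -> Cc g -> Cc (fun x => f x + g x).
Proof.
move=> [cf [K fK]] [cg [K' gK]]; split.
  by move=> x; apply: continuousD; [exact: cf|exact: cg].
exists (Num.max K K') => x i; rewrite gt_max => /andP[xK xK'].
by rewrite (fK x i)// (gK x i)// addr0.
Qed.

Lemma Cc_sum (I : Type) (r : seq I) (P : pred I) (h : I -> 'rV[R]_N -> R) :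
  (forall i, P i -> Cc (h i)) -> Cc (fun x => \sum_(i <- r | P i) h i x).
Proof. by move=> ch; apply: fun_sum_ind => //; [exact: Cc0|exact: CcD]. Qed.

Lemma Lint0 : Lint (fun _ => 0) = 0.
Proof. exact: iter_Rint0. Qed.

Lemma LintD f g : Cc f -> Cc g -> Lint (fun x => f x + g x) = Lint f + Lint g.
Proof.
move=> cf cg; rewrite -[Lint f]mul1r -Lint_lin//; congr Lint.
by apply/funext => x; rewrite mul1r.
Qed.

Lemma LintZ f c : Cc f -> Lint (fun x => c * f x) = c * Lint f.
Proof.
move=> cf; rewrite -[RHS]addr0 -Lint0 -Lint_lin//; last exact: Cc0.
by congr Lint; apply/funext => x; rewrite addr0.
Qed.

Lemma Lint_sum (I : Type) (r : seq I) (P : pred I) (h : I -> 'rV[R]_N -> R) :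
  (forall i, P i -> Cc (h i)) ->
  Lint (fun x => \sum_(i <- r | P i) h i x) = \sum_(i <- r | P i) Lint (h i).
Proof.
move=> ch; elim: r => [|i q IH]; first by rewrite fun_sum_nil big_nil Lint0.
rewrite fun_sum_cons big_cons; case: ifPn => // Pi.
by rewrite LintD ?IH//; [exact: ch|exact: Cc_sum].
Qed.

Lemma Lint_ge0 f : (forall x, 0 <= f x) -> 0 <= Lint f.
Proof. by move=> f0; exact: iter_Rint_ge0. Qed.

Lemma Lint_le f g : Cc f -> Cc g -> (forall x, f x <= g x) -> Lint f <= Lint g.
Proof.
move=> cf cg fg; rewrite -subr_ge0 addrC -mulN1r -Lint_lin//.
by apply: Lint_ge0 => x; rewrite mulN1r addrC subr_ge0.
Qed.

Lemma Lint_gt0 f x : Cc f -> (forall x, 0 <= f x) -> 0 < f x -> 0 < Lint f.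
Proof.
move=> /Cc_ucc[K _ cf] f0 fx.
pose xs (k : nat) := if insub k is Some i then x ord0 i else 0.
apply: (@iter_Rint_gt0 _ _ K _ xs) => //.
  move=> y z yz; congr f; apply/rowP => i; rewrite !mxE; exact: yz.
suff -> : row_of xs = x by [].
by apply/rowP => i; rewrite mxE /xs valK.
Qed.

Lemma Lint_derive0 f (i : 'I_N) : Cc f -> (forall x, derivable f x (ebase R i)) ->
  Cc (partial i f) -> Lint (partial i f) = 0.
Proof.
move=> /Cc_ucc[K K0 cf] df /Cc_ucc[K' K'0 cdf].
apply: (@iter_Rint_derive0 _ _ i (Num.max K K') (fun x => f (row_of x))) => //.
- by rewrite le_max K0.
- by apply: uccW cf; rewrite le_max lexx.
- by apply: uccW cdf; rewrite le_max lexx orbT.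
move=> x; have rowE s : row_of (upd x i s) = row_of (upd x i 0) + s *: ebase R i.
  apply/rowP => j; rewrite !mxE /upd.
  have [->|ij] := eqVneq i j; first by rewrite eqxx add0r mulr1.
  by rewrite mulr0 addr0 !ifN_eq// eq_sym.
under eq_fun do rewrite rowE.
have -> : row_of x = row_of (upd x i 0) + x i *: ebase R i by rewrite -rowE upd_id.
exact: (@is_derive_line R _ f (row_of (upd x i 0)) (ebase R i) (x i) (df _)).
Qed.

(** This is how the integrability hypotheses enter: a cut-off energy density is compared, by
    monotonicity alone, with the extended-valued integral assumed finite. *)
Lemma Lint_le_int_RN f (g : 'rV[R]_N -> R) : Cc f ->
  (forall x, 0 <= f x <= g x) ->
  (int_RN (fun x => (g x)%:E) < +oo)%E ->
  Lint f <= fine (int_RN (fun x => (g x)%:E)).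
Proof.
move=> /Cc_ucc[K _ cf] fg goo.
have h : ((Lint f)%:E <= int_RN (fun x => (g x)%:E))%E.
  rewrite -(iter_int_EFin cf); apply: iter_int_le => x; rewrite lee_fin;
  by case/andP: (fg (row_of x)).
by rewrite -lee_fin fineK// ge0_fin_numE// (le_trans _ h)// lee_fin;
  apply: Lint_ge0 => x; case/andP: (fg x).
Qed.

End RowIntegral.

(** * The chain rule for directional derivatives *)

Section Chain.
Context {R : realType} {V : normedModType R}.

(** Only a directional derivative of [f] is given, not differentiability, so the one-variable chain
    rule is applied to the restriction of [f] to the line through [x]. *)
Lemma is_derive_comp1 (g : R -> R) (f : V -> R) (x v : V) (df dg : R) :
  is_derive x v f df -> is_derive (f x) (1 : R) g dg ->
  is_derive x v (fun y => g (f y)) (dg * df).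
Proof.
move=> [fx <-] [gx <-].
have lineE (h : V -> R) : (fun t => t^-1 *: ((h \o shift x) (t *: v) - h x)) =
    (fun t => t^-1 *: (((fun s => h (s *: v + x)) \o shift (0:R)) (t *: (1 : R)) - h (0 *: v + x))).
  by apply/funext => t /=; rewrite [t%:A]mulr1 addr0 scale0r add0r.
have dl : derivable (fun s : R => f (s *: v + x)) 0 1.
  exact: (derivable1P f x v).1 fx.
have fx0 : f (0 *: v + x) = f x by rewrite scale0r add0r.
have gl : derivable g (f (0 *: v + x)) 1 by rewrite fx0.
have E : 'D_(1 : R) (fun s : R => f (s *: v + x)) 0 = 'D_v f x.
  by rewrite /derive lineE.
have E' : 'D_(1 : R) (fun s : R => g (f (s *: v + x))) 0 = 'D_v (fun y => g (f y)) x.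
  by rewrite /derive (lineE (fun y => g (f y))).
apply: DeriveDef.
  apply: (derivable1P (fun y => g (f y)) x v).2; apply/derivable1_diffP.
  by apply: (@differentiable_comp _ _ _ _ (fun s : R => f (s *: v + x)) g);
    exact/derivable1_diffP.
rewrite -E' -E -!derive1E.
have := derive1_comp dl gl; rewrite fx0 => <-.
by [].
Qed.

End Chain.

(** * Functions with continuous partial derivatives on an open set *)

Section C1.
Context {R : realType} {N : nat} (O : set 'rV[R]_N) (oO : open O).
Implicit Types (f g : 'rV[R]_N -> R) (x : 'rV[R]_N).

Lemma near_continuous f g x : {for x, continuous g} ->
  (\forall y \near x, g y = f y) -> {for x, continuous f}.
Proof.
move=> cg gf; rewrite /prop_for /continuous_at -(nbhs_singleton gf).
exact: cvg_trans (@near_eq_cvg _ _ (nbhs x) _ g f gf) cg.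
Qed.

Lemma near_open x : O x -> \forall y \near x, O y.
Proof. by move=> Ox; exact: open_nbhs_nbhs. Qed.

Definition C1_on f := forall x, O x -> {for x, continuous f} /\
  forall i, derivable f x (ebase R i) /\ {for x, continuous (partial i f)}.

Lemma C1_is_derive f i x : C1_on f -> O x -> is_derive x (ebase R i) f (partial i f x).
Proof. by move=> Cf Ox; apply: DeriveDef => //; have [_ /(_ i)[]] := Cf x Ox. Qed.

Lemma C1_continuous f x : C1_on f -> O x -> {for x, continuous f}.
Proof. by move=> Cf /Cf[]. Qed.

Lemma C1_continuous_partial f i x : C1_on f -> O x -> {for x, continuous (partial i f)}.
Proof. by move=> Cf /Cf[_ /(_ i)[]]. Qed.

Lemma C1_of f (df : 'I_N -> 'rV[R]_N -> R) :
  (forall x, O x -> {for x, continuous f}) ->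
  (forall i x, O x -> is_derive x (ebase R i) f (df i x)) ->
  (forall i x, O x -> {for x, continuous (df i)}) -> C1_on f.
Proof.
move=> cf fdf cdf x Ox; split=> [|i]; first exact: cf.
split; first by have [] := fdf i x Ox.
apply: (near_continuous (cdf i x Ox)).
by apply: filterS (near_open Ox) => y /(fdf i)[].
Qed.

Lemma C1_cst c : C1_on (fun _ => c).
Proof.
by apply: (@C1_of _ (fun _ _ => 0)) => *; exact: cst_continuous.
Qed.

Lemma is_derive_coord (i j : 'I_N) x :
  is_derive x (ebase R i) (fun y : 'rV[R]_N => y ord0 j) (i == j)%:R.
Proof.
have lin : (fun h => h^-1 *: (((fun y : 'rV[R]_N => y ord0 j) \o shift x) (h *: ebase R i) - x ord0 j))
   @ 0^' --> ((i == j)%:R : R).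
  apply/cvgrPdist_le => e e0; near=> h.
  have h0 : h != 0 by near: h; exact: nbhs_dnbhs_neq.
  rewrite /= !mxE addrK scalerA mulVf// scale1r subrr normr0 ltW//.
by apply: DeriveDef; [apply/cvg_ex; exists (i == j)%:R|exact: cvg_lim lin].
Unshelve. all: by end_near. Qed.

Lemma C1_coord (j : 'I_N) : C1_on (fun y : 'rV[R]_N => y ord0 j).
Proof.
apply: (@C1_of _ (fun i _ => (i == j)%:R)) => [x _|i x _|i x _].
- exact: coord_continuous.
- exact: is_derive_coord.
- exact: cst_continuous.
Qed.

Lemma is_derive_add f g x v df dg : is_derive x v f df -> is_derive x v g dg ->
  is_derive x v (fun y => f y + g y) (df + dg).
Proof. exact: is_deriveD. Qed.

Lemma is_derive_mul f g x v df dg : is_derive x v f df -> is_derive x v g dg ->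
  is_derive x v (fun y => f y * g y) (df * g x + f x * dg).
Proof.
move=> fx gx; apply: (is_derive_eq (is_deriveM fx gx)).
by rewrite /GRing.scale /= addrC mulrC.
Qed.

Lemma is_derive_bigsum (I : Type) (r : seq I) (P : pred I) (h dh : I -> 'rV[R]_N -> R) x v :
  (forall i, P i -> is_derive x v (h i) (dh i x)) ->
  is_derive x v (fun y => \sum_(i <- r | P i) h i y) (\sum_(i <- r | P i) dh i x).
Proof.
move=> hd; elim: r => [|i q IH]; first by rewrite fun_sum_nil big_nil; exact: is_derive_cst.
rewrite fun_sum_cons big_cons; case: ifPn => // Pi.
exact: (is_derive_add (hd i Pi) IH).
Qed.

Lemma C1D f g : C1_on f -> C1_on g -> C1_on (fun x => f x + g x).
Proof.
move=> Cf Cg.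
apply: (@C1_of _ (fun i x => partial i f x + partial i g x)) => [x Ox|i x Ox|i x Ox].
- by apply: continuousD; exact: C1_continuous.
- by apply: is_derive_add; exact: C1_is_derive.
- by apply: continuousD; exact: C1_continuous_partial.
Qed.

Lemma C1M f g : C1_on f -> C1_on g -> C1_on (fun x => f x * g x).
Proof.
move=> Cf Cg.
apply: (@C1_of _ (fun i x => partial i f x * g x + f x * partial i g x)) => [x Ox|i x Ox|i x Ox].
- by apply: continuousM; exact: C1_continuous.
- by apply: is_derive_mul; exact: C1_is_derive.
- by apply: continuousD; apply: continuousM;
    first [exact: C1_continuous_partial|exact: C1_continuous].
Qed.

Lemma C1_comp (g g' : R -> R) f : C1_on f ->
  (forall x, O x -> is_derive (f x) (1 : R) g (g' (f x))) ->
  (forall x, O x -> {for f x, continuous g'}) -> C1_on (fun x => g (f x)).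
Proof.
move=> Cf gg' cg'.
have cgf x : O x -> {for f x, continuous g}.
  by move=> Ox; apply/differentiable_continuous/derivable1_diffP; have [] := gg' x Ox.
apply: (@C1_of _ (fun i x => g' (f x) * partial i f x)) => [x Ox|i x Ox|i x Ox].
- by apply: continuous_comp; [exact: C1_continuous|exact: cgf].
- by apply: is_derive_comp1; [exact: C1_is_derive|exact: gg'].
- apply: continuousM; last exact: C1_continuous_partial.
  by apply: (@continuous_comp _ _ _ f g'); [exact: C1_continuous|exact: cg'].
Qed.

Lemma C1_sum (I : Type) (r : seq I) (P : pred I) (h : I -> 'rV[R]_N -> R) :
  (forall i, P i -> C1_on (h i)) -> C1_on (fun x => \sum_(i <- r | P i) h i x).
Proof. by move=> ch; apply: fun_sum_ind; [exact: C1_cst|exact: C1D|exact: ch]. Qed.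

Lemma line_MVT f x (v : 'rV[R]_N) T :
  (forall s : R, `|s| <= `|T| -> derivable f (x + s *: v) v) ->
  exists2 c, `|c| <= `|T| & f (x + T *: v) - f x = T * 'D_v f (x + c *: v).
Proof.
move=> fv.
have fx0 : f (x + 0 *: v) = f x by rewrite scale0r addr0.
have dl s : `|s| <= `|T| -> is_derive s (1 : R) (fun s => f (x + s *: v)) ('D_v f (x + s *: v)).
  by move=> sT; apply: is_derive_line; exact: fv.
have cl p q : (forall s, p <= s <= q -> `|s| <= `|T|) ->
    {within `[p, q], continuous (fun s : R => f (x + s *: v))}.
  move=> H; apply: derivable_within_continuous => s; rewrite in_itv /= => /H /dl.
  by case.
have [T0|T0] := leP 0 T.
  have H s : 0 <= s <= T -> `|s| <= `|T|.
    by move=> /andP[s0 sT]; rewrite !ger0_norm.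
  have dd s : s \in `]0, T[ ->
    is_derive s (1 : R) (fun s => f (x + s *: v)) ('D_v f (x + s *: v)).
    rewrite in_itv /= => /andP[s0 sT]; apply: dl; apply: H; lra.
  have [c] := MVT_segment T0 dd (cl _ _ H).
  rewrite in_itv /= => cT e; exists c; first exact: H.
  by rewrite -fx0 e subr0 mulrC.
have H s : T <= s <= 0 -> `|s| <= `|T|.
  by move=> /andP[s0 sT]; rewrite !ler0_norm//; lra.
have dd s : s \in `]T, 0[ ->
    is_derive s (1 : R) (fun s => f (x + s *: v)) ('D_v f (x + s *: v)).
    rewrite in_itv /= => /andP[s0 sT]; apply: dl; apply: H; lra.
have [c] := MVT_segment (ltW T0) dd (cl _ _ H).
rewrite in_itv /= => cT e; exists c; first exact: H.
by rewrite -fx0 -opprB e sub0r mulrN opprK mulrC.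
Qed.

End C1.

(** * Symmetry of second derivatives, directional derivatives, integration by parts *)

Section C1Consequences.
Context {R : realType} {N : nat} (O : set 'rV[R]_N) (oO : open O).
Implicit Types (f g : 'rV[R]_N -> R) (x y : 'rV[R]_N).

Lemma near_and (P Q : set 'rV[R]_N) x : (\forall y \near x, P y) ->
  (\forall y \near x, Q y) ->
  exists2 d : R, 0 < d & forall y, ball x d y -> P y /\ Q y.
Proof.
move=> /nbhs_ballP[d1 /= d10 H1] /nbhs_ballP[d2 /= d20 H2].
exists (Num.min d1 d2); first by rewrite lt_min d10.
move=> y xy; split.
  by apply: H1; apply: le_ball xy; rewrite ge_min lexx.
by apply: H2; apply: le_ball xy; rewrite ge_min lexx orbT.
Qed.

Lemma row_ball_add x (w : 'rV[R]_N) (d : R) : 0 < d ->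
  (forall n, `|w ord0 n| < d) -> ball x d (x + w).
Proof.
move=> d0 wd; apply/row_ballP => // n.
by rewrite mxE opprD addrA subrr sub0r normrN.
Qed.

Lemma is_derive_translate f (c : 'rV[R]_N) x v d : is_derive (x + c) v f d ->
  is_derive x v (fun y => f (y + c)) d.
Proof.
have E : (fun h : R => h^-1 *: (((fun y => f (y + c)) \o shift x) (h *: v) - f (x + c))) =
    (fun h : R => h^-1 *: ((f \o shift (x + c)) (h *: v) - f (x + c))).
  by apply/funext => h /=; rewrite addrA.
by move=> [dv <-]; apply: DeriveDef; rewrite /derivable /derive E.
Qed.

(** The mean value theorem in direction [i] for the increment of [f] along [ebase R j], then in
    direction [j] for [partial i f]. The second difference itself is symmetric in [i] and [j]. *)
Lemma second_difference f i j x (h : R) :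
  (forall s t : R, `|s| <= `|h| -> `|t| <= `|h| ->
     O (x + s *: ebase R i + t *: ebase R j)) ->
  C1_on O f -> C1_on O (partial i f) ->
  exists s t : R, [/\ `|s| <= `|h|, `|t| <= `|h| &
    f (x + h *: ebase R i + h *: ebase R j) - f (x + h *: ebase R j) -
      (f (x + h *: ebase R i) - f x) =
    h * (h * partial j (partial i f) (x + s *: ebase R i + t *: ebase R j))].
Proof.
move=> Oh Cf Cif.
pose g y := f (y + h *: ebase R j) + (-1) * f y.
have gD s : `|s| <= `|h| -> is_derive (x + s *: ebase R i) (ebase R i) g
    (partial i f (x + s *: ebase R i + h *: ebase R j) +
      (-1) * partial i f (x + s *: ebase R i)).
  move=> sh; apply: is_derive_add.
    by apply: is_derive_translate; apply: C1_is_derive (Cf) _; exact: Oh.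
  apply: is_derive_eq.
    apply: (@is_derive_mul _ _ (fun _ => -1) f _ _ 0).
    apply: C1_is_derive (Cf) _; have := Oh s 0 sh; rewrite normr0 scale0r addr0.
    by apply.
  by rewrite mul0r add0r.
have [|s sh] := @line_MVT _ _ g x (ebase R i) h.
  by move=> s /gD[].
have -> : 'D_(ebase R i) g (x + s *: ebase R i) =
    partial i f (x + s *: ebase R i + h *: ebase R j) +
      (-1) * partial i f (x + s *: ebase R i).
  by have [] := gD s sh.
move=> e1.
have [|t th e2] := @line_MVT _ _ (partial i f) (x + s *: ebase R i) (ebase R j) h.
  by move=> t th; have [] := C1_is_derive j Cif (Oh s t sh th).
exists s, t; split=> //; rewrite -[partial j _ _]/('D_(ebase R j) _ _) -e2.
have -> : partial i f (x + s *: ebase R i + h *: ebase R j) - partial i f (x + s *: ebase R i)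
  = partial i f (x + s *: ebase R i + h *: ebase R j) + (-1) * partial i f (x + s *: ebase R i).
  by ring.
by rewrite -e1 /g; ring.
Qed.

(** Schwarz's theorem: each mixed derivative, at some point near [x], equals the same second
    difference divided by [h ^+ 2]; continuity carries the equality to [x]. *)
Lemma partial_sym f i j x : C1_on O f -> (forall k, C1_on O (partial k f)) -> O x ->
  partial j (partial i f) x = partial i (partial j f) x.
Proof.
move=> Cf C2f Ox; apply/eqP; rewrite -subr_eq0 -normr_le0; apply/ler_addgt0Pl => e e0.
rewrite addr0.
have e2 : 0 < e / 2 by lra.
have /cvgrPdist_lt /(_ _ e2) H1 := C1_continuous_partial (i := j) (C2f i) Ox.
have /cvgrPdist_lt /(_ _ e2) H2 := C1_continuous_partial (i := i) (C2f j) Ox.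
have [d1 d10 Hd1] := near_and (near_open oO Ox) H1.
have [d2 d20 Hd2] := near_and (near_open oO Ox) H2.
pose d := Num.min d1 d2.
have d0 : 0 < d by rewrite lt_min d10.
have {Hd1 Hd2}Hd y : ball x d y ->
    [/\ O y, `|partial j (partial i f) x - partial j (partial i f) y| < e / 2 &
       `|partial i (partial j f) x - partial i (partial j f) y| < e / 2].
  move=> xy.
  have [|Oy h1] := Hd1 y; first by apply: le_ball xy; rewrite ge_min lexx.
  have [|_ h2] := Hd2 y; first by apply: le_ball xy; rewrite ge_min lexx orbT.
  exact: And3 Oy h1 h2.
(* Both increments may fall on the same coordinate, and together they must stay below [d]. *)
pose h := d / 3; have h0 : 0 < h by rewrite /h; lra.
have inb (k l : 'I_N) (s t : R) : `|s| <= `|h| -> `|t| <= `|h| ->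
    ball x d (x + s *: ebase R k + t *: ebase R l).
  rewrite (gtr0_norm h0) => sh th.
  rewrite -addrA; apply: row_ball_add => // n; rewrite !mxE.
  have H (c : R) (b : bool) : `|c| <= h -> `|c * b%:R| <= h.
    by case: b => ch; [rewrite mulr1|rewrite mulr0 normr0 ltW].
  have := H _ (k == n) sh; have := H _ (l == n) th.
  move=> a1 a2.
  apply: (le_lt_trans (ler_normD _ _)); rewrite /h in a1 a2 h0; lra.
have [|s [t [sh th E1]]] := @second_difference f i j x h _ Cf (C2f i).
  by move=> s t sh th; case: (Hd _ (inb i j s t sh th)).
have [|s' [t' [sh' th' E2]]] := @second_difference f j i x h _ Cf (C2f j).
  by move=> s' t' sh' th'; case: (Hd _ (inb j i s' t' sh' th')).
have h1 : h != 0 by rewrite gt_eqF.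
clearbody h.
have E : partial j (partial i f) (x + s *: ebase R i + t *: ebase R j) =
    partial i (partial j f) (x + s' *: ebase R j + t' *: ebase R i).
  have : h * (h * partial j (partial i f) (x + s *: ebase R i + t *: ebase R j)) =
      h * (h * partial i (partial j f) (x + s' *: ebase R j + t' *: ebase R i)).
    refine (etrans (esym E1) (etrans _ E2)); rewrite (addrAC x (h *: ebase R j)).
    set A1 := f _; set A2 := f _; set A3 := f _; set A4 := f _; ring.
  by move=> /(mulfI h1)/(mulfI h1).
have [_ A1 _] := Hd _ (inb i j s t sh th).
have [_ _ A2] := Hd _ (inb j i s' t' sh' th').
rewrite E in A1; move: A1 A2.
move: (partial j (partial i f) x) (partial i (partial j f) x).
move: (partial i (partial j f) _) => C A B A1 A2.
rewrite (_ : A - B = (A - C) - (B - C)); last by ring.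
apply: (le_trans (ler_normB _ _)).
by clear -A1 A2; lra.
Qed.

(** The successive truncations of [v] are the corners of a path from 0 to [v] with edges parallel to
    the axes. *)
Definition trunc_row (v : 'rV[R]_N) (k : nat) : 'rV[R]_N :=
  \row_j (if (j < k)%N then v ord0 j else 0).

Lemma trunc_rowS v (k : 'I_N) :
  trunc_row v k.+1 = trunc_row v k + v ord0 k *: ebase R k.
Proof.
apply/rowP => j; rewrite !mxE ltnS leq_eqVlt.
have [->|kj] := eqVneq k j; first by rewrite eqxx ltnn /= add0r mulr1.
by rewrite (_ : (j : nat) == k = false) ?mulr0 ?addr0//= eq_sym; apply/negbTE.
Qed.

(** Continuous partial derivatives yield all directional ones: the increment is telescoped along the
    path of truncations, and the mean value theorem is applied on each edge. *)
Lemma is_derive_dir f x v (s : R) : C1_on O f -> O (x + s *: v) ->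
  is_derive s (1 : R) (fun s => f (x + s *: v))
    (\sum_i v ord0 i * partial i f (x + s *: v)).
Proof.
move=> Cf Oy; apply: is_derive_quotient => e e0.
have yE h : x + (s + h) *: v = x + s *: v + h *: v by rewrite scalerDl addrA.
move: (x + s *: v) Oy yE => y Oy yE.
(* [M] bounds each coordinate of [v], which keeps the path in the ball, and also the sum of their
   absolute values, which enters the final estimate. *)
pose M := 1 + \sum_i `|v ord0 i|.
have M0 : 0 < M by rewrite /M ltr_wpDr// sumr_ge0.
have vM i : `|v ord0 i| <= M.
  rewrite /M (bigD1 i)//= addrCA lerDl addr_ge0// sumr_ge0//.
have eM : 0 < e / M by rewrite divr_gt0.
have Hn : \forall z \near y, forall i, `|partial i f y - partial i f z| < e / M.
  apply: (@filter_forall _ _ _ (nbhs y) _) => i.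
  by have /cvgrPdist_lt /(_ _ eM) := C1_continuous_partial (i := i) Cf Oy.
have [d d0 Hd] := near_and (near_open oO Oy) Hn.
exists (d / M); first by rewrite divr_gt0.
move=> h h0 hd.
have hM : `|h| * M < d by rewrite -ltr_pdivlMr.
have inb (k : 'I_N) (c : R) : `|c| <= `|(h *: v) ord0 k| ->
    ball y d (y + trunc_row (h *: v) k + c *: ebase R k).
  rewrite mxE => ck; rewrite -addrA; apply: row_ball_add => // n; rewrite !mxE.
  have [<-|kn] := eqVneq k n; first rewrite ltnn add0r mulr1.
    by rewrite (le_lt_trans ck)// (le_lt_trans _ hM)// normrM ler_wpM2l.
  rewrite mulr0 addr0; case: ifP => _; last by rewrite normr0.
  by rewrite (le_lt_trans _ hM)// normrM ler_wpM2l.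
have xi (k : 'I_N) : {z | ball y d z &
    f (y + trunc_row (h *: v) k.+1) - f (y + trunc_row (h *: v) k) =
      h * v ord0 k * partial k f z}.
  apply: cid2.
  have [|c ck e1] := @line_MVT _ _ f (y + trunc_row (h *: v) k) (ebase R k) ((h *: v) ord0 k).
    by move=> c ck; have [Oc _] := Hd _ (inb k c ck); have [] := C1_is_derive k Cf Oc.
  exists (y + trunc_row (h *: v) k + c *: ebase R k); first exact: inb.
  by rewrite trunc_rowS addrA e1 mxE.
have fE : f (y + h *: v) - f y = \sum_(k < N) h * v ord0 k * partial k f (s2val (xi k)).
  have T0 : trunc_row (h *: v) 0 = 0 by apply/rowP => j; rewrite !mxE.
  have TN : trunc_row (h *: v) N = h *: v by apply/rowP => j; rewrite !mxE ltn_ord.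
  rewrite -{1}TN -{2}(addr0 y) -T0.
  rewrite -(telescope_sumr (fun k => f (y + trunc_row (h *: v) k)) (leq0n N)) big_mkord.
  by apply: eq_bigr => k _; exact: (s2valP' (xi k)).
rewrite yE fE mulr_sumr -sumrB.
apply: (@le_trans _ _ (\sum_i (e / M) * `|v ord0 i|)).
  apply: (le_trans (ler_norm_sum _ _ _)); apply: ler_sum => k _.
  rewrite [X in `|X|](_ : _ = v ord0 k * (partial k f (s2val (xi k)) - partial k f y)).
    rewrite normrM mulrC ler_wpM2r// distrC ltW//.
    by have [_] := Hd _ (s2valP (xi k)); exact.
  by field.
rewrite -mulr_sumr mulrAC ler_pdivrMr// ler_wpM2l ?ltW//.
by rewrite /M; lra.
Qed.

(** Compact support inside [O], phrased without closures: [U] is open and contains the complement of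
    [O], so the function vanishes near every point outside [O]. *)
Definition inner_supported f := (exists U, [/\ open U, forall x, O x \/ U x & forall x, U x -> f x = 0]) /\
  exists K, forall (x : 'rV[R]_N) i, K < `|x ord0 i| -> f x = 0.

Lemma near_zero_partial f i x : (\forall y \near x, f y = 0) -> is_derive x (ebase R i) f 0.
Proof.
move=> fx; apply: (@near_eq_is_derive _ _ _ (fun _ => 0)).
by apply: filterS fx => y ->.
Qed.

Lemma inner_supported_near f x : inner_supported f -> O x \/ \forall y \near x, f y = 0.
Proof.
move=> [[U [oU OU fU]] _]; have [Ox|Ux] := OU x; [by left|right].
have : \forall y \near x, U y by exact: open_nbhs_nbhs.
by apply: filterS => y /fU.
Qed.

Lemma inner_supported_box f : inner_supported f -> exists K, forall (x : 'rV[R]_N) i, K < `|x ord0 i| ->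
  \forall y \near x, f y = 0.
Proof.
move=> [_ [K fK]]; exists K => x i xK.
have : \forall y \near x, K < `|(y : 'rV[R]_N) ord0 i|.
  have c : {for x, continuous (fun y : 'rV[R]_N => `|y ord0 i|)}.
    apply: (@continuous_comp _ _ _ (fun y : 'rV[R]_N => y ord0 i)); first exact: coord_continuous.
    exact: norm_continuous.
  have /cvgrPdist_lt /(_ (`|x ord0 i| - K)) := c.
  rewrite subr_gt0 => /(_ xK); apply: filterS => y /=.
  by rewrite ltr_norml => /andP[_]; lra.
by apply: filterS => y; exact: fK.
Qed.

Lemma inner_supported_Cc f : inner_supported f -> (forall x, O x -> {for x, continuous f}) -> Cc f.
Proof.
move=> af cf; split; last by case: af.
move=> x; have [Ox|fx] := inner_supported_near x af; first exact: cf.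
apply: (@near_continuous _ _ _ (fun _ => 0)); first exact: cst_continuous.
by apply: filterS fx => y ->.
Qed.

Lemma inner_supported_partial f i : inner_supported f -> inner_supported (partial i f).
Proof.
move=> af; have [[U [oU OU fU]] _] := af; split.
  exists U; split=> // x Ux.
  have fx : \forall y \near x, f y = 0.
    have : \forall y \near x, U y by exact: open_nbhs_nbhs.
    by apply: filterS => y /fU.
  by have [] := near_zero_partial i fx.
have [K fK] := inner_supported_box af; exists K => x k xK.
by have [] := near_zero_partial i (fK x k xK).
Qed.

(** Differentiability is known only on [O], but at any other point [f] vanishes in a neighbourhood;
    hence its partial derivative is continuous on the whole space. *)
Lemma Lint_partial_eq0 f i : inner_supported f -> C1_on O f -> Lint (partial i f) = 0.
Proof.
move=> af Cf; apply: Lint_derive0.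
- by apply: inner_supported_Cc => // x /Cf[].
- move=> x; have [Ox|fx] := inner_supported_near x af.
    by have [] := C1_is_derive i Cf Ox.
  by have [] := near_zero_partial i fx.
- by apply: inner_supported_Cc; [exact: inner_supported_partial|move=> x; exact: C1_continuous_partial].
Qed.

End C1Consequences.

(** * The annular domain, its closure and its boundary layers *)

Section Geometry.
Context {R : realType} {N m : nat} {a b : R} (a0 : 0 < a) (ab : a < b).
Implicit Types (x y : 'rV[R]_N).

(** This is |y|^2 for x = (y, z); [sigma] is |z|^2. *)
Definition rho (m : nat) x : R := \sum_(i < N | (i < m.+1)%N) x ord0 i ^+ 2.
Definition sigma (m : nat) x : R := \sum_(i < N | ~~ (i < m.+1)%N) x ord0 i ^+ 2.
(** A polynomial substitute for the distance to the boundary: positive exactly on the domain and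
    zero on its boundary. *)
Definition tau (m : nat) (a b : R) x : R := (rho m x - a ^+ 2) * (b ^+ 2 - rho m x).
Local Notation Om := (@Omega R N m a b).

Lemma rho_ge0 x : 0 <= rho m x.
Proof. by apply: sumr_ge0 => i _; exact: sqr_ge0. Qed.

Lemma sigma_ge0 x : 0 <= sigma m x.
Proof. by apply: sumr_ge0 => i _; exact: sqr_ge0. Qed.

Lemma OmegaP x : Om x <-> a ^+ 2 < rho m x < b ^+ 2.
Proof.
have b0 : 0 < b := lt_trans a0 ab.
rewrite /Omega /= -/(rho m x).
have s0 := sqrtr_ge0 (rho m x); have s2 := sqr_sqrtr (rho_ge0 x).
suff -> : (a < Num.sqrt (rho m x) < b) = (a ^+ 2 < rho m x < b ^+ 2) by [].
by rewrite -[in RHS]s2 !ltr_pXn2r ?nnegrE ?(ltW a0) ?(ltW b0).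
Qed.

Lemma a2_lt_b2 : a ^+ 2 < b ^+ 2.
Proof. by rewrite ltr_pXn2r ?nnegrE ?ltW// (lt_trans a0). Qed.

Lemma a2_gt0 : 0 < a ^+ 2.
Proof. exact: exprn_gt0. Qed.

Lemma Omega_tau x : Om x <-> 0 < tau m a b x.
Proof.
have := a2_lt_b2; rewrite OmegaP /tau; move: (a ^+ 2) (b ^+ 2) (rho m x) => A B r AB.
split=> [/andP[? ?]|h]; first by rewrite mulr_gt0// subr_gt0.
by apply/andP; split; nra.
Qed.

Lemma rho_continuous x : {for x, continuous (rho m)}.
Proof.
apply: (C1_continuous (O := setT)) => //; apply: C1_sum; first exact: openT.
move=> i _; under eq_fun do rewrite expr2.
by apply: C1M; first exact: openT; exact: C1_coord openT _.
Qed.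

Lemma sigma_continuous x : {for x, continuous (sigma m)}.
Proof.
apply: (C1_continuous (O := setT)) => //; apply: C1_sum; first exact: openT.
move=> i _; under eq_fun do rewrite expr2.
by apply: C1M; first exact: openT; exact: C1_coord openT _.
Qed.

Lemma tau_continuous x : {for x, continuous (tau m a b)}.
Proof.
by apply: continuousM; apply: continuousB; try exact: cst_continuous;
  exact: rho_continuous.
Qed.

Lemma open_Omega : open Om.
Proof.
have -> : Om = tau m a b @^-1` [set t | 0 < t].
  by apply/seteqP; split=> x /=; rewrite Omega_tau.
apply: open_comp; last exact: open_gt.
by move=> x _; exact: tau_continuous.
Qed.

Lemma near_row x (P : 'rV[R]_N -> Prop) : (\forall y \near x, P y) ->
  exists2 d : R, 0 < d & forall y, (forall i, `|x ord0 i - y ord0 i| < d) -> P y.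
Proof.
move=> /nbhs_ballP[d /= d0 Hd]; exists d => // y xy; apply: Hd.
exact/(row_ballP _ _ d0).
Qed.

Lemma closure_Omega_le x : closure Om x -> a ^+ 2 <= rho m x <= b ^+ 2.
Proof.
move=> cx; rewrite !leNgt -negb_or; apply/negP => h.
pose U := [set y | (rho m y < a ^+ 2) || (b ^+ 2 < rho m y)].
have oU : open U.
  have -> : U = (rho m @^-1` [set t | t < a ^+ 2]) `|` (rho m @^-1` [set t | b ^+ 2 < t]).
    apply/seteqP; split=> y /=; rewrite /U /=; first by move=> /orP.
    by move=> H; apply/orP.
  by apply: openU; apply: open_comp; try exact: open_lt; try exact: open_gt;
    move=> y _; exact: rho_continuous.
have [y [/OmegaP /andP[h1 h2]]] := cx U (open_nbhs_nbhs (conj oU h)).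
by rewrite /U /= => /orP[|]; lra.
Qed.

Definition scaleY (l : R) x : 'rV[R]_N :=
  \row_j (if (j < m.+1)%N then l * x ord0 j else x ord0 j).

Lemma rho_scaleY l x : rho m (scaleY l x) = l ^+ 2 * rho m x.
Proof.
rewrite /rho mulr_sumr; apply: eq_bigr => i im.
by rewrite mxE im exprMn.
Qed.

(** Multiplying [y] by a factor close to 1, larger than 1 on the inner sphere and smaller than 1 on
    the outer one, pushes a boundary point into the domain. *)
Lemma scaleY_near d x : a ^+ 2 <= rho m x <= b ^+ 2 -> 0 < d ->
  exists2 l, a ^+ 2 < rho m (scaleY l x) < b ^+ 2 &
    forall i, `|x ord0 i - scaleY l x ord0 i| < d.
Proof.
move=> /andP[h1 h2] d0.
have b0 : 0 < b := lt_trans a0 ab.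
pose M := 1 + \sum_i `|x ord0 i|.
have M0 : 0 < M by rewrite /M ltr_wpDr// sumr_ge0.
have xM i : `|x ord0 i| < M.
  rewrite /M (bigD1 i)//= addrCA ltrDl ltr_wpDr// sumr_ge0//.
suff [l lx ld] : exists2 l, a ^+ 2 < l ^+ 2 * rho m x < b ^+ 2 & `|1 - l| * M < d.
  exists l; first by rewrite rho_scaleY.
  move=> i; rewrite mxE; case: ifP => _; last by rewrite subrr normr0.
  rewrite -[X in X - _]mul1r -mulrBl normrM (le_lt_trans _ ld)// ler_wpM2l//.
  exact: ltW.
have eM : 0 < d / (2 * M) by rewrite divr_gt0// mulr_gt0.
have eMd : d / (2 * M) * M < d.
  have -> : d / (2 * M) * M = d / 2 by field; rewrite gt_eqF.
  by lra.
have [e1|n1] := eqVneq (rho m x) (a ^+ 2).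
  (* The second bound keeps [(1 + e) * a] at or below the midpoint of [a] and [b]. On the outer
     sphere its analogue keeps [(1 - e) * b] at or above it. *)
  pose e := Num.min (d / (2 * M)) ((b - a) / (2 * a)).
  have ba : 0 < (b - a) / (2 * a) by rewrite divr_gt0 ?mulr_gt0// subr_gt0.
  have e0 : 0 < e by rewrite lt_min eM.
  have ea : e * a <= (b - a) / 2.
    rewrite -ler_pdivlMr// (_ : _ / a = (b - a) / (2 * a)).
      by rewrite /e ge_min lexx orbT.
    by field; rewrite gt_eqF.
  exists (1 + e).
    rewrite e1 -exprMn !ltr_pXn2r ?nnegrE ?mulr_ge0 ?addr_ge0 ?ltW//.
    rewrite mulrDl mul1r ltrDl mulr_gt0//=.
    by move: ea ab; clear; move: (e * a) => z; lra.
  rewrite (_ : 1 - (1 + e) = - e); last by ring.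
  rewrite normrN gtr0_norm// (le_lt_trans _ eMd)// ler_wpM2r ?(ltW M0)//.
  by rewrite /e ge_min lexx.
have [e2|n2] := eqVneq (rho m x) (b ^+ 2).
  pose e := Num.min (d / (2 * M)) ((b - a) / (2 * b)).
  have ba : 0 < (b - a) / (2 * b) by rewrite divr_gt0 ?mulr_gt0// subr_gt0.
  have e0 : 0 < e by rewrite lt_min eM.
  have eb : e * b <= (b - a) / 2.
    rewrite -ler_pdivlMr// (_ : _ / b = (b - a) / (2 * b)).
      by rewrite /e ge_min lexx orbT.
    by field; rewrite gt_eqF.
  have e1 : e < 1.
    by rewrite -(ltr_pM2r b0) mul1r; move: eb ab a0; clear; move: (e * b) => z; lra.
  exists (1 - e).
    rewrite e2 -exprMn !ltr_pXn2r ?nnegrE ?mulr_ge0 ?subr_ge0 ?(ltW e1) ?(ltW b0) ?(ltW a0)//.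
    rewrite mulrBl mul1r ltrBlDr ltrDl mulr_gt0// andbT.
    by move: eb ab; clear; move: (e * b) => z; lra.
  rewrite (_ : 1 - (1 - e) = e); last by ring.
  rewrite gtr0_norm// (le_lt_trans _ eMd)// ler_wpM2r ?(ltW M0)//.
  by rewrite /e ge_min lexx.
exists 1; last by rewrite subrr normr0 mul0r.
by rewrite expr1n mul1r !lt_neqAle eq_sym n1 n2 h1 h2.
Qed.

Lemma closure_OmegaP x : closure Om x <-> a ^+ 2 <= rho m x <= b ^+ 2.
Proof.
split=> [/closure_Omega_le//|h] B /near_row[d d0 Hd].
have [l lx ld] := scaleY_near h d0.
by exists (scaleY l x); split; [exact/OmegaP|exact: Hd].
Qed.

Lemma within_row (A : set 'rV[R]_N) (f : 'rV[R]_N -> R) x : {within A, continuous f} -> A x ->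
  forall e, 0 < e -> exists2 d : R, 0 < d &
    forall y, A y -> (forall i, `|x ord0 i - y ord0 i| < d) -> `|f x - f y| < e.
Proof.
move=> /subspace_continuousP /(_ x) H /H /cvgrPdist_lt cf e /cf.
rewrite near_withinE => /near_row[d d0 Hd]; exists d => // y Ay xy.
exact: Hd.
Qed.

(** The points of the closure with [sigma m x <= K] and [0 <= f x] form a compact set. By hypothesis
    [tau] is nowhere zero there, so its minimum is positive; half of it is the width. The bound on
    [sigma] is what makes the set bounded. *)
Lemma compact_layer (f : 'rV[R]_N -> R) K : 
  {within closure Om, continuous f} ->
  (forall x, closure Om x -> tau m a b x = 0 -> f x < 0) ->
  exists2 e, 0 < e & forall x, Om x -> sigma m x <= K -> tau m a b x <= e -> f x < 0.
Proof.
move=> cf f0.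
pose A := [set x | closure Om x /\ (sigma m x <= K /\ 0 <= f x)].
have clA : closed A.
  move=> x clAx.
  have cx : closure Om x.
    by apply: closed_closure => B /clAx[y [[cy _] By]]; exists y.
  split=> //; split.
    rewrite leNgt; apply/negP => h.
    have /cvgrPdist_lt /(_ (sigma m x - K)) := @sigma_continuous x.
    rewrite subr_gt0 => /(_ h) /clAx[y [[_ [yK _]]]] /=.
    by rewrite ltr_norml => /andP[_]; lra.
  rewrite leNgt; apply/negP => h.
  have [d d0 Hd] := within_row cf cx (e := - f x) ltac:(lra).
  have /clAx[y [[cy [_ fy]] /row_ballP xy]] : nbhs x (ball x d) by exact: nbhsx_ballx.
  by have := Hd y cy (xy d0); rewrite ltr_norml => /andP[]; lra.
have bA : bounded_set A.
  exists (b ^+ 2 + `|K| + 1); split; first exact: num_real.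
  move=> M hM x [cx [xK _]].
  have sq (t : R) : `|t| <= 1 + t ^+ 2.
    rewrite -(real_normK (num_real t)); move: (`|t|) (normr_ge0 t) => s s0; nra.
  have xi i : `|x ord0 i| <= b ^+ 2 + `|K| + 1.
    apply: (le_trans (sq _)).
    have /andP[_ rb] := (closure_Omega_le cx).
    have sK : sigma m x <= `|K| by rewrite (le_trans xK)// ler_norm.
    have : x ord0 i ^+ 2 <= rho m x + sigma m x.
      have [im|im] := boolP (i < m.+1)%N.
        rewrite /rho (bigD1 i)//= -addrA lerDl addr_ge0 ?sigma_ge0//.
        by apply: sumr_ge0 => k _; exact: sqr_ge0.
      rewrite addrC /sigma (bigD1 i)//= -addrA lerDl addr_ge0 ?rho_ge0//.
      by apply: sumr_ge0 => k _; exact: sqr_ge0.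
    by have := sqr_ge0 b; lra.
  rewrite /= /Num.norm /= mx_normrE; apply/bigmax_leP; split=> [|[k l] _].
    by have := sqr_ge0 b; have := normr_ge0 K; lra.
  by rewrite ord1 /=; apply: (le_trans (xi l)); apply: ltW.
have cA : compact A := bounded_closed_compact bA clA.
have [A0|/set0P/negP/negPn/eqP A0] := pselect (A !=set0); last first.
  exists 1 => // x Ox xK _; rewrite ltNge; apply/negP => fx.
  have : A x by split=> //; exact: subset_closure.
  by rewrite A0.
have [c] := compact_EVT_min A0 cA (continuous_subspaceT (fun x => @tau_continuous x)).
rewrite inE => -[cc [cK fc]] cmin.
have tc : 0 < tau m a b c.
  rewrite lt_neqAle; apply/andP; split.
    by apply/negP => /eqP /esym tc0; have := f0 c cc tc0; lra.
  have /andP[r1 r2] := closure_Omega_le cc.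
  by rewrite /tau mulr_ge0// subr_ge0.
exists (tau m a b c / 2); first by rewrite divr_gt0.
move=> x Ox xK xt; rewrite ltNge; apply/negP => fx.
have /cmin : x \in A by rewrite inE; split=> //; exact: subset_closure.
lra.
Qed.

End Geometry.

(** * The gradient of a function vanishing on the boundary is normal there *)

Section Boundary.
Context {R : realType} {N m : nat} {a b : R} (a0 : 0 < a) (ab : a < b).
Local Notation Om := (@Omega R N m a b).
Implicit Types (x y v : 'rV[R]_N).

Lemma within_path (A : set 'rV[R]_N) (f : 'rV[R]_N -> R) x v (p q : R) :
  {within A, continuous f} -> (forall s, p <= s <= q -> A (x + s *: v)) ->
  {within `[p, q], continuous (fun s : R => f (x + s *: v))}.
Proof.
move=> cf Apq; apply/subspace_continuousP => s; rewrite /= in_itv /= => spq.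
apply/cvgrPdist_lt => e e0; rewrite near_withinE.
have [d d0 Hd] := within_row cf (Apq s spq) e0.
pose M := 1 + \sum_i `|v ord0 i|.
have M0 : 0 < M by rewrite /M ltr_wpDr// sumr_ge0.
have vM i : `|v ord0 i| <= M.
  rewrite /M (bigD1 i)//= addrCA lerDl addr_ge0// sumr_ge0//.
apply/nbhs_ballP; exists (d / M); first by rewrite /= divr_gt0.
move=> t st /=; rewrite in_itv /= => tpq; apply: Hd; first exact: Apq.
move=> i; rewrite !mxE opprD addrACA subrr add0r -mulrBl normrM.
apply: (@le_lt_trans _ _ (`|s - t| * M)); first by rewrite ler_wpM2l.
by rewrite -ltr_pdivlMr.
Qed.

Context {u : 'rV[R]_N -> R} {g : 'I_N -> 'rV[R]_N -> R}.
Hypothesis Cu : C1_on Om u.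
Hypothesis uc : {within closure Om, continuous u}.
Hypothesis gc : forall i, {within closure Om, continuous (g i)}.
Hypothesis gu : forall i x, Om x -> g i x = partial i u x.
Hypothesis u0 : forall x, closure Om x -> ~ Om x -> u x = 0.

Lemma tau0_notin x : tau m a b x = 0 -> ~ Om x.
Proof. by move=> t0 /(Omega_tau a0 ab); rewrite t0 ltxx. Qed.

Lemma rho_addz x (j : 'I_N) (t : R) : ~~ (j < m.+1)%N ->
  rho m (x + t *: ebase R j) = rho m x.
Proof.
move=> jm; apply: eq_bigr => i im; rewrite !mxE.
by rewrite (_ : j == i = false) ?mulr0 ?addr0//; apply/negbTE; apply: contraNN jm => /eqP ->.
Qed.

(* Points of the boundary are approached by interior points, whose translates in
   the direction [j] stay interior; so the difference quotients of [u] in that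
   direction, which vanish on the boundary, control the normal limit. *)
Lemma boundary_grad_z x (j : 'I_N) : ~~ (j < m.+1)%N ->
  closure Om x -> tau m a b x = 0 -> g j x = 0.
Proof.
move=> jm cx tx; apply/eqP; rewrite -normr_le0; apply/ler_addgt0Pl => e e0; rewrite addr0.
have e2 : 0 < e / 2 by lra.
have [d d0 Hd] := within_row (@gc j) cx e2.
pose T := d / 2; have T0 : 0 < T by rewrite /T; lra.
have rx : a ^+ 2 <= rho m x <= b ^+ 2 by exact/(closure_OmegaP a0 ab).
have cxT : closure Om (x + T *: ebase R j).
  by apply/(closure_OmegaP a0 ab); rewrite rho_addz.
have ux : u x = 0 by apply: u0 => //; exact: tau0_notin.
have uxT : u (x + T *: ebase R j) = 0.
  by apply: u0 => //; apply: tau0_notin; rewrite /tau rho_addz.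
(* Both end values are below [e * T / 4], so the difference quotient over the length [T] is at most
   [e / 2]. *)
have eT : 0 < e * T / 4 by rewrite divr_gt0// mulr_gt0.
have [d1 d10 Hd1] := within_row uc cx eT.
have [d2 d20 Hd2] := within_row uc cxT eT.
pose d' := Num.min (d / 2) (Num.min d1 d2).
have d'0 : 0 < d' by rewrite !lt_min d10 d20 divr_gt0.
have [l lx ld] := scaleY_near a0 ab rx d'0.
set y := scaleY l x in lx ld; have ly : rho m y = rho m y by [].
have Oy s : Om (y + s *: ebase R j) by apply/(OmegaP a0 ab); rewrite rho_addz.
have Oy0 : Om y by apply/(OmegaP a0 ab).
have [s _|c cT E] := @line_MVT _ _ u y (ebase R j) T.
  by have [] := C1_is_derive j Cu (Oy s).
have A1 : `|u y| < e * T / 4.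
  have := Hd1 y (subset_closure Oy0); rewrite ux sub0r normrN; apply=> i.
  by rewrite (lt_le_trans (ld i))// /d' !ge_min lexx orbT.
have A2 : `|u (y + T *: ebase R j)| < e * T / 4.
  have := Hd2 _ (subset_closure (Oy T)); rewrite uxT sub0r normrN; apply=> i.
  rewrite [X in `|X|](_ : _ = x ord0 i - y ord0 i); last first.
    by rewrite [in LHS]mxE [X in _ - X]mxE; ring.
  by rewrite (lt_le_trans (ld i))// /d' !ge_min lexx !orbT.
have A3 : `|g j x - g j (y + c *: ebase R j)| < e / 2.
  apply: Hd; first exact: subset_closure.
  move=> i; rewrite [(y + _) _ _]mxE opprD addrA.
  apply: (le_lt_trans (ler_normB _ _)).
  have B1 : `|x ord0 i - y ord0 i| < d / 2.
    by rewrite (lt_le_trans (ld i))// /d' ge_min lexx.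
  have B2 : `|(c *: ebase R j) ord0 i| <= d / 2.
    rewrite !mxE; case: eqP => _; last by rewrite mulr0 normr0 ltW// divr_gt0.
    by rewrite mulr1 (le_trans cT)// gtr0_norm.
  by move: B1 B2; lra.
have A4 : `|g j (y + c *: ebase R j)| <= e / 2.
  rewrite gu//; have : T * `|partial j u (y + c *: ebase R j)| <= T * (e / 2).
    rewrite -[X in X * `|_|](gtr0_norm T0) -normrM -E.
    apply: (le_trans (ler_normB _ _)).
    by move: A1 A2; lra.
  by rewrite ler_pM2l.
rewrite -(subrK (g j (y + c *: ebase R j)) (g j x)).
apply: (le_trans (ler_normD _ _)).
by move: A3 A4; lra.
Qed.

Lemma rho_line x v (s : R) :
  rho m (x + s *: v) = rho m x + 2 * s * (\sum_(i < N | (i < m.+1)%N) x ord0 i * v ord0 i) +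
    s ^+ 2 * rho m v.
Proof.
rewrite /rho !mulr_sumr -!big_split /=; apply: eq_bigr => i _.
by rewrite !mxE; ring.
Qed.

(** Rolle's theorem on a short chord of the outer sphere, leaving [x] in the direction opposite to
    [v + t y]: [u] vanishes at both ends. As [t] tends to 0 the chord shrinks to [x] and its
    direction becomes that of [v]. No such chord exists at the inner sphere, where [phi] vanishes
    instead. *)
Lemma boundary_grad_tangent x v : rho m x = b ^+ 2 ->
  (forall i : 'I_N, ~~ (i < m.+1)%N -> v ord0 i = 0) ->
  \sum_(i < N | (i < m.+1)%N) x ord0 i * v ord0 i = 0 ->
  \sum_i v ord0 i * g i x = 0.
Proof.
move=> rx vz xv.
have [v0|v0] := eqVneq (rho m v) 0.
  apply: big1 => i _; have [im|im] := boolP (i < m.+1)%N; last by rewrite vz// mul0r.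
  have /eqP : rho m v = 0 by [].
  rewrite psumr_eq0; last by move=> k _; exact: sqr_ge0.
  by move=> /allP /(_ i (mem_index_enum _)); rewrite im /= sqrf_eq0 => /eqP ->; rewrite mul0r.
have W0 : 0 < rho m v by rewrite lt_neqAle eq_sym v0 rho_ge0.
set W := rho m v in W0.
have b0 : 0 < b := lt_trans a0 ab.
have B0 : 0 < b ^+ 2 by exact: exprn_gt0.
have AB := a2_lt_b2 a0 ab.
have cx : closure Om x by apply/(closure_OmegaP a0 ab); rewrite rx lexx andbT ltW.
pose y0 : 'rV[R]_N := \row_j (if (j < m.+1)%N then x ord0 j else 0).
pose S1 := \sum_i `|v ord0 i|; pose S2 := \sum_i `|y0 ord0 i|.
pose S3 := \sum_i `|y0 ord0 i * g i x|.
have S10 : 0 <= S1 by exact: sumr_ge0.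
have S20 : 0 <= S2 by exact: sumr_ge0.
have S30 : 0 <= S3 by exact: sumr_ge0.
pose M := 1 + S1 + S2; have M0 : 0 < M by rewrite /M; lra.
apply/eqP; rewrite -normr_le0; apply/ler_addgt0Pl => e e0; rewrite addr0.
have e2 : 0 < e / (2 * M) by rewrite divr_gt0// mulr_gt0.
have [d d0 Hd] : exists2 d : R, 0 < d & forall i y, closure Om y ->
    (forall k, `|x ord0 k - y ord0 k| < d) -> `|g i x - g i y| < e / (2 * M).
  have [D HD] : {D : 'I_N -> R & forall i, 0 < D i /\ forall y, closure Om y ->
    (forall k, `|x ord0 k - y ord0 k| < D i) -> `|g i x - g i y| < e / (2 * M)}.
    apply: (@choice _ _ (fun i (D : R) => 0 < D /\ forall y, closure Om y ->
      (forall k, `|x ord0 k - y ord0 k| < D) -> `|g i x - g i y| < e / (2 * M))) => i.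
    by have [d d0 Hd] := within_row (@gc i) cx e2; exists d.
  exists (\big[Num.min/1]_i D i).
    by elim/big_ind: _ => // [p q p0 q0|i _]; [rewrite lt_min p0|case: (HD i)].
  move=> i y cy xy; apply: (HD i).2 => // k; rewrite (lt_le_trans (xy k))//.
  exact: bigmin_le_cond.
pose B := b ^+ 2.
(* The four bounds serve in turn: every coordinate of [h] is at most [M]; replacing [v] by [h] costs
   at most [e / 2]; the chord stays within [d] of [x]; its deepest point, where |y|^2 = B - L^2 H /
   4, stays outside |y| = a. *)
pose t := Num.min 1 (Num.min (e / (2 * (S3 + 1)))
   (Num.min (d * W / (4 * B * M)) ((B - a ^+ 2) * W / (2 * B ^+ 2)))).
have t0 : 0 < t.
  rewrite !lt_min ltr01 !divr_gt0 ?mulr_gt0 ?exprn_gt0 ?subr_gt0//.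
  by rewrite ltr_wpDl.
have t1 : t <= 1 by rewrite /t !ge_min lexx.
have t2 : t * S3 <= e / 2.
  apply: (@le_trans _ _ (t * (S3 + 1))); first by rewrite ler_wpM2l ?ltW//; lra.
  rewrite -ler_pdivlMr; last by rewrite ltr_wpDl.
  have -> : e / 2 / (S3 + 1) = e / (2 * (S3 + 1)).
    by field; rewrite gt_eqF// ltr_wpDl.
  by rewrite /t !ge_min lexx ?orbT.
have t3 : t * (4 * B * M) <= d * W.
  by rewrite -ler_pdivlMr ?mulr_gt0// /t !ge_min lexx ?orbT.
have t4 : t * (2 * B ^+ 2) <= (B - a ^+ 2) * W.
  by rewrite -ler_pdivlMr ?mulr_gt0 ?exprn_gt0// /t !ge_min lexx ?orbT.
clearbody t.
pose h : 'rV[R]_N := v + t *: y0.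
have rh : rho m h = W + t ^+ 2 * B.
  rewrite /h rho_line -/W [X in 2 * t * X](_ : _ = 0).
    rewrite mulr0 addr0; congr (_ + _ * _); rewrite /B -rx.
    by apply: eq_bigr => i im; rewrite mxE im.
  transitivity (\sum_(i < N | (i < m.+1)%N) x ord0 i * v ord0 i) => //.
  by apply: eq_bigr => i im; rewrite mxE im mulrC.
have xh : \sum_(i < N | (i < m.+1)%N) x ord0 i * h ord0 i = t * B.
  transitivity (\sum_(i < N | (i < m.+1)%N) x ord0 i * v ord0 i + t * rho m x).
    2: by rewrite xv add0r rx.
  rewrite /rho mulr_sumr -big_split /=.
  by apply: eq_bigr => i im; rewrite !mxE im; ring.
have hz (i : 'I_N) : ~~ (i < m.+1)%N -> h ord0 i = 0.
  by move=> im; rewrite !mxE (negbTE im) mulr0 addr0; exact: vz.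
have hM (i : 'I_N) : `|h ord0 i| <= M.
  rewrite !mxE (le_trans (ler_normD _ _))// normrM (gtr0_norm t0).
  have H1 : `|v ord0 i| <= S1 by rewrite /S1 (bigD1 i)//= lerDl sumr_ge0.
  have H2 : `|y0 ord0 i| <= S2 by rewrite /S2 (bigD1 i)//= lerDl sumr_ge0.
  rewrite mxE in H2.
  have H3 : t * `|if (i < m.+1)%N then x ord0 i else 0| <= `|if (i < m.+1)%N then x ord0 i else 0|.
    by rewrite ler_piMl.
  by rewrite /M; move: H1 H2 H3; lra.
pose H := rho m h.
have tB0 : 0 < t ^+ 2 * B by rewrite mulr_gt0// exprn_gt0.
have H0 : 0 < H by rewrite /H rh addr_gt0.
have WH : W <= H by rewrite /H rh lerDl ltW.
(* [L] is the second root of |y|^2 = b^2 along [x - s h]; between the roots |y|^2 = B - s (L - s) H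
   is smaller than B. *)
pose L := 2 * t * B / H.
have L0 : 0 < L by rewrite /L divr_gt0// mulr_gt0// mulr_gt0.
have LH : L * H = 2 * t * B by rewrite /L; field; rewrite gt_eqF.
have rs s : rho m (x + s *: - h) = B - s * (L - s) * H.
  rewrite rho_line rx.
  have -> : \sum_(i < N | (i < m.+1)%N) x ord0 i * (- h) ord0 i = - (t * B).
    by rewrite -xh -sumrN; apply: eq_bigr => i _; rewrite !mxE mulrN.
  have -> : rho m (- h) = H by apply: eq_bigr => i _; rewrite mxE sqrrN.
  have -> : B - s * (L - s) * H = B - s * (L * H) + s ^+ 2 * H by ring.
  by rewrite LH /B; ring.
have LHs : L ^+ 2 / 4 * H < B - a ^+ 2.
  have -> : L ^+ 2 / 4 * H = L * (L * H) / 4 by field.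
  rewrite LH; have -> : L * (2 * t * B) / 4 = (t * B) * (t * B) / H by rewrite /L; field; rewrite gt_eqF.
  rewrite ltr_pdivrMr//; apply: (@lt_le_trans _ _ ((B - a ^+ 2) * W)); last first.
    by rewrite ler_wpM2l// subr_ge0 ltW.
  apply: (lt_le_trans _ t4).
  have tB : t * B * (t * B) <= t * B ^+ 2.
    rewrite (_ : t * B * (t * B) = (t * B ^+ 2) * t); last by ring.
    by rewrite ger_pMr// mulr_gt0// exprn_gt0.
  have tB2 : 0 < t * B ^+ 2 by rewrite mulr_gt0// exprn_gt0.
  by move: tB tB2; rewrite [t * (2 * _)]mulrCA; move: (t * B ^+ 2) => z; lra.
have Os s : 0 < s < L -> Om (x + s *: - h).
  move=> /andP[s0 sL]; apply/(OmegaP a0 ab); rewrite rs -/B.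
  have P0 : 0 < s * (L - s) * H by rewrite !mulr_gt0// subr_gt0.
  have P1 : s * (L - s) * H <= L ^+ 2 / 4 * H.
    rewrite ler_wpM2r ?(ltW H0)//; have := sqr_ge0 (s - L / 2); rewrite -subr_ge0.
    by have -> : L ^+ 2 / 4 - s * (L - s) = (s - L / 2) ^+ 2 by field.
  by apply/andP; split; move: P0 P1 LHs; lra.
have us s : s = 0 \/ s = L -> tau m a b (x + s *: - h) = 0.
  by move=> hs; rewrite /tau rs -/B; case: hs => ->; rewrite ?mul0r ?subrr ?mulr0 ?mul0r ?subr0 ?subrr ?mulr0.
have cs s : 0 <= s <= L -> closure Om (x + s *: - h).
  move=> /andP[]; rewrite le_eqVlt => /predU1P[<-|s0]; first by rewrite scale0r addr0.
  rewrite le_eqVlt => /predU1P[->|sL]; last first.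
    by apply: subset_closure; apply: Os; rewrite s0.
  by apply/(closure_OmegaP a0 ab); rewrite rs subrr mulr0 mul0r subr0 lexx andbT ltW.
have [s|c] := MVT (f := fun s => u (x + s *: - h))
    (df := fun s => \sum_i (- h) ord0 i * partial i u (x + s *: - h)) L0 _
    (within_path uc cs).
  by rewrite in_itv /= => sL; apply: (is_derive_dir (open_Omega a0 ab) Cu); exact: Os.
rewrite in_itv /= => cL.
rewrite !u0 ?subrr; last 4 first.
- by apply: cs; rewrite lexx ltW.
- by apply: tau0_notin; apply: us; left.
- by apply: cs; rewrite lexx ltW.
- by apply: tau0_notin; apply: us; right.
move/esym/eqP; rewrite mulf_eq0 subr0 (gt_eqF L0) orbF => /eqP E.
set xi : 'rV[R]_N := x + c *: - h in E.
have Oxi : Om xi by exact: Os.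
have {}E : \sum_i h ord0 i * g i xi = 0.
  apply: oppr_inj; rewrite oppr0 -[RHS]E -sumrN; apply: eq_bigr => i _.
  by rewrite gu// !mxE mulNr.
have xid (k : 'I_N) : `|x ord0 k - xi ord0 k| < d.
  rewrite /xi [(x + _) _ _]mxE opprD addrA subrr sub0r normrN !mxE mulrN normrN normrM.
  have /andP[c0 cL'] := cL; rewrite (gtr0_norm c0).
  have := hM k; rewrite !mxE => hk.
  apply: (@le_lt_trans _ _ (c * M)); first by rewrite ler_wpM2l// ltW.
  apply: (@lt_trans _ _ (L * M)); first by rewrite ltr_pM2r.
  rewrite /L -mulrA [H^-1 * M]mulrC mulrA ltr_pdivrMr//.
  apply: (@lt_le_trans _ _ (d * W)); last by rewrite ler_wpM2l// ltW.
  have tBM : 0 < t * (B * M) by rewrite !mulr_gt0.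
  by move: t3 tBM; rewrite -!mulrA (mulrCA t 4); move: (t * (B * M)) => z; lra.
(* [h] is orthogonal to the gradient at [xi], so only the variation of [g] between [x] and [xi] and
   the summand [t *: y0] of [h] contribute. *)
have -> : \sum_i v ord0 i * g i x =
    \sum_i h ord0 i * (g i x - g i xi) - t * \sum_i y0 ord0 i * g i x.
  rewrite -[LHS]subr0 -[X in _ - X]E mulr_sumr -!sumrB; apply: eq_bigr => i _.
  by rewrite !mxE; ring.
apply: (le_trans (ler_normB _ _)).
have F1 : `|\sum_i h ord0 i * (g i x - g i xi)| <= e / 2.
  apply: (@le_trans _ _ (\sum_i `|h ord0 i| * (e / (2 * M)))).
    apply: (le_trans (ler_norm_sum _ _ _)); apply: ler_sum => i _.
    rewrite normrM ler_wpM2l// ltW//; apply: Hd => //; exact: subset_closure.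
  rewrite -mulr_suml.
  have HM : \sum_i `|h ord0 i| <= M.
    apply: (@le_trans _ _ (S1 + t * S2)).
      rewrite /S1 /S2 mulr_sumr -big_split /=; apply: ler_sum => i _.
      have -> : h ord0 i = v ord0 i + t * y0 ord0 i by rewrite !mxE.
      by rewrite (le_trans (ler_normD _ _))// normrM (gtr0_norm t0).
    have : t * S2 <= S2 by rewrite ler_piMl.
    by rewrite /M; lra.
  apply: (@le_trans _ _ (M * (e / (2 * M)))); first by rewrite ler_wpM2r// ltW.
  by rewrite le_eqVlt; apply/orP; left; apply/eqP; field; rewrite gt_eqF.
have F2 : `|t * \sum_i y0 ord0 i * g i x| <= e / 2.
  rewrite normrM (gtr0_norm t0); apply: (le_trans _ t2).
  by rewrite ler_wpM2l ?(ltW t0)// ler_norm_sum.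
by move: F1 F2; lra.
Qed.

(** Tested with the tangential part [v] of the y-gradient, the previous lemma says that [v] is zero,
    which is the equality case of Cauchy-Schwarz. *)
Lemma boundary_grad_y x : rho m x = b ^+ 2 ->
  (\sum_(i < N | (i < m.+1)%N) x ord0 i * g i x) ^+ 2 =
  b ^+ 2 * \sum_(i < N | (i < m.+1)%N) g i x ^+ 2.
Proof.
move=> rx; set q := \sum_(i < N | _) x ord0 i * g i x.
set G := \sum_(i < N | _) g i x ^+ 2.
have b0 : b != 0 by rewrite gt_eqF// (lt_trans a0 ab).
pose v : 'rV[R]_N := \row_j (if (j < m.+1)%N then g j x - q / b ^+ 2 * x ord0 j else 0).
have := @boundary_grad_tangent x v rx.
have -> : \sum_(i < N | (i < m.+1)%N) x ord0 i * v ord0 i = q - q / b ^+ 2 * rho m x.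
  rewrite {1}/q /rho mulr_sumr -sumrB; apply: eq_bigr => i im.
  by rewrite mxE im; ring.
have -> : \sum_i v ord0 i * g i x = G - q / b ^+ 2 * q.
  rewrite (bigID (fun i : 'I_N => (i < m.+1)%N)) /= [X in _ + X]big1 ?addr0; last first.
    by move=> i im; rewrite mxE (negbTE im) mul0r.
  rewrite /G {2}/q mulr_sumr -sumrB; apply: eq_bigr => i im.
  by rewrite mxE im; ring.
rewrite rx => H.
have {}H : G - q / b ^+ 2 * q = 0.
  by apply: H => [i im|]; [rewrite mxE (negbTE im)|field].
by rewrite (_ : G = q / b ^+ 2 * q); [field|apply/eqP; rewrite -subr_eq0 H].
Qed.

End Boundary.

(** * One-variable cutoffs, powers of the absolute value, and the radial weight *)

Section Cutoffs.
Context {R : realType}.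
Implicit Types s t : R.

Definition pos_part s : R := Num.max 0 s.
(** Squaring makes the positive part continuously differentiable; the differentiable cutoffs [theta]
    and [zcut] are both built from it. *)
Definition sqpos s : R := pos_part s ^+ 2.

Lemma pos_part_ge0 s : 0 <= pos_part s.
Proof. by rewrite /pos_part le_max lexx. Qed.

Lemma pos_part_id s : 0 <= s -> pos_part s = s.
Proof. by move=> s0; apply/max_idPr. Qed.

Lemma pos_part0 s : s <= 0 -> pos_part s = 0.
Proof. by move=> s0; apply/max_idPl. Qed.

Lemma le_pos_part s t : s <= t -> pos_part s <= pos_part t.
Proof.
move=> st; have [s0|s0] := leP s 0; first by rewrite (pos_part0 s0) pos_part_ge0.
by rewrite !pos_part_id// ?(ltW s0)// (le_trans (ltW s0)).
Qed.

Lemma le_sqpos s t : s <= t -> sqpos s <= sqpos t.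
Proof. by move=> st; rewrite ler_sqr ?nnegrE ?pos_part_ge0// le_pos_part. Qed.

Lemma is_derive_sqpos s : is_derive s (1 : R) sqpos (2 * pos_part s).
Proof.
apply: is_derive_quotient => e e0; exists e => // h h0 he.
have key : `|sqpos (s + h) - sqpos s - 2 * pos_part s * h| <= h ^+ 2.
  rewrite /sqpos; have [s0|s0] := leP 0 s; have [sh0|sh0] := leP 0 (s + h).
  - rewrite !pos_part_id// (_ : _ - _ - _ = h ^+ 2); last by ring.
    by rewrite ger0_norm// sqr_ge0.
  - rewrite (pos_part_id s0) (pos_part0 (ltW sh0)) ler_norml; apply/andP; split; nra.
  - rewrite (pos_part_id sh0) (pos_part0 (ltW s0)) ler_norml; apply/andP; split; nra.
  - rewrite (pos_part0 (ltW sh0)) (pos_part0 (ltW s0)).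
    by rewrite !(mul0r, mulr0, subrr, expr0n) normr0 sqr_ge0.
have -> : h^-1 * (sqpos (s + h) - sqpos s) - 2 * pos_part s =
   h^-1 * (sqpos (s + h) - sqpos s - 2 * pos_part s * h) by field.
rewrite normrM normfV ler_pdivrMl ?normr_gt0//; apply: (le_trans key).
by rewrite -(real_normK (num_real h)) expr2 ler_wpM2l// ltW.
Qed.

Lemma pos_part_continuous : continuous pos_part.
Proof.
move=> s; apply/cvgrPdist_le => e e0; near=> t.
have st : `|s - t| <= e.
  by near: t; have /cvgrPdist_le := @cvg_id _ (nbhs s); apply.
apply: le_trans st; rewrite /pos_part.
have [s0|s0] := leP 0 s; have [t0|t0] := leP 0 t; rewrite ?subrr ?normr0//.
  by rewrite subr0 !ger0_norm; lra.
by rewrite sub0r normrN ger0_norm// ler0_norm; lra.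
Unshelve. all: by end_near. Qed.

(** On the unit interval this is [1 - (1 - s ^+ 2) ^+ 2]: a [C^1] transition from 0 to 1 with zero
    slope at both ends. *)
Definition theta s : R := 1 - sqpos (1 - sqpos s).
Definition dtheta s : R := 4 * pos_part (1 - sqpos s) * pos_part s.

Lemma is_derive_theta s : is_derive s (1 : R) theta (dtheta s).
Proof.
have h1 : is_derive s (1 : R) (fun t => 1 - sqpos t) (- (2 * pos_part s)).
  by have := is_deriveB (is_derive_cst (1 : R) s (1 : R)) (is_derive_sqpos s);
    rewrite sub0r.
have d4 : is_derive s (1 : R) (fun t => sqpos (1 - sqpos t))
   (2 * pos_part (1 - sqpos s) * - (2 * pos_part s)).
  exact: (is_derive_comp1 h1 (is_derive_sqpos _)).
have -> : dtheta s = 0 - 2 * pos_part (1 - sqpos s) * - (2 * pos_part s).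
  by rewrite /dtheta; ring.
exact: is_deriveB (is_derive_cst (1 : R) s (1 : R)) d4.
Qed.

Lemma sqpos_continuous : continuous sqpos.
Proof. by move=> s; apply: continuousM; exact: pos_part_continuous. Qed.

Lemma dtheta_continuous : continuous dtheta.
Proof.
move=> s; apply: (@continuousM _ _ (fun s => 4 * pos_part (1 - sqpos s)) pos_part);
  last exact: pos_part_continuous.
apply: continuousM; first exact: cst_continuous.
apply: (@continuous_comp _ _ _ (fun s => 1 - sqpos s)); last exact: pos_part_continuous.
by apply: continuousB; [exact: cst_continuous|exact: sqpos_continuous].
Qed.

Lemma theta_le0 s : s <= 0 -> theta s = 0.
Proof.
move=> s0; rewrite /theta /sqpos (pos_part0 s0) expr0n /= subr0 pos_part_id//.
by rewrite expr1n subrr.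
Qed.

Lemma theta_ge1 s : 1 <= s -> theta s = 1.
Proof.
move=> s1; rewrite /theta {1}/sqpos (@pos_part0 (1 - sqpos s)) ?expr0n /= ?subr0//.
by rewrite /sqpos pos_part_id ?subr_le0 ?exprn_ege1// (le_trans ler01).
Qed.

Lemma theta_ge0 s : 0 <= theta s.
Proof.
rewrite /theta subr_ge0; have := pos_part_ge0 (1 - sqpos s).
rewrite {1}/sqpos => h; apply: exprn_ile1 => //.
by rewrite /pos_part ge_max ler01 lerBlDr lerDl sqr_ge0.
Qed.

Lemma theta_le1 s : theta s <= 1.
Proof. by rewrite /theta lerBlDr lerDl sqr_ge0. Qed.

Lemma le_theta s t : s <= t -> theta s <= theta t.
Proof. by move=> st; rewrite /theta lerB// le_sqpos// lerB// le_sqpos. Qed.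

Lemma dtheta_ge0 s : 0 <= dtheta s.
Proof. by rewrite /dtheta !mulr_ge0// pos_part_ge0. Qed.

Lemma dtheta_le0 s : s <= 0 -> dtheta s = 0.
Proof. by move=> s0; rewrite /dtheta (pos_part0 s0) mulr0. Qed.

Lemma dtheta_ge1 s : 1 <= s -> dtheta s = 0.
Proof.
move=> s1; rewrite /dtheta (@pos_part0 (1 - sqpos s)) ?mulr0 ?mul0r//.
by rewrite /sqpos pos_part_id ?subr_le0 ?exprn_ege1// (le_trans ler01).
Qed.

Lemma powR_le1 s (p : R) : 0 <= s <= 1 -> 0 <= p -> powR s p <= 1.
Proof.
move=> /andP[s0 s1] p0; rewrite [leRHS](_ : 1 = powR 1 p); last by rewrite powR1.
by apply: ge0_ler_powR => //; rewrite nnegrE.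
Qed.

Lemma powR_sub2 s (p : R) : 2 < p -> powR `|s| p = powR `|s| (p - 2) * s ^+ 2.
Proof.
move=> p2; have [->|s0] := eqVneq s 0.
  by rewrite normr0 powR0 ?expr0n ?mulr0// gt_eqF//; lra.
rewrite -[in LHS](subrK 2 p) [in LHS]powRD; last by rewrite normr_eq0 s0 implybT.
by rewrite powR_mulrn// real_normK// num_real.
Qed.

(** Zeros of [u] inside the domain must be covered: at 0 the difference quotient is
    [powR |h| (p - 2) * h], which tends to 0. *)
Lemma is_derive_powR_norm (p : R) s : 2 < p ->
  is_derive s (1 : R) (fun t => powR `|t| p) (p * (powR `|s| (p - 2) * s)).
Proof.
move=> p2; have [s0|s0|->] := ltgtP s 0.
- apply: (@near_eq_is_derive _ _ _ (fun t => powR (- t) p)).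
    have := near_in_itvNyo s0.
    by apply: filterS => t; rewrite in_itv /= => t0; rewrite ltr0_norm.
  have ns0 : 0 < - s by rewrite oppr_gt0.
  apply: (is_derive_eq (is_derive_comp1 (@is_deriveNid R R s 1) (is_derive1_powR p ns0))).
  rewrite ltr0_norm// (_ : p - 1 = (p - 2) + 1); last by ring.
  rewrite powRD; last by apply/implyP => _; rewrite gt_eqF.
  by rewrite powRr1 ?ltW//; ring.
- apply: (@near_eq_is_derive _ _ _ (fun t => powR t p)).
    have s0' : s \in `]0, +oo[ by rewrite in_itv /= s0.
    have := near_in_itvoy s0'.
    by apply: filterS => t; rewrite in_itv /= andbT => t0; rewrite gtr0_norm.
  apply: is_derive_eq; first exact: (is_derive1_powR p s0).
  rewrite gtr0_norm// (_ : p - 1 = (p - 2) + 1); last by ring.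
  rewrite powRD; last by apply/implyP => _; rewrite gt_eqF.
  by rewrite powRr1 ?ltW.
- apply: is_derive_quotient => e e0.
  exists (Num.min e 1); first by rewrite lt_min e0 ltr01.
  move=> h h0; rewrite lt_min => /andP[he h1].
  rewrite add0r !mulr0 subr0 normr0 powR0 ?subr0; last by rewrite gt_eqF//; lra.
  rewrite powR_sub2// (_ : h^-1 * _ = powR `|h| (p - 2) * h); last by field.
  rewrite normrM ger0_norm ?powR_ge0//; apply: (le_trans _ (ltW he)).
  by rewrite ler_piMl// powR_le1 ?normr_ge0 ?(ltW h1)//; lra.
Qed.

(* [phi r = (1 - (A / r) ^ ((m + 1) / 2)) / (m + 1)]; the differential equation says
   that the field [(phi (|y|^2) y, z)] has constant divergence. *)
Lemma radial_weight_exists (m : nat) (A : R) : 0 < A -> exists phi dphi : R -> R,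
  [/\ forall r : R, 0 < r -> is_derive r (1 : R) phi (dphi r),
      forall r : R, 0 < r -> {for r, continuous dphi},
      forall r : R, 0 < r -> m.+1%:R * phi r + 2 * r * dphi r = 1,
      phi A = 0 &
      (forall r : R, A < r -> 0 < phi r) /\ (forall r : R, 0 < r -> m.+1%:R * phi r <= 1)].
Proof.
move=> A0; pose M : R := m.+1%:R; have M0 : 0 < M by rewrite ltr0n.
pose c := M / 2; have c0 : 0 < c by rewrite divr_gt0.
pose phi r := (1 - powR A c * powR r (- c)) / M.
(* Solving the differential equation for [dphi] makes it hold by construction; what remains is that
   this is the derivative of the explicit power. *)
pose dphi r := (1 - M * phi r) / (2 * r).
have dphiP (r : R) : 0 < r -> is_derive r (1 : R) phi (dphi r).
  move=> r0.
  have h : is_derive r (1 : R) (fun r => powR r (- c)) (- c * powR r (- c - 1)).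
    exact: is_derive1_powR.
  have h1 : is_derive r (1 : R) (fun r => 1 / M + (- (powR A c / M)) * powR r (- c))
     (- (powR A c / M) * (- c * powR r (- c - 1))).
    have := is_deriveD (is_derive_cst (1 / M) r (1 : R)) (is_deriveZ (- (powR A c / M)) h).
    by rewrite add0r.
  have -> : phi = (fun r => 1 / M + (- (powR A c / M)) * powR r (- c)).
    by apply/funext => t; rewrite /phi; field; rewrite gt_eqF.
  suff <- : - (powR A c / M) * (- c * powR r (- c - 1)) = dphi r by exact: h1.
  rewrite /dphi /phi.
  have -> : powR r (- c - 1) = powR r (- c) / r.
    rewrite powRD; last by apply/implyP => _; rewrite gt_eqF.
    by rewrite (powRN r 1) powRr1 ?ltW.
  by rewrite /c; field; rewrite !gt_eqF.
exists phi, dphi; split.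
- exact: dphiP.
- move=> r r0.
  have cphi : {for r, continuous phi}.
    by apply/differentiable_continuous/derivable1_diffP; have [] := dphiP r r0.
  have cc : {for r, continuous (fun r : R => 2 * r)}.
    by apply: continuousM; [exact: cst_continuous|exact: cvg_id].
  apply: continuousM.
    by apply: continuousB; [exact: cst_continuous|apply: continuousM; [exact: cst_continuous|exact: cphi]].
  apply: cvgV; first by rewrite mulf_neq0// gt_eqF.
  exact: cc.
- by move=> r r0; rewrite /dphi -/M; field; rewrite gt_eqF.
- rewrite /phi powRN divff ?subrr ?mul0r//.
  by rewrite gt_eqF// powR_gt0.
split=> r; last first.
  move=> _.
  rewrite -/M /phi mulrC divfK ?gt_eqF// lerBlDr lerDl.
  by rewrite mulr_ge0 ?powR_ge0.
move=> Ar; have r0 : 0 < r := lt_trans A0 Ar.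
rewrite /phi divr_gt0// subr_gt0 powRN ltr_pdivrMr ?powR_gt0// mul1r.
by apply: gt0_ltr_powR => //; rewrite nnegrE ltW.
Qed.

End Cutoffs.

(** * Finite-sum algebra: the divergence computation and Cauchy-Schwarz *)

Section FiniteSums.
Context {R : realType} {N : nat}.

Lemma sum_delta (P : pred 'I_N) (F : 'I_N -> R) i :
  \sum_(j | P j) (i == j)%:R * F j = if P i then F i else 0.
Proof.
rewrite big_mkcond /= (bigD1 i)//= eqxx mul1r big1 ?addr0// => j ji.
by rewrite eq_sym (negbTE ji) mul0r; case: ifP.
Qed.

(** To be read with [c] the field [chi], [dc] its Jacobian, [v] and [H] the gradient and Hessian of
    [u], [w = u] and [lam = k / p]. The products of [c . v] with the trace of [H] cancel because the
    equation makes the gradient of |u|^p / p equal to [- laplacian u] times that of [u]; the terms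
    [c H v] cancel because [H] is symmetric. *)
Lemma divergence_algebra (c v : 'I_N -> R) (dc H : 'I_N -> 'I_N -> R) (w B lam : R) :
  (forall i j, H i j = H j i) ->
  \sum_i ((\sum_j (dc i j * v j + c j * H i j) + lam * v i) * v i +
    (\sum_j c j * v j + lam * w) * H i i +
    ((- (\sum_j H j j * v i) - \sum_j v j * H i j) * c i + B * dc i i)) =
  \sum_i \sum_j dc i j * v i * v j + lam * \sum_i v i ^+ 2 +
    lam * w * (\sum_i H i i) + B * \sum_i dc i i.
Proof.
move=> Hs; rewrite !big_split /=.
have E1 : \sum_i (\sum_j (dc i j * v j + c j * H i j) + lam * v i) * v i =
    \sum_i \sum_j dc i j * v i * v j + \sum_i \sum_j c j * H i j * v i +
    lam * \sum_i v i ^+ 2.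
  rewrite [lam * _]mulr_sumr -!big_split /=; apply: eq_bigr => i _.
  rewrite mulrDl mulr_suml -big_split /=; congr (_ + _); last by ring.
  by apply: eq_bigr => j _; ring.
have E2 : \sum_i (\sum_j c j * v j + lam * w) * H i i =
    (\sum_j c j * v j) * (\sum_i H i i) + lam * w * (\sum_i H i i).
  by rewrite -mulr_sumr mulrDl.
have E3 : \sum_i (- (\sum_j H j j * v i) - \sum_j v j * H i j) * c i =
    - ((\sum_j c j * v j) * (\sum_i H i i)) - \sum_i \sum_j c j * H i j * v i.
  have -> : \sum_i \sum_j c j * H i j * v i = \sum_i (\sum_j v j * H i j) * c i.
    rewrite exchange_big /=; apply: eq_bigr => i _; rewrite mulr_suml.
    by apply: eq_bigr => j _; rewrite Hs; ring.
  rewrite mulr_suml -sumrN -sumrB; apply: eq_bigr => i _.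
  rewrite -mulr_suml; ring.
rewrite E1 E2 E3 -mulr_sumr.
move: (\sum_i \sum_j c j * H i j * v i) (\sum_i c i * v i) => X Y.
move: (\sum_i \sum_j dc i j * v i * v j) (\sum_i H i i) => Z T.
ring.
Qed.

Lemma card_ord_lt (k : nat) : (k <= N)%N -> \sum_(i < N | (i < k)%N) (1 : R) = k%:R.
Proof.
move=> kN; rewrite -(big_ord_widen _ (fun=> 1 : R) kN) sumr_const card_ord.
by [].
Qed.

Lemma card_ord_ge (k : nat) : (k <= N)%N -> \sum_(i < N | ~~ (i < k)%N) (1 : R) = (N - k)%:R.
Proof.
move=> kN; have := @card_ord_lt k kN.
have : \sum_(i < N) (1 : R) = N%:R by rewrite sumr_const card_ord.
rewrite (bigID (fun i : 'I_N => (i < k)%N)) /= natrB// => <- ->.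
by rewrite addrAC subrr add0r.
Qed.

Lemma cauchy_schwarz (P : pred 'I_N) (x v : 'I_N -> R) :
  (\sum_(i | P i) x i * v i) ^+ 2 <=
  (\sum_(i | P i) x i ^+ 2) * (\sum_(i | P i) v i ^+ 2).
Proof.
set X := \sum_(i | P i) x i ^+ 2; set V := \sum_(i | P i) v i ^+ 2.
set S := \sum_(i | P i) x i * v i.
have X0 : 0 <= X by apply: sumr_ge0 => i _; exact: sqr_ge0.
have V0 : 0 <= V by apply: sumr_ge0 => i _; exact: sqr_ge0.
have key t : 0 <= X - 2 * t * S + t ^+ 2 * V.
  have -> : X - 2 * t * S + t ^+ 2 * V = \sum_(i | P i) (x i - t * v i) ^+ 2.
    rewrite /X /S /V !mulr_sumr -sumrB -big_split /=.
    by apply: eq_bigr => i _; ring.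
  by apply: sumr_ge0 => i _; exact: sqr_ge0.
have [V00|V1] := eqVneq V 0.
  have S0 : S = 0.
    rewrite /S big1// => i Pi; move/eqP: V00.
    rewrite /V psumr_eq0; last by move=> k _; exact: sqr_ge0.
    move=> /allP /(_ i (mem_index_enum _)).
    by rewrite Pi /= sqrf_eq0 => /eqP ->; rewrite mulr0.
  by rewrite S0 expr0n /= mulr_ge0.
have Vp : 0 < V by rewrite lt_neqAle eq_sym V1.
have : 0 <= V * (X - 2 * (S / V) * S + (S / V) ^+ 2 * V) by rewrite mulr_ge0.
have -> : V * (X - 2 * (S / V) * S + (S / V) ^+ 2 * V) = X * V - S ^+ 2.
  by field.
by rewrite subr_ge0.
Qed.

End FiniteSums.

(** * The cutoffs in [y] and [z]: gradients and supports *)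

Section Fields.
Context {R : realType} {N m : nat} {a b : R} (a0 : 0 < a) (ab : a < b).
Local Notation Om := (@Omega R N m a b).
Implicit Types (x y v : 'rV[R]_N).
Let oO : open Om := open_Omega a0 ab.

Lemma is_derive_sqsum (P : pred 'I_N) i x :
  is_derive x (ebase R i) (fun y => \sum_(j | P j) y ord0 j ^+ 2)
    (if P i then 2 * x ord0 i else 0).
Proof.
have -> : (if P i then 2 * x ord0 i else 0) = \sum_(j | P j) (i == j)%:R * (2 * x ord0 j).
  by rewrite sum_delta.
apply: (@is_derive_bigsum _ _ _ _ _ _ (fun j x => (i == j)%:R * (2 * x ord0 j))) => j _.
have := is_derive_mul (is_derive_coord i j x) (is_derive_coord i j x).
by congr is_derive; ring.
Qed.

Lemma is_derive_rho i x : is_derive x (ebase R i) (rho m)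
  (if (i < m.+1)%N then 2 * x ord0 i else 0).
Proof. exact: is_derive_sqsum. Qed.

Lemma is_derive_sigma i x : is_derive x (ebase R i) (sigma m)
  (if (i < m.+1)%N then 0 else 2 * x ord0 i).
Proof.
have := is_derive_sqsum (fun j : 'I_N => ~~ (j < m.+1)%N) i x.
by rewrite if_neg.
Qed.

Lemma C1_rho (O : set 'rV[R]_N) : open O -> C1_on O (rho m).
Proof.
move=> oO'; apply: C1_sum => // i _; under eq_fun do rewrite expr2.
by apply: C1M => //; exact: C1_coord.
Qed.

(* [eta] vanishes where [tau <= e] and is [1] where [tau >= 2 e]; its gradient
   is [deta * skew * (2 y, 0)], and [skew ^+ 2 = (b ^+ 2 - a ^+ 2) ^+ 2 - 4 * tau]. *)
Definition eta (m : nat) (a b e : R) x : R := theta (tau m a b x / e - 1).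
Definition deta (m : nat) (a b e : R) x : R := dtheta (tau m a b x / e - 1) / e.
Definition skew (m : nat) (a b : R) x : R := a ^+ 2 + b ^+ 2 - 2 * rho m x.
(* A logarithmic cutoff in [z]: [|z| * |grad zcut|] is of order [d], uniformly. *)
Definition zcut (m : nat) (c d : R) x : R := sqpos (c - d * ln (1 + sigma m x)).
Definition dzcut (m : nat) (c d : R) x : R := 2 * pos_part (c - d * ln (1 + sigma m x)).

Lemma is_derive_affine (f : 'rV[R]_N -> R) (k c : R) x v df : is_derive x v f df ->
  is_derive x v (fun y => k * f y + c) (k * df).
Proof.
move=> fd; have := is_derive_add (is_derive_mul (is_derive_cst k x v) fd) (is_derive_cst c x v).
by rewrite mul0r add0r addr0.
Qed.

Lemma is_derive_skew i x : is_derive x (ebase R i) (skew m a b)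
  (if (i < m.+1)%N then - (4 * x ord0 i) else 0).
Proof.
have := is_derive_affine (-2) (a ^+ 2 + b ^+ 2) (is_derive_rho i x).
have -> : (fun y => -2 * rho m y + (a ^+ 2 + b ^+ 2)) = skew m a b.
  by apply/funext => y; rewrite /skew; ring.
by congr is_derive; case: ifP => _; ring.
Qed.

Lemma is_derive_tau i x : is_derive x (ebase R i) (tau m a b)
  (skew m a b x * (if (i < m.+1)%N then 2 * x ord0 i else 0)).
Proof.
have h1 := is_derive_affine 1 (- a ^+ 2) (is_derive_rho i x).
have h2 := is_derive_affine (-1) (b ^+ 2) (is_derive_rho i x).
have := is_derive_mul h1 h2.
have -> : (fun y => (1 * rho m y - a ^+ 2) * (-1 * rho m y + b ^+ 2)) = tau m a b.
  by apply/funext => y; rewrite /tau; ring.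
by congr is_derive; rewrite /skew; ring.
Qed.

Lemma is_derive_eta e i x : is_derive x (ebase R i) (eta m a b e)
  (deta m a b e x * (skew m a b x * (if (i < m.+1)%N then 2 * x ord0 i else 0))).
Proof.
have h := is_derive_affine e^-1 (-1) (is_derive_tau i x).
have := is_derive_comp1 h (is_derive_theta _).
have -> : (fun y => theta (e^-1 * tau m a b y + -1)) = eta m a b e.
  by apply/funext => y; rewrite /eta mulrC.
by congr is_derive; rewrite /deta [e^-1 * tau _ _ _ _]mulrC; ring.
Qed.

Lemma deta_continuous e x : {for x, continuous (deta m a b e)}.
Proof.
apply: continuousM; last exact: cst_continuous.
apply: (@continuous_comp _ _ _ (fun x => tau m a b x / e - 1)); last exact: dtheta_continuous.
apply: continuousB; last exact: cst_continuous.
by apply: continuousM; [exact: tau_continuous|exact: cst_continuous].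
Qed.

Lemma skew_continuous x : {for x, continuous (skew m a b)}.
Proof.
apply: continuousB; first exact: cst_continuous.
by apply: continuousM; [exact: cst_continuous|exact: rho_continuous].
Qed.

Lemma C1_eta e (O : set 'rV[R]_N) : open O -> C1_on O (eta m a b e).
Proof.
move=> oO'; apply: (C1_of oO' (df := fun i x =>
   deta m a b e x * (skew m a b x * (if (i < m.+1)%N then 2 * x ord0 i else 0)))).
- move=> x _; apply: (@continuous_comp _ _ _ (fun x => tau m a b x / e - 1)).
    apply: continuousB; last exact: cst_continuous.
    by apply: continuousM; [exact: tau_continuous|exact: cst_continuous].
  by apply/differentiable_continuous/derivable1_diffP; have [] := is_derive_theta (tau m a b x / e - 1).
- by move=> i x _; exact: is_derive_eta.
- move=> i x _; apply: continuousM; first exact: deta_continuous.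
  apply: continuousM; first exact: skew_continuous.
  case: (i < m.+1)%N; last exact: cst_continuous.
  by apply: continuousM; [exact: cst_continuous|exact: coord_continuous].
Qed.

Lemma C1_skew (O : set 'rV[R]_N) : open O -> C1_on O (skew m a b).
Proof.
move=> oO'; apply: (C1_of oO' (df := fun i x => if (i < m.+1)%N then - (4 * x ord0 i) else 0)).
- by move=> x _; exact: skew_continuous.
- by move=> i x _; exact: is_derive_skew.
- move=> i x _; case: (i < m.+1)%N; last exact: cst_continuous.
  by apply: continuousN; apply: continuousM; [exact: cst_continuous|exact: coord_continuous].
Qed.

Lemma logsig_continuous c d x : {for x, continuous (fun x => c - d * ln (1 + sigma m x))}.
Proof.
apply: continuousB; first exact: cst_continuous.
apply: continuousM; first exact: cst_continuous.
apply: (@continuous_comp _ _ _ (fun x => 1 + sigma m x)).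
  by apply: continuousD; [exact: cst_continuous|exact: sigma_continuous].
by apply: continuous_ln; rewrite ltr_pwDl// sigma_ge0.
Qed.

Lemma is_derive_zcut c d i x : is_derive x (ebase R i) (zcut m c d)
  (dzcut m c d x * (- d / (1 + sigma m x) * (if (i < m.+1)%N then 0 else 2 * x ord0 i))).
Proof.
have s1 : 0 < 1 + sigma m x by rewrite ltr_pwDl// sigma_ge0.
have h1 := is_derive_affine 1 1 (is_derive_sigma i x).
have s1' : 0 < 1 * sigma m x + 1 by rewrite mul1r addrC.
have h2 := is_derive_comp1 h1 (is_derive1_ln s1').
have h3 := is_derive_affine (- d) c h2.
have := is_derive_comp1 h3 (is_derive_sqpos _).
have E y : - d * ln (1 * sigma m y + 1) + c = c - d * ln (1 + sigma m y).
  by rewrite mul1r [sigma m y + 1]addrC; ring.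
under eq_fun do rewrite E.
congr is_derive; rewrite E /dzcut mul1r [sigma m x + 1]addrC; ring.
Qed.

Lemma dzcut_continuous c d x : {for x, continuous (dzcut m c d)}.
Proof.
apply: continuousM; first exact: cst_continuous.
apply: (@continuous_comp _ _ _ (fun x => c - d * ln (1 + sigma m x)));
  [exact: logsig_continuous|exact: pos_part_continuous].
Qed.

Lemma zcut_continuous c d x : {for x, continuous (zcut m c d)}.
Proof.
apply: (@continuous_comp _ _ _ (fun x => c - d * ln (1 + sigma m x)));
  [exact: logsig_continuous|exact: sqpos_continuous].
Qed.

Lemma C1_zcut c d (O : set 'rV[R]_N) : open O -> C1_on O (zcut m c d).
Proof.
move=> oO'; apply: (C1_of oO' (df := fun i x =>
  dzcut m c d x * (- d / (1 + sigma m x) * (if (i < m.+1)%N then 0 else 2 * x ord0 i)))).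
- by move=> x _; exact: zcut_continuous.
- by move=> i x _; exact: is_derive_zcut.
- move=> i x _; apply: continuousM; first exact: dzcut_continuous.
  apply: continuousM.
    apply: continuousM; first exact: cst_continuous.
    have ne0 : 1 + sigma m x != 0 by rewrite gt_eqF// ltr_pwDl// sigma_ge0.
    have c1 : {for x, continuous (fun x => 1 + sigma m x)}.
      by apply: continuousD; [exact: cst_continuous|exact: sigma_continuous].
    exact: (@cvgV _ _ (nbhs x) _ (fun x => 1 + sigma m x) (1 + sigma m x) ne0 c1).
  case: (i < m.+1)%N; first exact: cst_continuous.
  by apply: continuousM; [exact: cst_continuous|exact: coord_continuous].
Qed.

Lemma zcut_sigma_le c d x : 0 < d -> 0 < c - d * ln (1 + sigma m x) -> sigma m x <= expR (c / d).
Proof.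
move=> d0 h; have s1 : 0 < 1 + sigma m x by rewrite ltr_pwDl// sigma_ge0.
apply: (@le_trans _ _ (1 + sigma m x)); first by rewrite lerDr.
rewrite -[leLHS]lnK ?posrE// ler_expR ler_pdivlMr// mulrC.
by move: h; lra.
Qed.

Lemma inner_supported_cut e c d (F h : 'rV[R]_N -> R) : 0 < e -> 0 < d ->
  (forall x, tau m a b x < e -> F x = 0) ->
  (forall x, c - d * ln (1 + sigma m x) <= 0 -> h x = 0) ->
  inner_supported Om (fun x => F x * h x).
Proof.
move=> e0 d0 F0 h0.
have b0 : 0 < b := lt_trans a0 ab.
split.
  exists [set x | tau m a b x < e]; split.
  - have -> : [set x | tau m a b x < e] = tau m a b @^-1` [set t | t < e] by [].
    apply: open_comp; last exact: open_lt.
    by move=> x _; exact: tau_continuous.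
  - move=> x; have [|te] := ltP (tau m a b x) e; first by right.
    by left; apply/(Omega_tau a0 ab); exact: lt_le_trans te.
  - by move=> x xe; rewrite F0 ?mul0r.
(* The [+ 1] passes from a bound on a coordinate to one on its square. A large coordinate in [y]
   makes [F] vanish, one in [z] makes [h] vanish. *)
exists (b ^+ 2 + expR (c / d) + 1) => x i xi.
have E0 := expR_gt0 (c / d); have B0 : 0 < b ^+ 2 by exact: exprn_gt0.
have xi2 : b ^+ 2 + expR (c / d) < x ord0 i ^+ 2.
  rewrite -(real_normK (num_real (x ord0 i))).
  move: (`|x ord0 i|) xi E0 B0 => t; move: (expR _) (b ^+ 2) => E B; nra.
have [im|im] := boolP (i < m.+1)%N.
  have rx : b ^+ 2 < rho m x.
    apply: (@lt_le_trans _ _ (x ord0 i ^+ 2)); first by move: xi2 E0; lra.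
    rewrite /rho (bigD1 i)//= lerDl; apply: sumr_ge0 => k _; exact: sqr_ge0.
  rewrite F0 ?mul0r//; apply: le_lt_trans e0.
  have AB := a2_lt_b2 a0 ab.
  by rewrite /tau mulr_ge0_le0// ?subr_ge0 ?subr_le0 ?ltW// (lt_trans AB).
have sx : expR (c / d) < sigma m x.
  apply: (@lt_le_trans _ _ (x ord0 i ^+ 2)); first by move: xi2 B0; lra.
  rewrite /sigma (bigD1 i)//= lerDl; apply: sumr_ge0 => k _; exact: sqr_ge0.
rewrite h0 ?mulr0// leNgt; apply/negP => /(zcut_sigma_le d0).
by rewrite leNgt sx.
Qed.

Lemma eta_tau_lt e x : 0 < e -> tau m a b x < e -> eta m a b e x = 0.
Proof. by move=> e0 te; rewrite /eta theta_le0// subr_le0 ler_pdivrMr// mul1r ltW. Qed.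

Lemma deta_tau_lt e x : 0 < e -> tau m a b x < e -> deta m a b e x = 0.
Proof. by move=> e0 te; rewrite /deta dtheta_le0 ?mul0r// subr_le0 ler_pdivrMr// mul1r ltW. Qed.

Lemma deta_tau_ge e x : 0 < e -> 2 * e <= tau m a b x -> deta m a b e x = 0.
Proof. by move=> e0 te; rewrite /deta dtheta_ge1 ?mul0r// lerBrDr ler_pdivlMr. Qed.

Lemma deta_ge0 e x : 0 < e -> 0 <= deta m a b e x.
Proof. by move=> e0; rewrite /deta divr_ge0 ?dtheta_ge0// ltW. Qed.

End Fields.

(** * The Pohozaev field and its divergence *)

Section Pohozaev.
Context {R : realType} {N m : nat} {a b p : R} {u : 'rV[R]_N -> R} {phi dphi : R -> R}.
Hypotheses (a0 : 0 < a) (ab : a < b) (hm2 : (m < N - 2)%N) (hp2 : 2 < p).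
Local Notation Om := (@Omega R N m a b).
Local Notation k := ((N - m)%:R : R).
Hypothesis hpk : 1 <= k * (1 / 2 - 1 / p).
Hypothesis Cu : C1_on Om u.
Hypothesis Cpu : forall i, C1_on Om (partial i u).
Hypothesis heq : forall x, Om x -> - laplacian u x = powR `|u x| (p - 2) * u x.
Hypothesis phiD : forall r : R, 0 < r -> is_derive r (1 : R) phi (dphi r).
Hypothesis dphiC : forall r : R, 0 < r -> {for r, continuous dphi}.
Hypothesis phiE : forall r : R, 0 < r -> m.+1%:R * phi r + 2 * r * dphi r = 1.
Hypothesis phi_gt0 : forall r : R, a ^+ 2 < r -> 0 < phi r.
Hypothesis phi_le : forall r : R, 0 < r -> m.+1%:R * phi r <= 1.
Let oO : open Om := open_Omega a0 ab.
Implicit Types x y : 'rV[R]_N.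

Definition upow (p : R) (u : 'rV[R]_N -> R) x : R := powR `|u x| p.
Definition chi (m : nat) (phi : R -> R) (j : 'I_N) x : R :=
  (if (j < m.+1)%N then phi (rho m x) else 1) * x ord0 j.
Definition dchi (m : nat) (phi dphi : R -> R) (i j : 'I_N) x : R :=
  (i == j)%:R * (if (j < m.+1)%N then phi (rho m x) else 1) +
  (if (i < m.+1)%N && (j < m.+1)%N then 2 * dphi (rho m x) * x ord0 i * x ord0 j else 0).
Definition pohA x : R := \sum_j chi m phi j x * partial j u x + k / p * u x.
Definition pohB x : R := upow p u x / p - grad_sq u x / 2.
(* Pohozaev field combined with [k / p * u * grad u], so that the [|u|^p] terms
   cancel in the divergence. *)
Definition pohG (i : 'I_N) x : R := pohA x * partial i u x + pohB x * chi m phi i x.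
Definition gradY (x : 'rV[R]_N) : R := \sum_(i < N | (i < m.+1)%N) partial i u x ^+ 2.
Definition gradZ (x : 'rV[R]_N) : R := \sum_(i < N | ~~ (i < m.+1)%N) partial i u x ^+ 2.
Definition dotY (x : 'rV[R]_N) : R := \sum_(i < N | (i < m.+1)%N) x ord0 i * partial i u x.
Definition dotZ (x : 'rV[R]_N) : R := \sum_(i < N | ~~ (i < m.+1)%N) x ord0 i * partial i u x.

Lemma continuous_bigsum (I : Type) (r : seq I) (P : pred I) (h : I -> 'rV[R]_N -> R) x :
  (forall i, P i -> {for x, continuous (h i)}) ->
  {for x, continuous (fun y => \sum_(i <- r | P i) h i y)}.
Proof.
move=> ch; apply: (@fun_sum_ind _ _ _ _ _ (fun f => {for x, continuous f})) => //.
  exact: cst_continuous.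
by move=> f1 f2 c1 c2; exact: continuousD.
Qed.

Lemma mN : (m.+1 <= N)%N.
Proof. exact: leq_trans hm2 (leq_subr _ _). Qed.

Lemma Omega_rho_gt0 x : Om x -> 0 < rho m x.
Proof. by move=> /(OmegaP a0 ab)/andP[+ _]; exact: lt_trans (a2_gt0 a0). Qed.

(** Using the equation inside the derivative has two benefits: continuity reduces to that of the
    second derivatives, and the result matches the pattern of [divergence_algebra]. *)
Lemma is_derive_upow i x : Om x ->
  is_derive x (ebase R i) (upow p u) (p * - laplacian u x * partial i u x).
Proof.
move=> Ox; rewrite heq//.
exact: (is_derive_comp1 (C1_is_derive i Cu Ox) (is_derive_powR_norm (u x) hp2)).
Qed.

Lemma powR_norm_continuous : continuous (fun t : R => powR `|t| p).
Proof.
by move=> t; apply/differentiable_continuous/derivable1_diffP;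
  have [] := is_derive_powR_norm t hp2.
Qed.

Lemma C1_upow : C1_on Om (upow p u).
Proof.
apply: (C1_of oO (df := fun i x => p * - laplacian u x * partial i u x)).
- move=> x Ox; apply: (@continuous_comp _ _ _ u (fun t : R => powR `|t| p)).
    exact: (C1_continuous Cu Ox).
  exact: powR_norm_continuous.
- by move=> i x; exact: is_derive_upow.
- move=> i x Ox; apply: continuousM; last exact: (C1_continuous (Cpu i) Ox).
  apply: continuousM; first exact: cst_continuous.
  apply: continuousN; apply: continuous_bigsum => j _.
  exact: (C1_continuous_partial (Cpu j) Ox).
Qed.

Lemma C1_chi j : C1_on Om (chi m phi j).
Proof.
rewrite /chi; refine (C1M oO _ (C1_coord oO j)).
case: (j < m.+1)%N; last exact: (C1_cst oO 1).
refine (C1_comp oO (g' := dphi) (C1_rho oO) _ _) => x /Omega_rho_gt0.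
  exact: phiD.
exact: dphiC.
Qed.

Lemma is_derive_chi i j x : Om x ->
  is_derive x (ebase R i) (chi m phi j) (dchi m phi dphi i j x).
Proof.
move=> Ox; rewrite /chi /dchi.
have [jm|jm] := boolP (j < m.+1)%N.
  have h := is_derive_comp1 (is_derive_rho (m := m) i x) (phiD (Omega_rho_gt0 Ox)).
  have := is_derive_mul h (is_derive_coord i j x).
  by congr is_derive; rewrite andbT; case: ifP => _; ring.
have := is_derive_mul (is_derive_cst (1 : R) x (ebase R i)) (is_derive_coord i j x).
by congr is_derive; rewrite /= andbF; ring.
Qed.

Lemma C1_gradsq : C1_on Om (grad_sq u).
Proof.
apply: (C1_sum oO) => i _; under eq_fun do rewrite expr2.
exact: (C1M oO (Cpu i) (Cpu i)).
Qed.

Lemma C1_pohA : C1_on Om pohA.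
Proof.
refine (C1D oO _ (C1M oO (C1_cst oO (k / p)) Cu)).
by apply: (C1_sum oO) => j _; exact: (C1M oO (C1_chi j) (Cpu j)).
Qed.

Lemma C1_pohB : C1_on Om pohB.
Proof.
have -> : pohB = (fun x => p^-1 * upow p u x + (- (1 / 2)) * grad_sq u x).
  by apply/funext => x; rewrite /pohB; field; rewrite gt_eqF// (lt_trans _ hp2).
exact: (C1D oO (C1M oO (C1_cst oO p^-1) C1_upow)
  (C1M oO (C1_cst oO (- (1 / 2))) C1_gradsq)).
Qed.

Lemma C1_pohG i : C1_on Om (pohG i).
Proof.
exact: (C1D oO (C1M oO C1_pohA (Cpu i)) (C1M oO C1_pohB (C1_chi i))).
Qed.

Lemma gradsqE x : grad_sq u x = gradY x + gradZ x.
Proof. by rewrite /grad_sq (bigID (fun i : 'I_N => (i < m.+1)%N)). Qed.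

Lemma is_derive_pohA i x : Om x -> is_derive x (ebase R i) pohA
  (\sum_j (dchi m phi dphi i j x * partial j u x +
     chi m phi j x * partial i (partial j u) x) + k / p * partial i u x).
Proof.
move=> Ox; apply: is_derive_add.
  apply: (@is_derive_bigsum _ _ _ _ _ _ (fun j x => dchi m phi dphi i j x * partial j u x +
     chi m phi j x * partial i (partial j u) x)) => j _.
  apply: is_derive_mul; first exact: is_derive_chi.
  exact: C1_is_derive (Cpu j) Ox.
have := is_derive_mul (is_derive_cst (k / p) x (ebase R i)) (C1_is_derive i Cu Ox).
by rewrite mul0r add0r.
Qed.

Lemma is_derive_gradsq i x : Om x -> is_derive x (ebase R i) (grad_sq u)
  (\sum_j 2 * (partial j u x * partial i (partial j u) x)).
Proof.
move=> Ox.
apply: (@is_derive_bigsum _ _ _ _ _ _ (fun j x => 2 * (partial j u x * partial i (partial j u) x))) => j _.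
have h := C1_is_derive i (Cpu j) Ox.
have := is_derive_mul h h.
by congr is_derive; ring.
Qed.

Lemma is_derive_pohB i x : Om x -> is_derive x (ebase R i) pohB
  (- (laplacian u x * partial i u x) - \sum_j partial j u x * partial i (partial j u) x).
Proof.
move=> Ox.
have h1 := is_derive_affine p^-1 0 (is_derive_upow i Ox).
have h2 := is_derive_affine (- (1 / 2)) 0 (is_derive_gradsq i Ox).
have p0 : p != 0 by rewrite gt_eqF// (lt_trans _ hp2).
have := is_derive_add h1 h2.
have -> : (fun y => p^-1 * upow p u y + 0 + (- (1 / 2) * grad_sq u y + 0)) = pohB.
  by apply/funext => y; rewrite /pohB; field.
congr is_derive; rewrite -mulr_sumr.
by move: (\sum_j _) => s; field.
Qed.

Lemma is_derive_pohG i x : Om x -> is_derive x (ebase R i) (pohG i)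
  ((\sum_j (dchi m phi dphi i j x * partial j u x +
     chi m phi j x * partial i (partial j u) x) + k / p * partial i u x) * partial i u x +
   pohA x * partial i (partial i u) x +
   ((- (laplacian u x * partial i u x) -
     \sum_j partial j u x * partial i (partial j u) x) * chi m phi i x +
    pohB x * dchi m phi dphi i i x)).
Proof.
move=> Ox; apply: is_derive_add; apply: is_derive_mul.
- exact: is_derive_pohA.
- exact: C1_is_derive (Cpu i) Ox.
- exact: is_derive_pohB.
- exact: is_derive_chi.
Qed.

(** The [m.+1] coordinates of [y] contribute 1 in total, by the differential equation for [phi], and
    each of the [N - m - 1] coordinates of [z] contributes 1. *)
Lemma div_chi x : Om x -> \sum_i dchi m phi dphi i i x = k.
Proof.
move=> Ox; have r0 := Omega_rho_gt0 Ox.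
have -> : \sum_i dchi m phi dphi i i x =
  \sum_(i < N | (i < m.+1)%N) (phi (rho m x) * 1 + 2 * dphi (rho m x) * x ord0 i ^+ 2) +
  \sum_(i < N | ~~ (i < m.+1)%N) 1.
  rewrite (bigID (fun i : 'I_N => (i < m.+1)%N)) /=; congr (_ + _); apply: eq_bigr => i im.
    by rewrite /dchi eqxx im /=; ring.
  by rewrite /dchi eqxx (negbTE im) /=; ring.
rewrite big_split /= -!mulr_sumr -/(rho m x) card_ord_lt ?mN// card_ord_ge ?mN//.
have -> : 2 * dphi (rho m x) * rho m x = 1 - m.+1%:R * phi (rho m x).
  by rewrite -[X in X - _](phiE r0); ring.
rewrite !natrB ?mN//; last by apply: ltnW; exact: mN.
by rewrite -[m.+1]addn1 natrD; ring.
Qed.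

Lemma dchi_form x : \sum_i \sum_j dchi m phi dphi i j x * partial i u x * partial j u x =
  phi (rho m x) * gradY x + gradZ x + 2 * dphi (rho m x) * dotY x ^+ 2.
Proof.
have E i : \sum_j dchi m phi dphi i j x * partial i u x * partial j u x =
    (if (i < m.+1)%N then phi (rho m x) else 1) * partial i u x ^+ 2 +
    (if (i < m.+1)%N then 2 * dphi (rho m x) * (x ord0 i * partial i u x) * dotY x else 0).
  have -> : \sum_j dchi m phi dphi i j x * partial i u x * partial j u x =
    \sum_(j < N) (i == j)%:R * ((if (j < m.+1)%N then phi (rho m x) else 1) * partial i u x * partial j u x) +
    \sum_(j < N) (if (i < m.+1)%N && (j < m.+1)%N then 2 * dphi (rho m x) * x ord0 i * x ord0 j else 0) * partial i u x * partial j u x.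
    rewrite -big_split /=; apply: eq_bigr => j _.
    by rewrite /dchi !mulrDl !mulrA.
  rewrite sum_delta /=; congr (_ + _); first by rewrite expr2 mulrA.
  case: ifP => im; last by apply: big1 => j _; rewrite !mul0r.
  rewrite /dotY mulr_sumr [RHS]big_mkcond /=; apply: eq_bigr => j _.
  by case: ifP => _; ring.
under eq_bigr do rewrite E.
rewrite big_split /= (bigID (fun i : 'I_N => (i < m.+1)%N)) /=.
congr (_ + _ + _).
- by rewrite /gradY mulr_sumr; apply: eq_bigr => i ->.
- by rewrite /gradZ; apply: eq_bigr => i /negbTE ->; rewrite mul1r.
rewrite -big_mkcond /= -mulr_suml -mulr_sumr -/(dotY x).
by ring.
Qed.

Lemma gradY_ge0 x : 0 <= gradY x.
Proof. by apply: sumr_ge0 => i _; exact: sqr_ge0. Qed.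

Lemma gradZ_ge0 x : 0 <= gradZ x.
Proof. by apply: sumr_ge0 => i _; exact: sqr_ge0. Qed.

Lemma upow_ge0 x : 0 <= upow p u x.
Proof. exact: powR_ge0. Qed.

Lemma upowE x : Om x -> u x * laplacian u x = - upow p u x.
Proof.
move=> Ox; rewrite -[laplacian u x]opprK heq// /upow (powR_sub2 _ hp2); ring.
Qed.

Lemma div_pohG x : Om x -> \sum_i partial i (pohG i) x =
  phi (rho m x) * gradY x + gradZ x + 2 * dphi (rho m x) * dotY x ^+ 2 -
  k * (1 / 2 - 1 / p) * grad_sq u x.
Proof.
move=> Ox.
have p0 : p != 0 by rewrite gt_eqF// (lt_trans _ hp2).
have -> : \sum_i partial i (pohG i) x =
  \sum_i ((\sum_j (dchi m phi dphi i j x * partial j u x +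
     chi m phi j x * partial i (partial j u) x) + k / p * partial i u x) * partial i u x +
   (\sum_j chi m phi j x * partial j u x + k / p * u x) * partial i (partial i u) x +
   ((- (\sum_j partial j (partial j u) x * partial i u x) -
     \sum_j partial j u x * partial i (partial j u) x) * chi m phi i x +
    pohB x * dchi m phi dphi i i x)).
  apply: eq_bigr => i _; rewrite -mulr_suml -/(laplacian u x).
  by have [_ h] := is_derive_pohG i Ox; exact: h.
rewrite (divergence_algebra (fun j => chi m phi j x) (fun j => partial j u x)
  (fun i j => dchi m phi dphi i j x) (H := fun i j => partial i (partial j u) x)); last first.
  by move=> i j; exact: (partial_sym oO _ _ Cu Cpu Ox).
rewrite div_chi// dchi_form -/(laplacian u x) -/(grad_sq u x).
have -> : k / p * u x * laplacian u x = - (k / p * upow p u x).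
  by rewrite -mulrA upowE//; ring.
by rewrite /pohB; field.
Qed.

(** The bound [m.+1 * phi <= 1] gives [dphi >= 0], so Cauchy-Schwarz on [dotY] bounds the y-part of
    the quadratic form by its radial value [1 - m * phi] times [gradY]. By [hpk], the term in
    [grad_sq] absorbs the remaining [gradY + gradZ]. *)
Lemma div_pohG_le x : Om x ->
  \sum_i partial i (pohG i) x <= - (m%:R * phi (rho m x) * gradY x).
Proof.
move=> Ox; rewrite div_pohG// gradsqE.
have r0 := Omega_rho_gt0 Ox.
have CS : dotY x ^+ 2 <= rho m x * gradY x by exact: cauchy_schwarz.
have E : 2 * dphi (rho m x) * rho m x = 1 - m.+1%:R * phi (rho m x).
  by rewrite -[X in X - _](phiE r0); ring.
have dphi0 : 0 <= dphi (rho m x).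
  have := phi_le r0; rewrite -subr_ge0 -E => h.
  by rewrite -(pmulr_lge0 _ r0) -(pmulr_rge0 _ (ltr0Sn R 1)) mulrA.
have H1 : 2 * dphi (rho m x) * dotY x ^+ 2 <= (1 - m.+1%:R * phi (rho m x)) * gradY x.
  by rewrite -E -[leRHS]mulrA ler_wpM2l// mulr_ge0.
have H2 : gradY x + gradZ x <= k * (1 / 2 - 1 / p) * (gradY x + gradZ x).
  by rewrite ler_peMl// addr_ge0 ?gradY_ge0 ?gradZ_ge0.
have H3 : m.+1%:R * phi (rho m x) = m%:R * phi (rho m x) + phi (rho m x).
  by rewrite -[m.+1]addn1 natrD mulrDl mul1r.
rewrite H3 in H1.
have {}H1 : 2 * dphi (rho m x) * dotY x ^+ 2 <=
    gradY x - m%:R * phi (rho m x) * gradY x - phi (rho m x) * gradY x.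
  by apply: (le_trans H1); rewrite le_eqVlt; apply/orP; left; apply/eqP; ring.
move: H1 H2; move: (k * (1 / 2 - 1 / p) * (gradY x + gradZ x)) (2 * dphi (rho m x) * dotY x ^+ 2)
  (m%:R * phi (rho m x) * gradY x) (phi (rho m x) * gradY x) => A B C D.
lra.
Qed.

(** * Bounds on the cutoffs and integration of cut-off fields *)

Lemma zcut_le0 c d x : c - d * ln (1 + sigma m x) <= 0 -> zcut m c d x = 0.
Proof. by move=> h; rewrite /zcut /sqpos pos_part0// expr0n. Qed.

Lemma zcut_ge0 c d x : 0 <= zcut m c d x.
Proof. exact: sqr_ge0. Qed.

Lemma eta_ge0 e x : 0 <= eta m a b e x.
Proof. exact: theta_ge0. Qed.

Lemma eta_le1 e x : eta m a b e x <= 1.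
Proof. exact: theta_le1. Qed.

Lemma lnsigma_ge0 x : 0 <= ln (1 + sigma m x).
Proof. by rewrite ln_ge0// lerDl sigma_ge0. Qed.

Lemma zcut2_le4 d x : 0 < d -> zcut m 2 d x <= 4.
Proof.
move=> d0; rewrite (_ : 4 = 2 ^+ 2); last by ring.
rewrite /zcut /sqpos ler_sqr ?nnegrE ?pos_part_ge0// /pos_part ge_max.
by rewrite ler0n /= lerBlDr lerDl mulr_ge0 ?lnsigma_ge0// ltW.
Qed.

Lemma zcut1_le d x : zcut m 1 d x <= zcut m 2 d x.
Proof. by rewrite /zcut le_sqpos// lerD2r ler1n. Qed.

Lemma dzcut_ge0 c d x : 0 <= dzcut m c d x.
Proof. by rewrite /dzcut mulr_ge0// pos_part_ge0. Qed.

(** The reason for two levels of cutoff: near the edge of its support a squared positive part does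
    not control its own derivative, but the same profile shifted by 1 does. *)
Lemma dzcut1_le d x : dzcut m 1 d x <= 2 * zcut m 2 d x.
Proof.
rewrite /dzcut /zcut; set t := 1 - _.
have -> : 2 - d * ln (1 + sigma m x) = t + 1 by rewrite /t; ring.
rewrite ler_pM2l//; move: t => t; have [t0|t0] := leP t 0.
  by rewrite (pos_part0 t0) sqr_ge0.
rewrite /sqpos !pos_part_id ?(ltW t0)//; last by rewrite addr_ge0// ltW.
nra.
Qed.

Lemma eta_continuous e x : {for x, continuous (eta m a b e)}.
Proof.
exact: (C1_continuous (C1_eta (m := m) (a := a) (b := b) e openT) (x := x) Logic.I).
Qed.

Lemma inner_supported_eta e c d (h : 'rV[R]_N -> R) : 0 < e -> 0 < d ->
  inner_supported Om (fun x => eta m a b e x * (zcut m c d x * h x)).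
Proof.
move=> e0 d0; apply: (inner_supported_cut a0 ab (e := e) (c := c) (d := d) e0 d0).
  by move=> x; exact: eta_tau_lt.
by move=> x /zcut_le0 ->; rewrite mul0r.
Qed.

Lemma Cc_eta e c d (h : 'rV[R]_N -> R) : 0 < e -> 0 < d ->
  (forall x, Om x -> {for x, continuous h}) ->
  Cc (fun x => eta m a b e x * (zcut m c d x * h x)).
Proof.
move=> e0 d0 ch; apply: (inner_supported_Cc (inner_supported_eta c h e0 d0)) => x Ox.
apply: continuousM; first exact: eta_continuous.
by apply: continuousM; [exact: zcut_continuous|exact: ch].
Qed.

Lemma Cc_deta e c d (h : 'rV[R]_N -> R) : 0 < e -> 0 < d ->
  (forall x, Om x -> {for x, continuous h}) ->
  Cc (fun x => deta m a b e x * (zcut m c d x * h x)).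
Proof.
move=> e0 d0 ch.
have A : inner_supported Om (fun x => deta m a b e x * (zcut m c d x * h x)).
  apply: (inner_supported_cut a0 ab (e := e) (c := c) (d := d) e0 d0).
    by move=> x; exact: deta_tau_lt.
  by move=> x /zcut_le0 ->; rewrite mul0r.
apply: (inner_supported_Cc A) => x Ox; apply: continuousM; first exact: deta_continuous.
by apply: continuousM; [exact: zcut_continuous|exact: ch].
Qed.

(** The second factor is a continuous majorant of the indicator of |y| <= b; it is free of [e] and
    so bounds the layer mass uniformly. *)
Lemma Cc_box c d : 0 < d ->
  Cc (fun x : 'rV[R]_N => zcut m c d x * pos_part (2 - rho m x / b ^+ 2)).
Proof.
move=> d0; have B0 : 0 < b ^+ 2 by rewrite exprn_gt0// (lt_trans a0).
split.
  move=> x; apply: continuousM; first exact: zcut_continuous.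
  apply: (@continuous_comp _ _ _ (fun x => 2 - rho m x / b ^+ 2)); last exact: pos_part_continuous.
  apply: continuousB; first exact: cst_continuous.
  by apply: continuousM; [exact: rho_continuous|exact: cst_continuous].
exists (2 * b ^+ 2 + expR (c / d) + 1) => x i xi.
have E0 := expR_gt0 (c / d).
have xi2 : 2 * b ^+ 2 + expR (c / d) < x ord0 i ^+ 2.
  rewrite -(real_normK (num_real (x ord0 i))).
  move: (`|x ord0 i|) xi E0 B0 => t; move: (expR _) (b ^+ 2) => E B; nra.
have [im|im] := boolP (i < m.+1)%N.
  have rx : 2 * b ^+ 2 < rho m x.
    apply: (@lt_le_trans _ _ (x ord0 i ^+ 2)); first by move: xi2 E0; lra.
    by rewrite /rho (bigD1 i)//= lerDl; apply: sumr_ge0 => j _; exact: sqr_ge0.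
  by rewrite (@pos_part0 _ (2 - _)) ?mulr0// subr_le0 ler_pdivlMr// ltW.
have sx : expR (c / d) < sigma m x.
  apply: (@lt_le_trans _ _ (x ord0 i ^+ 2)); first by move: xi2 B0; lra.
  by rewrite /sigma (bigD1 i)//= lerDl; apply: sumr_ge0 => j _; exact: sqr_ge0.
rewrite zcut_le0 ?mul0r// leNgt; apply/negP => /(zcut_sigma_le d0).
by rewrite leNgt sx.
Qed.

Lemma partial_cut e c d (H : 'rV[R]_N -> R) i x : C1_on Om H -> Om x ->
  partial i (fun x => eta m a b e x * (zcut m c d x * H x)) x =
  deta m a b e x * (skew m a b x * (if (i < m.+1)%N then 2 * x ord0 i else 0)) *
    (zcut m c d x * H x) +
  eta m a b e x * (dzcut m c d x * (- d / (1 + sigma m x) *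
    (if (i < m.+1)%N then 0 else 2 * x ord0 i)) * H x + zcut m c d x * partial i H x).
Proof.
move=> CH Ox.
have h1 := is_derive_mul (is_derive_zcut (m := m) c d i x) (C1_is_derive i CH Ox).
have [_ h2] := is_derive_mul (is_derive_eta (m := m) (a := a) (b := b) e i x) h1.
exact: h2.
Qed.

(** The common frame of the three integral inequalities below: a pointwise estimate modulo the
    divergence of a cut-off field is integrated, and the divergence disappears. *)
Lemma Lint_div_le e c d (P : pred 'I_N) (H : 'I_N -> 'rV[R]_N -> R)
    (X Z : 'rV[R]_N -> R) (sg : R) : 0 < e -> 0 < d ->
  (forall i, C1_on Om (H i)) -> Cc X -> Cc Z ->
  (forall x, Om x -> X x - Z x <= sg * \sum_(i | P i)
     partial i (fun x => eta m a b e x * (zcut m c d x * H i x)) x) ->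
  (forall x, ~ Om x -> X x <= Z x) -> Lint X <= Lint Z.
Proof.
move=> e0 d0 CH cX cZ hO hN.
pose V i x := eta m a b e x * (zcut m c d x * H i x).
have aV i : inner_supported Om (V i) by exact: inner_supported_eta.
have CV i : C1_on Om (V i).
  exact: (C1M oO (C1_eta e oO) (C1M oO (C1_zcut c d oO) (CH i))).
have cV i : Cc (partial i (V i)).
  by apply: inner_supported_Cc => [|x Ox]; [exact: inner_supported_partial|exact: (C1_continuous_partial (CV i) Ox)].
have V0 i x : ~ Om x -> partial i (V i) x = 0.
  by move=> nO; have [//|/(near_zero_partial i)[_]] := inner_supported_near x (aV i).
have cS : Cc (fun x => \sum_(i | P i) partial i (V i) x) by exact: Cc_sum.
have cXZ : Cc (fun x => -1 * Z x + X x) by apply: CcD => //; exact: CcZ.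
rewrite -subr_le0 (_ : Lint X - Lint Z = Lint (fun x => -1 * Z x + X x)); last first.
  by rewrite Lint_lin// mulN1r addrC.
rewrite (_ : 0 = Lint (fun x => sg * \sum_(i | P i) partial i (V i) x)); last first.
  by rewrite LintZ// Lint_sum// big1 ?mulr0// => i _; exact: (Lint_partial_eq0 i (aV i) (CV i)).
apply: Lint_le => //; first exact: CcZ.
move=> x; rewrite mulN1r addrC; have [Ox|nO] := pselect (Om x); first exact: hO.
by rewrite big1 ?mulr0 ?subr_le0 ?hN// => i _; exact: V0.
Qed.

(** Contains every point of the domain at which [deta m a b e] and [zcut m 2 d] are both nonzero. *)
Definition layer (e d : R) (x : 'rV[R]_N) :=
  [/\ Om x, sigma m x <= expR (2 / d) & tau m a b x <= 2 * e].

Lemma layer_le e d x (A B : R) : 0 < e -> 0 < d -> Om x -> (layer e d x -> A <= B) ->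
  deta m a b e x * (zcut m 2 d x * A) <= deta m a b e x * (zcut m 2 d x * B).
Proof.
move=> e0 d0 Ox hAB; have [te|te] := leP (tau m a b x) (2 * e); last first.
  by rewrite (deta_tau_ge e0 (ltW te)) !mul0r.
have [z|/zcut_le0 ->] := ltP 0 (2 - d * ln (1 + sigma m x)); last by rewrite !mul0r.
have sx := zcut_sigma_le d0 z.
by rewrite ler_wpM2l ?deta_ge0// ler_wpM2l ?zcut_ge0// hAB.
Qed.

(** The integrand is [zcut] times the product of the gradient of [eta] with [skew * (y, 0)]. The
    weight [skew ^+ 2 * rho] is positive on the boundary, so boundary errors can be measured by
    it. *)
Definition lmass e d : R :=
  Lint (fun x : 'rV[R]_N => deta m a b e x * (zcut m 2 d x * (2 * (skew m a b x ^+ 2 * rho m x)))).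

Lemma sqr_continuous (f : 'rV[R]_N -> R) x : {for x, continuous f} ->
  {for x, continuous (fun x => f x ^+ 2)}.
Proof.
move=> cf; have -> : (fun x => f x ^+ 2) = (fun x => f x * f x).
  by apply/funext => y; rewrite expr2.
exact: continuousM.
Qed.

Lemma cstM_continuous (r : R) (f : 'rV[R]_N -> R) x : {for x, continuous f} ->
  {for x, continuous (fun x => r * f x)}.
Proof. by move=> cf; apply: continuousM => //; exact: cst_continuous. Qed.

Lemma skew2rho_continuous x : {for x, continuous (fun x : 'rV[R]_N => 2 * (skew m a b x ^+ 2 * rho m x))}.
Proof.
apply: cstM_continuous; apply: continuousM; last exact: rho_continuous.
by apply: sqr_continuous; exact: skew_continuous.
Qed.

Lemma Omega_not_eta e x : 0 < e -> ~ Om x -> eta m a b e x = 0.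
Proof.
move=> e0 nO; apply: eta_tau_lt => //; apply: le_lt_trans e0.
by rewrite leNgt; apply/negP => /(Omega_tau a0 ab).
Qed.

Lemma Omega_not_deta e x : 0 < e -> ~ Om x -> deta m a b e x = 0.
Proof.
move=> e0 nO; apply: deta_tau_lt => //; apply: le_lt_trans e0.
by rewrite leNgt; apply/negP => /(Omega_tau a0 ab).
Qed.

(* Divergence theorem for the field [eta * zcut * skew * y]: the mass of the
   boundary layer stays bounded as its width [e] tends to 0. *)
Lemma lmass_le e d : 0 < e -> 0 < d -> lmass e d <=
  (4 + m.+1%:R) * b ^+ 2 *
    Lint (fun x : 'rV[R]_N => zcut m 2 d x * pos_part (2 - rho m x / b ^+ 2)).
Proof.
move=> e0 d0; have B0 : 0 < b ^+ 2 by rewrite exprn_gt0// (lt_trans a0).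
rewrite -LintZ; last exact: Cc_box.
apply: (@Lint_div_le e 2 d (fun i => (i < m.+1)%N) (fun i x => skew m a b x * x ord0 i)
  _ _ 1 e0 d0).
- by move=> i; exact: (C1M oO (C1_skew oO) (C1_coord oO i)).
- by apply: Cc_deta => // x _; exact: skew2rho_continuous.
- by apply: CcZ; exact: Cc_box.
- move=> x Ox; rewrite mul1r.
  have -> : \sum_(i < N | (i < m.+1)%N) partial i (fun x => eta m a b e x * (zcut m 2 d x * (skew m a b x * x ord0 i))) x =
    \sum_(i < N | (i < m.+1)%N) (deta m a b e x * (zcut m 2 d x * (2 * skew m a b x ^+ 2)) * x ord0 i ^+ 2 +
      eta m a b e x * zcut m 2 d x * (- 4) * x ord0 i ^+ 2 + eta m a b e x * zcut m 2 d x * skew m a b x * 1).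
    apply: eq_bigr => i im; rewrite partial_cut//; last first.
      exact: (C1M oO (C1_skew oO) (C1_coord oO i)).
    have [_ h] := is_derive_mul (is_derive_skew (m := m) (a := a) (b := b) i x) (is_derive_coord i i x).
    rewrite [partial i (fun x => skew m a b x * _) x]h im eqxx /=; ring.
  rewrite !big_split /= -!mulr_sumr -/(rho m x) (card_ord_lt mN).
  have /andP[r1 r2] := (OmegaP a0 ab x).1 Ox.
  have F0 : 0 <= eta m a b e x * zcut m 2 d x by rewrite mulr_ge0 ?eta_ge0 ?zcut_ge0.
  have F1 : eta m a b e x * zcut m 2 d x <= zcut m 2 d x * pos_part (2 - rho m x / b ^+ 2).
    rewrite mulrC ler_wpM2l ?zcut_ge0// (le_trans (eta_le1 _ _))// pos_part_id.
      rewrite lerBrDr -lerBrDl (_ : 2 - 1 = 1); last by ring.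
      by rewrite ler_pdivrMr// mul1r ltW.
    by rewrite subr_ge0 ler_pdivrMr//; move: r2 B0; lra.
  set F := eta m a b e x * _ in F0 F1 *; set BX := zcut m 2 d x * pos_part _ in F1 *.
  set D := deta m a b e x; set W := zcut m 2 d x.
  (* [- 4 * rho + m.+1 * skew] is the divergence of [skew * (y, 0)]; it does not involve [deta], so
     its bound is uniform in [e]. *)
  have K1 : F * (4 * rho m x - m.+1%:R * skew m a b x) <= (4 + m.+1%:R) * b ^+ 2 * BX.
    apply: (@le_trans _ _ (F * ((4 + m.+1%:R) * b ^+ 2))).
      apply: ler_wpM2l => //.
      have s1 : - skew m a b x <= b ^+ 2 by rewrite /skew; have := a2_gt0 a0; move: r2; lra.
      have := @ler_wpM2l R m.+1%:R (ler0n _ _) _ _ s1.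
      by move: r2; move: (b ^+ 2) (m.+1%:R) => B M; move: (skew _ _ _ _) (rho _ _) => s r; lra.
    by rewrite mulrC ler_wpM2l// mulr_ge0 ?(ltW B0)// addr_ge0.
  move: K1; rewrite -/D -/W; clearbody F BX D W.
  move: (skew m a b x) (rho m x) (m.+1%:R : R) (_ * b ^+ 2 * BX) => s r M Z K1.
  have -> : D * (W * (2 * s ^+ 2)) * r + F * -4 * r + F * s * M =
     D * (W * (2 * (s ^+ 2 * r))) - F * (4 * r - M * s) by ring.
  by move: K1; move: (F * _) (D * _) => K1 K2; lra.
move=> x nO; rewrite (Omega_not_deta e0 nO) mul0r mulr_ge0//.
  by rewrite mulr_ge0 ?(ltW B0)// addr_ge0.
by rewrite mulr_ge0 ?zcut_ge0 ?pos_part_ge0.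
Qed.

Let i0 : 'I_N := Ordinal (leq_trans (ltn0Sn m) mN).

Lemma sqr_u_continuous x : Om x -> {for x, continuous (fun x => u x ^+ 2)}.
Proof. by move=> Ox; apply: sqr_continuous; exact: (C1_continuous Cu Ox). Qed.

Lemma gradsq_continuous x : Om x -> {for x, continuous (grad_sq u)}.
Proof. by move=> Ox; exact: (C1_continuous C1_gradsq Ox). Qed.

(* Divergence theorem for [eta * zcut * u ^+ 2 * y_0 e_0]. *)
Lemma poincare e d delta : 0 < e -> 0 < d ->
  (forall x, layer e d x ->
     - skew m a b x * (x ord0 i0 ^+ 2 * u x ^+ 2) <= delta * (skew m a b x ^+ 2 * rho m x)) ->
  Lint (fun x => eta m a b e x * (zcut m 2 d x * u x ^+ 2)) <=
  4 * b ^+ 2 * Lint (fun x => eta m a b e x * (zcut m 2 d x * grad_sq u x)) +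
  2 * delta * lmass e d.
Proof.
move=> e0 d0 hl.
have c1 : Cc (fun x => eta m a b e x * (zcut m 2 d x * u x ^+ 2)).
  by apply: Cc_eta => // x; exact: sqr_u_continuous.
have c2 : Cc (fun x => eta m a b e x * (zcut m 2 d x * grad_sq u x)).
  by apply: Cc_eta => // x; exact: gradsq_continuous.
have c3 : Cc (fun x : 'rV[R]_N => deta m a b e x * (zcut m 2 d x * (2 * (skew m a b x ^+ 2 * rho m x)))).
  by apply: Cc_deta => // x _; exact: skew2rho_continuous.
rewrite -(LintZ _ c2) -(LintZ _ c3) -LintD; try exact: CcZ.
apply: (@Lint_div_le e 2 d (pred1 i0) (fun i x => u x ^+ 2 * x ord0 i) _ _ 2 e0 d0).
- move=> i; refine (C1M oO _ (C1_coord oO i)); under eq_fun do rewrite expr2.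
  exact: (C1M oO Cu Cu).
- exact: c1.
- by apply: CcD; exact: CcZ.
- move=> x Ox; rewrite big_pred1_eq partial_cut//; last first.
    refine (C1M oO _ (C1_coord oO i0)); under eq_fun do rewrite expr2.
    exact: (C1M oO Cu Cu).
  have hu := C1_is_derive i0 Cu Ox.
  have [_ h] := is_derive_mul (is_derive_mul hu hu) (is_derive_coord i0 i0 x).
  rewrite [partial i0 (fun x => u x ^+ 2 * _) x](_ : _ =
     2 * (u x * partial i0 u x * x ord0 i0) + u x ^+ 2); last first.
    under eq_fun do rewrite expr2.
    by rewrite [LHS]h eqxx /=; ring.
  have L := layer_le e0 d0 Ox (fun h => hl x h).
  have /andP[_ r2] := (OmegaP a0 ab x).1 Ox.
  have F0 : 0 <= eta m a b e x * zcut m 2 d x by rewrite mulr_ge0 ?eta_ge0 ?zcut_ge0.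
  have x2 : x ord0 i0 ^+ 2 <= b ^+ 2.
    apply: le_trans (ltW r2); rewrite /rho (bigD1 i0)//= lerDl.
    by apply: sumr_ge0 => j _; exact: sqr_ge0.
  have S2 : partial i0 u x ^+ 2 <= grad_sq u x.
    by rewrite /grad_sq (bigD1 i0)//= lerDl; apply: sumr_ge0 => j _; exact: sqr_ge0.
  have XS : x ord0 i0 ^+ 2 * partial i0 u x ^+ 2 <= b ^+ 2 * grad_sq u x.
    by apply: ler_pM => //; exact: sqr_ge0.
  (* With D the derivative along the first axis, 2 (u^2 + 2 x_0 u D u) = (u + 2 x_0 D u)^2 + u^2 - 4
     x_0^2 (D u)^2. Dropping the square and using x_0^2 <= b^2 yields the factor [4 * b ^+ 2]. *)
  have {F0} := mulr_ge0 F0 (sqr_ge0 (u x + 2 * (partial i0 u x * x ord0 i0))).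
  have := ler_wpM2l (mulr_ge0 (eta_ge0 e x) (zcut_ge0 2 d x)) XS.
  have i0m : (i0 < m.+1)%N by [].
  move: L; rewrite i0m !mulr0 !mul0r add0r.
  move: (eta m a b e x) (zcut m 2 d x) (deta m a b e x) (skew m a b x) (rho m x) (u x)
    (partial i0 u x) (x ord0 i0) (grad_sq u x) (b ^+ 2) => E W D s r v v1 t S B.
  move=> L1 L2 L3; rewrite -subr_ge0.
  have -> : 2 * (D * (s * (2 * t)) * (W * (v ^+ 2 * t)) + E * (W * (2 * (v * v1 * t) + v ^+ 2)))
    = 4 * (D * (W * (s * (t ^+ 2 * v ^+ 2)))) + E * W * (4 * (v * v1 * t) + 2 * v ^+ 2) by ring.
  have -> : E * W * (4 * (v * v1 * t) + 2 * v ^+ 2) =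
    E * W * (v + 2 * (v1 * t)) ^+ 2 + E * W * v ^+ 2 - 4 * (E * W * (t ^+ 2 * v1 ^+ 2)) by ring.
  move: L1; have -> : D * (W * (- s * (t ^+ 2 * v ^+ 2))) = - (D * (W * (s * (t ^+ 2 * v ^+ 2)))) by ring.
  have -> : D * (W * (delta * (s ^+ 2 * r))) = delta * (D * (W * (s ^+ 2 * r))) by ring.
  have -> : 2 * delta * (D * (W * (2 * (s ^+ 2 * r)))) = 4 * (delta * (D * (W * (s ^+ 2 * r)))) by ring.
  have -> : E * (W * v ^+ 2) = E * W * v ^+ 2 by ring.
  have -> : 4 * B * (E * (W * S)) = 4 * (E * W * (B * S)) by ring.
  move: L2 L3; move: (delta * _) (D * (W * (s * _))) (E * W * (v + _) ^+ 2) (E * W * v ^+ 2)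
    (E * W * (B * S)) (E * W * (t ^+ 2 * _)) => q1 q2 q3 q4 q5 q6 *; lra.
move=> x nO.
by rewrite (Omega_not_eta e0 nO) (Omega_not_deta e0 nO) !mul0r !mulr0 addr0.
Qed.

(** [dotG] and [zG] are the products of the field [pohG] with (y, 0) and (0, z), the directions of
    the gradients of [eta] and [zcut]. *)
Definition dotG x : R := pohA x * dotY x + pohB x * (phi (rho m x) * rho m x).
Definition zG x : R := pohA x * dotZ x + pohB x * sigma m x.
Definition Cz : R := b ^+ 2 + 2 + k / p.
Definition Qf x : R := m%:R * phi (rho m x) * gradY x.

Lemma pohAE x : pohA x = phi (rho m x) * dotY x + dotZ x + k / p * u x.
Proof.
rewrite /pohA (bigID (fun i : 'I_N => (i < m.+1)%N)) /=; congr (_ + _ + _).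
  by rewrite /dotY mulr_sumr; apply: eq_bigr => i im; rewrite /chi im mulrA.
by apply: eq_bigr => i im; rewrite /chi (negbTE im) mul1r.
Qed.

Lemma sumY_pohG x : \sum_(i < N | (i < m.+1)%N) x ord0 i * pohG i x = dotG x.
Proof.
rewrite /dotG /dotY /rho !mulr_sumr -big_split /=; apply: eq_bigr => i im.
by rewrite /pohG /chi im; ring.
Qed.

Lemma sumZ_pohG x : \sum_(i < N | ~~ (i < m.+1)%N) x ord0 i * pohG i x = zG x.
Proof.
rewrite /zG /dotZ /sigma !mulr_sumr -big_split /=; apply: eq_bigr => i im.
by rewrite /pohG /chi (negbTE im); ring.
Qed.

Lemma p_gt0 : 0 < p.
Proof. exact: lt_trans hp2. Qed.

Lemma lam_ge0 : 0 <= k / p.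
Proof. by rewrite divr_ge0 ?ler0n// ltW// p_gt0. Qed.

Lemma Cz_ge0 : 0 <= Cz.
Proof. by rewrite /Cz !addr_ge0 ?lam_ge0 ?sqr_ge0. Qed.

Lemma phi_le1 r : 0 < r -> 0 <= phi r -> phi r <= 1.
Proof.
move=> r0 f0; apply: le_trans (phi_le r0).
by rewrite ler_peMl// ler1n.
Qed.

(** The factor [1 + sigma] is cancelled by the denominator in the gradient of [zcut]; since [Cz]
    depends on neither [d] nor [e], the error in [z] is of order [d]. *)
Lemma zG_bound x : Om x ->
  - (2 * zG x) <= Cz * (1 + sigma m x) * (grad_sq u x + upow p u x + u x ^+ 2).
Proof.
move=> Ox; rewrite /zG pohAE /pohB /Cz.
have r0 := Omega_rho_gt0 Ox.
have /andP[r1 r2] := (OmegaP a0 ab x).1 Ox.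
have f0 := ltW (phi_gt0 r1); have f1 := phi_le1 r0 f0.
have y1 : dotY x ^+ 2 <= rho m x * gradY x by exact: cauchy_schwarz.
have z1 : dotZ x ^+ 2 <= sigma m x * gradZ x by exact: cauchy_schwarz.
have gy := gradY_ge0 x; have gz := gradZ_ge0 x.
have sE := gradsqE x; have q0 := upow_ge0 x; have sg := sigma_ge0 (m := m) x.
have l0 := lam_ge0.
have y2 : (phi (rho m x) * dotY x) ^+ 2 <= b ^+ 2 * grad_sq u x.
  rewrite exprMn; apply: (@le_trans _ _ (dotY x ^+ 2)).
    by rewrite ler_piMl ?sqr_ge0// exprn_ile1.
  apply: (le_trans y1); apply: ler_pM => //; [exact: ltW|exact: ltW|].
  by rewrite sE lerDl.
have z2 : dotZ x ^+ 2 <= sigma m x * grad_sq u x.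
  by apply: (le_trans z1); rewrite ler_wpM2l// sE lerDr.
have S0 : 0 <= grad_sq u x by rewrite sE addr_ge0.
have qp : 0 <= upow p u x / p by rewrite divr_ge0// ltW// p_gt0.
move: y2 z2 l0 sg S0 q0 qp (sqr_ge0 b).
move: (phi (rho m x) * dotY x) (dotZ x) (k / p) (sigma m x) (grad_sq u x)
  (upow p u x) (upow p u x / p) (b ^+ 2) (u x) => y z l s S q qp B v.
move=> y2 z2 l0 s0 S0 q0 qp0 B0.
have T0 : 0 <= v ^+ 2 by exact: sqr_ge0.
have h1 : 0 <= (y + z) ^+ 2 by exact: sqr_ge0.
have h2 : 0 <= l * (v + z) ^+ 2 by rewrite mulr_ge0// sqr_ge0.
have h3 : 0 <= s * qp by exact: mulr_ge0.
have h4 : l * z ^+ 2 <= l * (s * S) by rewrite ler_wpM2l.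
have h5 : 0 <= z ^+ 2 by exact: sqr_ge0.
rewrite -subr_ge0.
(* The squares [(y + z) ^+ 2] and [l * (v + z) ^+ 2] complete the cross terms; the Cauchy-Schwarz
   bounds [y2] and [z2] pay for them. *)
have -> : (B + 2 + l) * (1 + s) * (S + q + v ^+ 2) - - (2 * ((y + z + l * v) * z + (qp - S / 2) * s)) =
  (y + z) ^+ 2 + l * (v + z) ^+ 2 + 2 * (s * qp) + (B * S - y ^+ 2) + (s * S - z ^+ 2) +
  (l * (s * S) - l * z ^+ 2) + 2 * z ^+ 2 +
  (B * s * S + (B + 2 + l) * (1 + s) * (q + v ^+ 2) - l * v ^+ 2 + 2 * S + l * S) by field.
have h6 : l * v ^+ 2 <= (B + 2 + l) * (1 + s) * (q + v ^+ 2).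
  have h7 : 0 <= B * v ^+ 2 by exact: mulr_ge0.
  have h8 : 0 <= l * q by exact: mulr_ge0.
  apply: (@le_trans _ _ ((B + 2 + l) * (q + v ^+ 2))).
    have h9 : 0 <= B * q by exact: mulr_ge0.
    by rewrite -subr_ge0 (_ : _ - _ = B * q + B * v ^+ 2 + 2 * q + 2 * v ^+ 2 + l * q);
      [rewrite !addr_ge0// mulr_ge0|ring].
  rewrite -subr_ge0 (_ : _ - _ = s * ((B + 2 + l) * (q + v ^+ 2))); last by ring.
  by rewrite !mulr_ge0// !addr_ge0.
have h10 : 0 <= B * s * S by rewrite !mulr_ge0.
have h11 : 0 <= l * S by rewrite mulr_ge0.
move: h1 h2 h3 h4 h5 h6 h10 h11.
move: ((y + z) ^+ 2) (l * (v + z) ^+ 2) (s * qp) (l * z ^+ 2) (l * (s * S)) (l * v ^+ 2)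
  ((B + 2 + l) * (1 + s) * (q + v ^+ 2)) (B * s * S) (l * S) y2 z2.
move: (z ^+ 2) (y ^+ 2) (s * S) (B * S) => *; lra.
Qed.

Lemma phirho_C1 : C1_on Om (fun x => phi (rho m x)).
Proof.
refine (C1_comp oO (g' := dphi) (C1_rho oO) _ _) => x /Omega_rho_gt0.
  exact: phiD.
exact: dphiC.
Qed.

Lemma gradY_C1 : C1_on Om gradY.
Proof.
apply: (C1_sum oO) => i _; under eq_fun do rewrite expr2.
exact: (C1M oO (Cpu i) (Cpu i)).
Qed.

Lemma Qf_continuous x : Om x -> {for x, continuous Qf}.
Proof.
move=> Ox; apply: continuousM; last exact: (C1_continuous gradY_C1 Ox).
by apply: cstM_continuous; exact: (C1_continuous phirho_C1 Ox).
Qed.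

Lemma total_continuous x : Om x ->
  {for x, continuous (fun x => grad_sq u x + upow p u x + u x ^+ 2)}.
Proof.
move=> Ox; apply: continuousD; last exact: sqr_u_continuous.
by apply: continuousD; [exact: gradsq_continuous|exact: (C1_continuous C1_upow Ox)].
Qed.

(** The divergence of [eta * zcut * pohG] has three parts: [K1] from the boundary layer, [K2] from
    the cutoff in [z], and [K3] from the divergence of [pohG], which produces [Qf]. *)
Lemma pohozaev_ineq e d delta : 0 < e -> 0 < d -> 0 < delta ->
  (forall x, layer e d x -> skew m a b x * dotG x <= delta * (skew m a b x ^+ 2 * rho m x)) ->
  Lint (fun x => eta m a b e x * (zcut m 1 d x * Qf x)) <=
  delta * lmass e d + 2 * d * Cz *
    Lint (fun x => eta m a b e x * (zcut m 2 d x * (grad_sq u x + upow p u x + u x ^+ 2))).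
Proof.
move=> e0 d0 dl0 hl.
have c1 : Cc (fun x => eta m a b e x * (zcut m 1 d x * Qf x)).
  by apply: Cc_eta => // x; exact: Qf_continuous.
have c2 : Cc (fun x => eta m a b e x * (zcut m 2 d x * (grad_sq u x + upow p u x + u x ^+ 2))).
  by apply: Cc_eta => // x; exact: total_continuous.
have c3 : Cc (fun x : 'rV[R]_N => deta m a b e x * (zcut m 2 d x * (2 * (skew m a b x ^+ 2 * rho m x)))).
  by apply: Cc_deta => // x _; exact: skew2rho_continuous.
rewrite -(LintZ _ c2) -(LintZ _ c3) -LintD; try exact: CcZ.
apply: (@Lint_div_le e 1 d predT pohG _ _ (-1) e0 d0).
- exact: C1_pohG.
- exact: c1.
- by apply: CcD; exact: CcZ.
- move=> x Ox.
  have -> : \sum_i partial i (fun x => eta m a b e x * (zcut m 1 d x * pohG i x)) x =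
    2 * (deta m a b e x * (zcut m 1 d x * (skew m a b x * dotG x))) +
    eta m a b e x * dzcut m 1 d x * (- d / (1 + sigma m x)) * (2 * zG x) +
    eta m a b e x * zcut m 1 d x * \sum_i partial i (pohG i) x.
    rewrite -sumY_pohG -sumZ_pohG !mulr_sumr [X in X + _ + _]big_mkcond /=.
    rewrite [X in _ + X + _]big_mkcond -!big_split /=; apply: eq_bigr => i _.
    rewrite (partial_cut _ _ _ _ (C1_pohG i) Ox).
    by case: (i < m.+1)%N => /=; ring.
  have dG := div_pohG_le Ox.
  have zb := zG_bound Ox.
  have L := layer_le e0 d0 Ox (fun h => hl x h).
  have s1 : 0 < 1 + sigma m x by rewrite ltr_pwDl// sigma_ge0.
  have r0 := Omega_rho_gt0 Ox.
  set T := grad_sq u x + upow p u x + u x ^+ 2 in zb *.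
  have T0 : 0 <= T by rewrite /T gradsqE !addr_ge0 ?gradY_ge0 ?gradZ_ge0 ?upow_ge0 ?sqr_ge0.
  have E0 := eta_ge0 e x; have D0 := deta_ge0 (m := m) (a := a) (b := b) x e0.
  have W0 := zcut_ge0 2 d x; have z0 := zcut_ge0 1 d x.
  have zW := zcut1_le d x; have dz0 := dzcut_ge0 1 d x; have dzW := dzcut1_le d x.
  have K1 : deta m a b e x * (zcut m 1 d x * (skew m a b x * dotG x)) <=
      delta * (deta m a b e x * (zcut m 2 d x * (skew m a b x ^+ 2 * rho m x))).
    have sr0 : 0 <= delta * (skew m a b x ^+ 2 * rho m x).
      by apply: mulr_ge0; [exact: ltW|apply: mulr_ge0; [exact: sqr_ge0|exact: ltW]].
    rewrite (_ : delta * (_ * _) = deta m a b e x * (zcut m 2 d x * (delta * (skew m a b x ^+ 2 * rho m x)))); last by ring.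
    have [te|te] := leP (tau m a b x) (2 * e); last first.
      by rewrite (deta_tau_ge e0 (ltW te)) !mul0r.
    rewrite ler_wpM2l//.
    apply: (@le_trans _ _ (zcut m 1 d x * (delta * (skew m a b x ^+ 2 * rho m x)))); last first.
      by rewrite ler_wpM2r.
    have [z|/zcut_le0 ->] := ltP 0 (1 - d * ln (1 + sigma m x)); last by rewrite !mul0r.
    rewrite ler_wpM2l// hl//; split=> //; apply: (zcut_sigma_le d0).
    by move: z; lra.
  have K2 : eta m a b e x * dzcut m 1 d x * (- d / (1 + sigma m x)) * (2 * zG x) <=
      2 * d * Cz * (eta m a b e x * (zcut m 2 d x * T)).
    rewrite (_ : _ * (2 * zG x) = eta m a b e x * dzcut m 1 d x * d * (- (2 * zG x) / (1 + sigma m x))); last first.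
      by field; rewrite gt_eqF.
    apply: (@le_trans _ _ (eta m a b e x * dzcut m 1 d x * d * (Cz * T))).
      apply: ler_wpM2l; first by apply: mulr_ge0; [exact: mulr_ge0|exact: ltW].
      by rewrite ler_pdivrMr// mulrAC.
    rewrite (_ : 2 * d * Cz * _ = eta m a b e x * (2 * zcut m 2 d x) * d * (Cz * T)); last by ring.
    apply: ler_wpM2r; first by rewrite mulr_ge0// Cz_ge0.
    by apply: ler_wpM2r; [exact: ltW|rewrite ler_wpM2l].
  have K3 : eta m a b e x * zcut m 1 d x * (\sum_i partial i (pohG i) x) <=
      - (eta m a b e x * (zcut m 1 d x * Qf x)).
    rewrite (_ : - _ = eta m a b e x * zcut m 1 d x * (- Qf x)); last by ring.
    by rewrite ler_wpM2l// mulr_ge0.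
  rewrite mulN1r.
  have -> : delta * (deta m a b e x * (zcut m 2 d x * (2 * (skew m a b x ^+ 2 * rho m x)))) =
    2 * (delta * (deta m a b e x * (zcut m 2 d x * (skew m a b x ^+ 2 * rho m x)))) by ring.
  move: K1 K2 K3; move: (deta m a b e x * _) (delta * _) (_ * (2 * zG x)) (2 * d * Cz * _)
    (_ * \sum_i _) (_ * (_ * Qf x)) => *; lra.
move=> x nO.
by rewrite (Omega_not_eta e0 nO) (Omega_not_deta e0 nO) !mul0r !mulr0 addr0.
Qed.

(** * Boundary values of the field and the sign of the layer term *)

Lemma within_mul (A : set 'rV[R]_N) (f h : 'rV[R]_N -> R) : {within A, continuous f} ->
  {within A, continuous h} -> {within A, continuous (fun x => f x * h x)}.
Proof. by move=> cf ch x; apply: continuousM; [exact: cf|exact: ch]. Qed.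

Lemma within_add (A : set 'rV[R]_N) (f h : 'rV[R]_N -> R) : {within A, continuous f} ->
  {within A, continuous h} -> {within A, continuous (fun x => f x + h x)}.
Proof. by move=> cf ch x; apply: continuousD; [exact: cf|exact: ch]. Qed.

Lemma within_cst (A : set 'rV[R]_N) (c : R) : {within A, continuous (fun _ : 'rV[R]_N => c)}.
Proof. by apply: continuous_subspaceT => x; exact: cst_continuous. Qed.

Lemma within_sum (A : set 'rV[R]_N) (I : Type) (r : seq I) (P : pred I) (h : I -> 'rV[R]_N -> R) :
  (forall i, {within A, continuous (h i)}) ->
  {within A, continuous (fun x => \sum_(i <- r | P i) h i x)}.
Proof.
move=> ch; apply: (@fun_sum_ind _ _ _ _ _ (fun f => {within A, continuous f})) => //.
  exact: within_cst.
by move=> f h' cf cg; exact: within_add.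
Qed.

Lemma within_in (A : set 'rV[R]_N) (f : 'rV[R]_N -> R) :
  (forall x, A x -> {for x, continuous f}) -> {within A, continuous f}.
Proof. by move=> cf; apply: continuous_in_subspaceT => x; rewrite inE; exact: cf. Qed.

Context {g : 'I_N -> 'rV[R]_N -> R}.
Hypothesis uc : {within closure Om, continuous u}.
Hypothesis gc : forall i, {within closure Om, continuous (g i)}.
Hypothesis gu : forall i x, Om x -> g i x = partial i u x.
Hypothesis u0 : forall x, closure Om x -> ~ Om x -> u x = 0.
Hypothesis phi_a : phi (a ^+ 2) = 0.

Lemma within_upow : {within closure Om, continuous (upow p u)}.
Proof.
move=> x; apply: (@continuous_comp _ _ _ (u : subspace (closure Om) -> R) (fun t : R => powR `|t| p)).
  exact: uc.
exact: powR_norm_continuous.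
Qed.

(* The expression of [dotG] in terms of the boundary extensions [g i] of the
   partial derivatives. *)
Definition dotGb x : R :=
  let Y1 := \sum_(i < N | (i < m.+1)%N) x ord0 i * g i x in
  let Z1 := \sum_(i < N | ~~ (i < m.+1)%N) x ord0 i * g i x in
  (phi (rho m x) * Y1 + Z1 + k / p * u x) * Y1 +
  (upow p u x / p + (- (1 / 2)) * \sum_i g i x * g i x) * (phi (rho m x) * rho m x).

Lemma dotGbE x : Om x -> dotGb x = dotG x.
Proof.
move=> Ox; rewrite /dotGb /dotG pohAE /pohB /dotY /dotZ.
have -> : \sum_(i < N | (i < m.+1)%N) x ord0 i * g i x = \sum_(i < N | (i < m.+1)%N) x ord0 i * partial i u x.
  by apply: eq_bigr => i _; rewrite gu.
have -> : \sum_(i < N | ~~ (i < m.+1)%N) x ord0 i * g i x = \sum_(i < N | ~~ (i < m.+1)%N) x ord0 i * partial i u x.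
  by apply: eq_bigr => i _; rewrite gu.
have -> : \sum_i g i x * g i x = grad_sq u x.
  by apply: eq_bigr => i _; rewrite gu// expr2.
by congr (_ + _ * _); field; rewrite gt_eqF// p_gt0.
Qed.

Lemma within_coord (i : 'I_N) : {within closure Om, continuous (fun x : 'rV[R]_N => x ord0 i)}.
Proof. by apply: continuous_subspaceT => x; exact: coord_continuous. Qed.

Lemma within_phirho : {within closure Om, continuous (fun x : 'rV[R]_N => phi (rho m x))}.
Proof.
apply: within_in => x /(closure_OmegaP a0 ab)/andP[r1 _].
have r0 : 0 < rho m x by exact: lt_le_trans (a2_gt0 a0) r1.
apply: (@continuous_comp _ _ _ (rho m) phi); first exact: rho_continuous.
by apply/differentiable_continuous/derivable1_diffP; have [] := phiD r0.
Qed.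

Lemma within_dotGb : {within closure Om, continuous dotGb}.
Proof.
have cY : {within closure Om, continuous (fun x => \sum_(i < N | (i < m.+1)%N) x ord0 i * g i x)}.
  by apply: within_sum => i; apply: within_mul; [exact: within_coord|exact: gc].
have cZ : {within closure Om, continuous (fun x => \sum_(i < N | ~~ (i < m.+1)%N) x ord0 i * g i x)}.
  by apply: within_sum => i; apply: within_mul; [exact: within_coord|exact: gc].
have cS : {within closure Om, continuous (fun x => \sum_i g i x * g i x)}.
  by apply: within_sum => i; exact: within_mul.
have cr : {within closure Om, continuous (rho m : 'rV[R]_N -> R)}.
  by apply: within_in => x _; exact: rho_continuous.
apply: within_add; apply: within_mul => //.
- apply: within_add; last by apply: within_mul => //; exact: within_cst.
  by apply: within_add => //; apply: within_mul => //; exact: within_phirho.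
- apply: within_add; apply: within_mul => //; [exact: within_upow|exact: within_cst|exact: within_cst].
- by apply: within_mul => //; exact: within_phirho.
Qed.

Lemma skewE_boundary x : tau m a b x = 0 -> closure Om x ->
  0 < skew m a b x ^+ 2 * rho m x.
Proof.
move=> t0 /(closure_OmegaP a0 ab)/andP[r1 _].
have r0 : 0 < rho m x by exact: lt_le_trans (a2_gt0 a0) r1.
rewrite mulr_gt0// (_ : skew m a b x ^+ 2 = (b ^+ 2 - a ^+ 2) ^+ 2 - 4 * tau m a b x); last first.
  by rewrite /skew /tau; ring.
by rewrite t0 mulr0 subr0 exprn_gt0// subr_gt0 a2_lt_b2.
Qed.

(** On the boundary [u] and the z-gradient vanish, which leaves [phi] times (y . g)^2 - |y|^2 |g|^2
    / 2. On the inner sphere [phi] is zero. On the outer one (y . g)^2 = b^2 |g|^2, so [dotGb] is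
    nonnegative while [skew] is negative. *)
Lemma skew_dotGb_boundary x : tau m a b x = 0 -> closure Om x -> skew m a b x * dotGb x <= 0.
Proof.
move=> t0 cx.
have ux : u x = 0 by apply: u0 => //; exact: (tau0_notin a0 ab).
have gz (i : 'I_N) : ~~ (i < m.+1)%N -> g i x = 0.
  by move=> im; exact: (boundary_grad_z a0 ab Cu uc gc gu u0 im cx t0).
have AB := a2_lt_b2 a0 ab.
have E : dotGb x = phi (rho m x) * ((\sum_(i < N | (i < m.+1)%N) x ord0 i * g i x) ^+ 2 -
    1 / 2 * rho m x * \sum_(i < N | (i < m.+1)%N) g i x ^+ 2).
  rewrite /dotGb ux /upow ux normr0 powR0 ?gt_eqF ?p_gt0// mul0r mulr0 addr0 add0r.
  have z1 : \sum_(i < N | ~~ (i < m.+1)%N) x ord0 i * g i x = 0.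
    by apply: big1 => i im; rewrite gz// mulr0.
  have z2 : \sum_i g i x * g i x = \sum_(i < N | (i < m.+1)%N) g i x ^+ 2.
    rewrite (bigID (fun i : 'I_N => (i < m.+1)%N)) /=.
    rewrite [X in _ + X]big1 ?addr0; last by move=> i im; rewrite gz// mulr0.
    by apply: eq_bigr => i _; rewrite expr2.
  by rewrite z1 z2 addr0; ring.
have := t0; rewrite /tau => /eqP; rewrite mulf_eq0 => /orP[/eqP|/eqP] /subr0_eq r.
  by rewrite E r phi_a mul0r mulr0.
have rb : rho m x = b ^+ 2 by [].
have sk : skew m a b x < 0 by rewrite /skew rb; move: AB; lra.
rewrite nmulr_rle0// E rb (boundary_grad_y a0 ab Cu uc gc gu u0 rb).
have pb : 0 < phi (b ^+ 2) by apply: phi_gt0.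
rewrite mulr_ge0 ?(ltW pb)//.
have S0 : 0 <= b ^+ 2 * \sum_(i < N | (i < m.+1)%N) g i x ^+ 2.
  by rewrite mulr_ge0 ?sqr_ge0//; apply: sumr_ge0 => i _; exact: sqr_ge0.
rewrite -mulrA; move: S0; move: (b ^+ 2 * _) => z; lra.
Qed.

(** The positive term with [delta] makes both boundary inequalities strict, and strict inequalities
    persist in a layer by [compact_layer]. *)
Lemma boundary_layer delta K : 0 < delta -> exists2 e, 0 < e &
  forall x, Om x -> sigma m x <= K -> tau m a b x <= e ->
  skew m a b x * dotG x <= delta * (skew m a b x ^+ 2 * rho m x) /\
  - skew m a b x * (x ord0 i0 ^+ 2 * u x ^+ 2) <= delta * (skew m a b x ^+ 2 * rho m x).
Proof.
move=> dl0.
have csk : {within closure Om, continuous (skew m a b : 'rV[R]_N -> R)}.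
  by apply: within_in => x _; exact: skew_continuous.
have cr : {within closure Om, continuous (rho m : 'rV[R]_N -> R)}.
  by apply: within_in => x _; exact: rho_continuous.
have c3 : {within closure Om, continuous (fun x : 'rV[R]_N => - delta * (skew m a b x * skew m a b x * rho m x))}.
  apply: within_mul; first exact: within_cst.
  by apply: within_mul => //; exact: within_mul.
have c1 : {within closure Om, continuous (fun x => skew m a b x * dotGb x + - delta * (skew m a b x * skew m a b x * rho m x))}.
  by apply: within_add => //; apply: within_mul => //; exact: within_dotGb.
have c2 : {within closure Om, continuous (fun x => (-1) * skew m a b x * (x ord0 i0 * x ord0 i0 * (u x * u x)) + - delta * (skew m a b x * skew m a b x * rho m x))}.
  apply: within_add => //; apply: within_mul.
    by apply: within_mul => //; exact: within_cst.
  by apply: within_mul; apply: within_mul => //; exact: within_coord.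
have [|e1 e10 H1] := compact_layer a0 ab K c1.
  move=> x cx t0; have := skew_dotGb_boundary t0 cx.
  have := mulr_gt0 dl0 (skewE_boundary t0 cx); rewrite expr2.
  move: (skew m a b x * dotGb x) (skew m a b x * skew m a b x * rho m x) => A B; lra.
have [|e2 e20 H2] := compact_layer a0 ab K c2.
  move=> x cx t0; have ux : u x = 0 by apply: u0 => //; exact: (tau0_notin a0 ab).
  have := mulr_gt0 dl0 (skewE_boundary t0 cx); rewrite expr2 ux !mulr0 add0r.
  move: (skew m a b x * skew m a b x * rho m x) => B; lra.
exists (Num.min e1 e2); first by rewrite lt_min e10.
move=> x Ox sK; rewrite le_min => /andP[te1 te2].
have := H1 x Ox sK te1; have := H2 x Ox sK te2; rewrite dotGbE// !expr2.
move: (skew m a b x * skew m a b x * rho m x) => B.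
have -> : -1 * skew m a b x * (x ord0 i0 * x ord0 i0 * (u x * u x)) =
  - skew m a b x * (x ord0 i0 * x ord0 i0 * (u x * u x)) by ring.
by move: (- skew m a b x * _) (skew m a b x * _) => A1 A2 h1 h2; split; lra.
Qed.

(** * The limit in the cutoffs and the vanishing of the solution *)

Hypothesis hm1 : (1 <= m)%N.
Hypothesis hgrad : L1_nonneg_on Om (grad_sq u).
Hypothesis hup : L1_nonneg_on Om (upow p u).
Let M1 : R := fine (int_RN (fun x => (\1_Om x * grad_sq u x)%:E)).
Let M2 : R := fine (int_RN (fun x => (\1_Om x * upow p u x)%:E)).

(** The constant [4] is the maximal value [2 ^+ 2] of [zcut m 2 d]; the bound is uniform in [e] and
    [d]. *)
Lemma Lint_eta_le e d (f : 'rV[R]_N -> R) : 0 < e -> 0 < d ->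
  (forall x, 0 <= f x) -> (forall x, Om x -> {for x, continuous f}) ->
  L1_nonneg_on Om f ->
  Lint (fun x => eta m a b e x * (zcut m 2 d x * f x)) <=
  4 * fine (int_RN (fun x => (\1_Om x * f x)%:E)).
Proof.
move=> e0 d0 f0 cf hf.
have c1 : Cc (fun x => eta m a b e x * (zcut m 2 d x * f x)) by exact: Cc_eta.
rewrite -ler_pdivrMl// -(LintZ _ c1); apply: Lint_le_int_RN => //; first exact: CcZ.
move=> x; have E0 := eta_ge0 e x; have W0 := zcut_ge0 2 d x.
have Z0 : 0 <= 4^-1 * (eta m a b e x * (zcut m 2 d x * f x)) 
  by apply: mulr_ge0; [rewrite invr_ge0|apply: mulr_ge0 => //; exact: mulr_ge0].
rewrite Z0 andTb indicE; have [Ox|nO] := pselect (Om x); last first.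
  by rewrite (Omega_not_eta e0 nO) mul0r mulr0 memNset// mul0r.
rewrite mem_set// mul1r.
rewrite (_ : 4^-1 * _ = (eta m a b e x * (zcut m 2 d x / 4)) * f x); last by ring.
rewrite ler_piMl// mulr_ile1 ?eta_le1 ?divr_ge0//.
by rewrite ler_pdivrMr// mul1r zcut2_le4.
Qed.

Lemma gradsq_ge0 x : 0 <= grad_sq u x.
Proof. by rewrite gradsqE addr_ge0 ?gradY_ge0 ?gradZ_ge0. Qed.

Lemma M1_ge0 : 0 <= M1.
Proof.
by apply: fine_ge0; apply: iter_int_ge0 => x; rewrite lee_fin mulr_ge0// gradsq_ge0.
Qed.

Lemma M2_ge0 : 0 <= M2.
Proof.
by apply: fine_ge0; apply: iter_int_ge0 => x; rewrite lee_fin mulr_ge0// upow_ge0.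
Qed.

Lemma Qf_ge0 x : Om x -> 0 <= Qf x.
Proof.
move=> /(OmegaP a0 ab)/andP[r1 _]; apply: mulr_ge0; last exact: gradY_ge0.
by apply: mulr_ge0; [exact: ler0n|exact: ltW (phi_gt0 r1)].
Qed.

(** Shrinking [e] and [d] enlarges the cutoffs, so the integral with the fixed [e1] and [d1] is
    dominated by those to which [pohozaev_ineq] applies. The constant [C] must not depend on [d]. *)
Lemma weighted_gradY_small e1 d1 : 0 < e1 -> 0 < d1 -> exists2 C, 0 < C &
  forall d, 0 < d <= Num.min 1 d1 ->
  Lint (fun x => eta m a b e1 x * (zcut m 1 d1 x * Qf x)) <= d * C.
Proof.
move=> e10 d10; have M10 := M1_ge0; have M20 := M2_ge0; have C0 := Cz_ge0.
have B0 := sqr_ge0 b.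
(* The leading 1 comes from the layer mass, [4 * M1] and [4 * M2] from the two energies, and the
   remainder of the sum from the Poincare bound, whose layer term is at most [2 * d <= 2]. *)
exists (1 + 2 * Cz * (4 * M1 + 4 * M2 + 4 * b ^+ 2 * (4 * M1) + 2)).
  have m1 : 0 <= 4 * M1 by rewrite mulr_ge0.
  have m2 : 0 <= 4 * M2 by rewrite mulr_ge0.
  have m3 : 0 <= 4 * b ^+ 2 * (4 * M1) by rewrite mulr_ge0// mulr_ge0.
  have m4 : 0 <= 4 * M1 + 4 * M2 + 4 * b ^+ 2 * (4 * M1) + 2 by rewrite !addr_ge0.
  by rewrite ltr_pwDl// mulr_ge0// mulr_ge0.
move=> d /andP[d0]; rewrite le_min => /andP[dle1 dled1].
set Cw := (4 + m.+1%:R) * b ^+ 2 *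
    Lint (fun x : 'rV[R]_N => zcut m 2 d x * pos_part (2 - rho m x / b ^+ 2)).
have Cw0 : 0 <= Cw.
  apply: mulr_ge0; first by apply: mulr_ge0 => //; rewrite addr_ge0.
  by apply: Lint_ge0 => x; apply: mulr_ge0; [exact: zcut_ge0|exact: pos_part_ge0].
have Cw1 : 0 < Cw + 1 by rewrite ltr_wpDl.
(* [Cw] depends on [d] but not on [e], which is still to be chosen; this [delta] makes the layer
   term at most [d]. *)
pose delta := d / (Cw + 1); have dl0 : 0 < delta by rewrite divr_gt0.
have [e0 e00 He] := boundary_layer (expR (2 / d)) dl0.
(* [e1] serves the monotonicity of [eta]; the half is there because [layer] extends up to
   [tau = 2 * e]. *)
pose e := Num.min e1 (e0 / 2).
have ep : 0 < e by rewrite lt_min e10 divr_gt0.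
have ee1 : e <= e1 by rewrite /e ge_min lexx.
have ee0 : 2 * e <= e0 by rewrite mulrC -ler_pdivlMr// /e ge_min lexx orbT.
have Hl x : layer e d x ->
  skew m a b x * dotG x <= delta * (skew m a b x ^+ 2 * rho m x) /\
  - skew m a b x * (x ord0 i0 ^+ 2 * u x ^+ 2) <= delta * (skew m a b x ^+ 2 * rho m x).
  by move=> [Ox sx tx]; apply: He => //; exact: le_trans ee0.
have mass : delta * lmass e d <= d.
  apply: (@le_trans _ _ (delta * Cw)); first by rewrite ler_wpM2l ?(ltW dl0)// lmass_le.
  by rewrite /delta mulrAC ler_pdivrMr// ler_wpM2l ?(ltW d0)// lerDl.
have I1 := pohozaev_ineq ep d0 dl0 (fun x h => (Hl x h).1).
have I2 := poincare ep d0 (fun x h => (Hl x h).2).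
have I3 := Lint_eta_le ep d0 gradsq_ge0 gradsq_continuous hgrad.
have I4 := Lint_eta_le ep d0 upow_ge0 (fun x Ox => C1_continuous C1_upow Ox) hup.
rewrite -/M1 in I3; rewrite -/M2 in I4.
have cQ e' d' : 0 < e' -> 0 < d' -> Cc (fun x => eta m a b e' x * (zcut m 1 d' x * Qf x)).
  by move=> *; apply: Cc_eta => // x; exact: Qf_continuous.
have mono : Lint (fun x => eta m a b e1 x * (zcut m 1 d1 x * Qf x)) <=
    Lint (fun x => eta m a b e x * (zcut m 1 d x * Qf x)).
  apply: Lint_le; [exact: cQ|exact: cQ|move=> x].
  have [Ox|nO] := pselect (Om x); last first.
    by rewrite (Omega_not_eta e10 nO) (Omega_not_eta ep nO) !mul0r.
  have Q0 := Qf_ge0 Ox.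
  apply: ler_pM.
  - exact: eta_ge0.
  - by apply: mulr_ge0 => //; exact: zcut_ge0.
  - rewrite /eta le_theta// lerD2r ler_wpM2l// ?lef_pV2//.
    by apply: ltW; apply/(Omega_tau a0 ab).
  - apply: ler_wpM2r => //; rewrite /zcut le_sqpos// lerD2l lerN2.
    by apply: ler_wpM2r => //; exact: lnsigma_ge0.
apply: (le_trans mono); apply: (le_trans I1).
have c1 : Cc (fun x => eta m a b e x * (zcut m 2 d x * grad_sq u x)).
  by apply: Cc_eta => // x; exact: gradsq_continuous.
have c2 : Cc (fun x => eta m a b e x * (zcut m 2 d x * upow p u x)).
  by apply: Cc_eta => // x Ox; exact: (C1_continuous C1_upow Ox).
have c3 : Cc (fun x => eta m a b e x * (zcut m 2 d x * u x ^+ 2)).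
  by apply: Cc_eta => // x; exact: sqr_u_continuous.
have -> : Lint (fun x => eta m a b e x * (zcut m 2 d x * (grad_sq u x + upow p u x + u x ^+ 2))) =
  Lint (fun x => eta m a b e x * (zcut m 2 d x * grad_sq u x)) +
  Lint (fun x => eta m a b e x * (zcut m 2 d x * upow p u x)) +
  Lint (fun x => eta m a b e x * (zcut m 2 d x * u x ^+ 2)).
  rewrite -LintD// -LintD//; last exact: CcD.
  by congr Lint; apply/funext => x; rewrite !mulrDr.
have I2' : Lint (fun x => eta m a b e x * (zcut m 2 d x * u x ^+ 2)) <= 4 * b ^+ 2 * (4 * M1) + 2.
  apply: (le_trans I2); apply: lerD; first by rewrite ler_wpM2l// mulr_ge0.
  rewrite -mulrA -[leRHS]mulr1 ler_wpM2l//; exact: le_trans dle1.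
have dC : 0 <= 2 * d * Cz by rewrite !mulr_ge0// ltW.
have tot := lerD (lerD I3 I4) I2'.
have {}tot := ler_wpM2l dC tot.
apply: (le_trans (lerD mass tot)).
by rewrite le_eqVlt; apply/orP; left; apply/eqP; ring.
Qed.

Lemma gradY_eq0 x : Om x -> gradY x = 0.
Proof.
move=> Ox; apply/eqP; rewrite eq_le gradY_ge0 andbT leNgt; apply/negP => gx.
have tx := (Omega_tau a0 ab x).1 Ox.
have /andP[r1 _] := (OmegaP a0 ab x).1 Ox.
have l0 := lnsigma_ge0 x.
(* [e1] and [d1] make both cutoffs positive at [x]: [tau = 2 * e1] is where [eta] reaches 1, and
   [d1 * ln (1 + sigma)] stays below 1. *)
pose e1 := tau m a b x / 2; have e10 : 0 < e1 by rewrite divr_gt0.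
pose d1 := (2 * (1 + ln (1 + sigma m x)))^-1.
have d10 : 0 < d1 by rewrite invr_gt0 mulr_gt0// ltr_pwDl.
have [C C0 HC] := weighted_gradY_small e10 d10.
pose beta y := eta m a b e1 y * (zcut m 1 d1 y * Qf y).
have cb : Cc beta by apply: Cc_eta => // y; exact: Qf_continuous.
have b0' y : 0 <= beta y.
  have [Oy|nO] := pselect (Om y); last by rewrite /beta (Omega_not_eta e10 nO) mul0r.
  apply: mulr_ge0; first exact: eta_ge0.
  by apply: mulr_ge0; [exact: zcut_ge0|exact: Qf_ge0].
have bx : 0 < beta x.
  have eta1 : eta m a b e1 x = 1.
    rewrite /eta theta_ge1// /e1 invf_div mulrCA divff ?gt_eqF// mulr1.
    by rewrite lerBrDr.
  have z1 : 0 < zcut m 1 d1 x.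
    have L2 : 0 < 2 * (1 + ln (1 + sigma m x)) by rewrite mulr_gt0// ltr_pwDl.
    have dl : d1 * ln (1 + sigma m x) < 1.
      rewrite /d1 mulrC ltr_pdivrMr// mul1r.
      by move: l0; move: (ln _) => l; lra.
    by rewrite /zcut /sqpos pos_part_id ?exprn_gt0 ?subr_gt0 ?subr_ge0 ?ltW.
  rewrite /beta eta1 mul1r; apply: mulr_gt0 => //; apply: mulr_gt0 => //.
  (* The hypothesis [1 <= m] enters here: for [m = 0] the density [Qf] would be identically zero. *)
  by apply: mulr_gt0; [rewrite ltr0n|exact: phi_gt0].
have I0 := Lint_gt0 cb b0' bx.
pose d := Num.min (Num.min 1 d1) (Lint beta / (2 * C)).
have d0 : 0 < d by rewrite !lt_min ltr01 d10 divr_gt0// mulr_gt0.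
have := HC d; rewrite d0 /= {1}/d ge_min lexx => /(_ isT); rewrite -/beta.
have : d * C <= Lint beta / 2.
  rewrite -ler_pdivlMr// (_ : _ / 2 / C = Lint beta / (2 * C)).
    by rewrite /d ge_min lexx orbT.
  by field; rewrite gt_eqF.
by move: I0; move: (Lint beta) (d * C) => A B; lra.
Qed.

(** [u] is constant along the first axis, which lies in the y-space; following it away from the
    origin increases |y| until the outer sphere, where [u] vanishes. *)
Lemma solution_eq0 x : Om x -> u x = 0.
Proof.
move=> Ox; have /andP[r1 r2] := (OmegaP a0 ab x).1 Ox.
have pu0 y : Om y -> partial i0 u y = 0.
  move=> Oy; have /eqP := gradY_eq0 Oy.
  rewrite /gradY psumr_eq0; last by move=> j _; exact: sqr_ge0.
  by move=> /allP /(_ i0 (mem_index_enum _)); rewrite /= sqrf_eq0 => /eqP.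
(* The sign [s] orients the axis so that |y| does not decrease, which keeps the segment off the
   inner sphere. *)
have [s s1 sx] : exists2 s : R, s ^+ 2 = 1 & 0 <= s * x ord0 i0.
  have [x0|x0] := leP 0 (x ord0 i0); first by exists 1; rewrite ?expr1n ?mul1r.
  by exists (-1); rewrite ?sqrrN ?expr1n// mulN1r oppr_ge0 ltW.
pose v : 'rV[R]_N := s *: ebase R i0.
pose c := s * x ord0 i0.
have rl t : rho m (x + t *: v) = rho m x + 2 * t * c + t ^+ 2.
  rewrite rho_line (_ : rho m v = 1).
    rewrite mulr1; congr (_ + _ * _ + _).
    transitivity (\sum_(i < N | (i < m.+1)%N) (i0 == i)%:R * (s * x ord0 i)).
      by apply: eq_bigr => i _; rewrite !mxE; ring.
    by rewrite sum_delta.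
  rewrite /rho -[RHS]s1; transitivity (\sum_(i < N | (i < m.+1)%N) (i0 == i)%:R * (s ^+ 2 : R)).
    apply: eq_bigr => i _; rewrite !mxE; case: (i0 == i) => /=; last by rewrite !(mulr0, mul0r) expr0n.
    by rewrite mulr1 mul1r.
  by rewrite sum_delta.
pose D := c ^+ 2 + (b ^+ 2 - rho m x).
have D0 : c ^+ 2 < D by rewrite /D ltrDl subr_gt0.
(* The positive root of T^2 + 2 c T + |y|^2 = b^2, the equation of the outer sphere along the
   segment. *)
pose T := Num.sqrt D - c.
have sD : Num.sqrt D ^+ 2 = D by rewrite sqr_sqrtr// (le_trans _ (ltW D0))// sqr_ge0.
have T0 : 0 < T.
  by rewrite subr_gt0 -(ltr_pXn2r (n := 2))// ?nnegrE ?sqrtr_ge0// sD.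
have rT : rho m (x + T *: v) = b ^+ 2.
  rewrite rl /T.
  have -> : rho m x + 2 * (Num.sqrt D - c) * c + (Num.sqrt D - c) ^+ 2 = rho m x - c ^+ 2 + Num.sqrt D ^+ 2 by ring.
  by rewrite sD /D; ring.
have Ot t : 0 <= t < T -> Om (x + t *: v).
  move=> /andP[t0 tT]; apply/(OmegaP a0 ab); apply/andP; split.
    apply: (lt_le_trans r1); rewrite rl -addrA lerDl addr_ge0 ?sqr_ge0//.
    by apply: mulr_ge0 => //; exact: mulr_ge0.
  rewrite -rT !rl; have : 0 <= (T - t) * c by rewrite mulr_ge0// subr_ge0 ltW.
  have : t ^+ 2 < T ^+ 2 by rewrite ltr_pXn2r ?nnegrE// ltW.
  by move: sx; rewrite -/c; move: (rho m x) => r h1 h2 h3; nra.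
have ct t : 0 <= t <= T -> closure Om (x + t *: v).
  move=> /andP[t0]; rewrite le_eqVlt => /predU1P[->|tT].
    by apply/(closure_OmegaP a0 ab); rewrite rT lexx andbT ltW// a2_lt_b2.
  by apply: subset_closure; apply: Ot; rewrite t0.
have uT : u (x + T *: v) = 0.
  apply: u0; first by apply: ct; rewrite lexx andbT ltW.
  by move=> /(OmegaP a0 ab); rewrite rT ltxx andbF.
have dd t : t \in `]0, T[ ->
    is_derive t (1 : R) (fun t => u (x + t *: v)) (\sum_i v ord0 i * partial i u (x + t *: v)).
  rewrite in_itv /= => /andP[t0 tT]; apply: (is_derive_dir oO Cu); apply: Ot.
  by rewrite ltW.
have [t] := MVT T0 dd (within_path uc ct).
rewrite in_itv /= => /andP[t0 tT].
rewrite uT scale0r addr0 sub0r big1 ?mul0r; last first.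
  move=> i _; rewrite !mxE; have [<-|ii] := eqVneq i0 i; last by rewrite mulr0 mul0r.
  by rewrite pu0 ?mulr0//; apply: Ot; rewrite ltW.
by move=> /eqP; rewrite oppr_eq0 => /eqP.
Qed.

End Pohozaev.

Theorem theorem1p1 (R : realType) (N m : nat) (a b p : R)
  (hN : (2 <= N)%N) (hm1 : (1 <= m)%N) (hm2 : (m < N - 2)%N)
  (ha : 0 < a) (hab : a < b)
  (hp : 2 * (N - m)%:R / (N - m - 2)%:R <= p)
  (u : 'rV[R]_N -> R)
  (hC2 : C2_on (Omega N m a b) u)
  (hC1 : C1_closure (Omega N m a b) u)
  (heq : forall x, Omega N m a b x ->
           - laplacian u x = powR `|u x| (p - 2) * u x)
  (hbd : forall x, closure (Omega N m a b) x -> ~ Omega N m a b x -> u x = 0)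
  (hgrad : L1_nonneg_on (Omega N m a b) (grad_sq u))
  (hup : L1_nonneg_on (Omega N m a b) (fun x => powR `|u x| p)) :
  forall x, Omega N m a b x -> u x = 0.
Proof.
have [_ [uc hg]] := hC1.
have [g gP] := choice hg.
have Cu : C1_on (Omega N m a b) u.
  by move=> x Ox; have [cu du] := hC2 x Ox; split=> // i; have [? [? _]] := du i.
have Cpu i : C1_on (Omega N m a b) (partial i u).
  by move=> x Ox; have [_ /(_ i)[_ [ci dij]]] := hC2 x Ox; split.
have hk : (2 < N - m)%N by rewrite ltn_subRL addnC -ltn_subRL.
have e2 : (N - m - 2)%:R = (N - m)%:R - 2 :> R by rewrite natrB// ltnW.
have k2 : 0 < (N - m)%:R - 2 :> R by rewrite -e2 ltr0n subn_gt0.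
have hp' : 2 * (N - m)%:R <= p * ((N - m)%:R - 2) by rewrite -ler_pdivrMr// -e2.
have hp2 : 2 < p.
  rewrite -(ltr_pM2r k2); apply: lt_le_trans hp'.
  by rewrite mulrBr; lra.
(* The lower bound on [p], cleared of denominators and divided by [2 * p]. *)
have hpk : 1 <= (N - m)%:R * (1 / 2 - 1 / p).
  have p0 : 0 < p by exact: lt_trans hp2.
  rewrite -subr_ge0.
  have -> : (N - m)%:R * (1 / 2 - 1 / p) - 1 =
      (p * ((N - m)%:R - 2) - 2 * (N - m)%:R) / (2 * p) by field; rewrite gt_eqF.
  by rewrite divr_ge0 ?subr_ge0// mulr_ge0// ltW.
have [phi [dphi [phiD dphiC phiE phia [phi_gt0 phi_le]]]] :=
  radial_weight_exists m (exprn_gt0 2 ha).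
exact: (solution_eq0 ha hab hm2 hp2 hpk Cu Cpu heq phiD dphiC phiE phi_gt0 phi_le
  uc (fun i => (gP i).1) (fun i => (gP i).2) hbd phia hm1 hgrad hup).
Qed.
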